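(* Let $B=\operatorname{diag}(\beta_1I_{n_1},\dots,\beta_rI_{n_r})=\operatorname{diag}(b_1,\dots,b_n)$, $n_1+\dots+n_r=n$, with $\beta_1,\dots,\beta_r$ distinct and nonzero, and let $Q=(Q_{jk})_{j,k=1}^r=(q_{jk})_{j,k=1}^n\in L^1([0,1];\mathbb C^{n\times n})$ with blocks $Q_{jk}\in L^1([0,1];\mathbb C^{n_j\times n_k})$ satisfying $Q_{jj}\equiv0$, $j\in\{1,\dots,r\}$. Let $p\in\{1,\dots,\nu\}$. Assume, in addition, that $Q$ is continuous at the endpoints $0$ and $1$. Then for sufficiently large $R$ and small $\varepsilon>0$ the equation $-iB^{-1}y'+Q(x)y=\lambda y$ has a fundamental matrix solution $Y(x,\lambda)=(y_{jk}(x,\lambda))_{j,k=1}^n$, analytic with respect to $\lambda\in S_{p,\varepsilon,R}$. Moreover, uniformly in $x\in[0,1]$, $$y_{jk}(x,\lambda)=(\delta_{jk}+o(1))e^{ib_k\lambda x}\quad\text{as }\lambda\to\infty,\ \lambda\in S_{p,\varepsilon,R},\quad j,k\in\{1,\dots,n\},$$ and, as $\lambda\to\infty$, $\lambda\in S_{p,\varepsilon,R}$, $$y_{jk}(0,\lambda)=\begin{cases}0,&\operatorname{Re}(ib_j\lambda)<\operatorname{Re}(ib_k\lambda),\\ \delta_{jk},&b_j=b_k,\\ \dfrac{b_jq_{jk}(0)+o(1)}{b_j-b_k}\cdot\dfrac1\lambda,&\operatorname{Re}(ib_j\lambda)>\operatorname{Re}(ib_k\lambda);\end{cases}$$ $$y_{jk}(1,\lambda)=\begin{cases}\dfrac{b_jq_{jk}(1)+o(1)}{b_j-b_k}\cdot\dfrac{e^{ib_k\lambda}}\lambda,&\operatorname{Re}(ib_j\lambda)<\operatorname{Re}(ib_k\lambda),\\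 (\delta_{jk}+o(1))e^{ib_k\lambda},&b_j=b_k,\\ 0,&\operatorname{Re}(ib_j\lambda)>\operatorname{Re}(ib_k\lambda).\end{cases}$$
   Context: The lines $\{\lambda:\operatorname{Re}(i\beta_j\lambda)=\operatorname{Re}(i\beta_k\lambda)\}$, $1\le j<k\le r$, and $\{\lambda:\operatorname{Re}(i\beta_j\lambda)=0\}$, $1\le j\le r$, divide $\mathbb C$ into open sectors $S_1,\dots,S_\nu$ with vertex at the origin, $S_p=\{z:\varphi_{1p}<\arg z<\varphi_{2p}\}$; put $S_{p,\varepsilon}=\{z:\varphi_{1p}+\varepsilon<\arg z<\varphi_{2p}-\varepsilon\}$ and $S_{p,\varepsilon,R}=\{z\in S_{p,\varepsilon}:|z|>R\}$. Within a sector $S_p$ the sign of $\operatorname{Re}(ib_j\lambda)-\operatorname{Re}(ib_k\lambda)$ is constant for $b_j\neq b_k$. $\delta_{jk}$ is the Kronecker symbol. A fundamental matrix solution is an $n\times n$ matrix whose columns are linearly independent solutions. *)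

(* Defs.v *)
From HB Require Import structures.
From mathcomp Require Import all_boot all_order all_algebra complex.
From mathcomp Require Import all_classical all_reals all_analysis.

Set Implicit Arguments.
Unset Strict Implicit.
Unset Printing Implicit Defensive.

Import numFieldNormedType.Exports.
Import Order.TTheory GRing.Theory Num.Theory.
Local Open Scope classical_set_scope.
Local Open Scope complex_scope.
Local Open Scope ring_scope.

Local Notation Re := complex.Re.
Local Notation Im := complex.Im.

(* The complex numbers are R[i]; the regular module R[i]^o carries the topology
   and the normed-module structure over R[i] itself. The norm `|z| of z : R[i]
   is an element of R[i], so it is compared with real numbers through %:C. *)

Section Complex.
Context {R : realType}.

Definition cexp (z : R[i]) : R[i] :=
  (expR (Re z))%:C * (cos (Im z) +i* sin (Im z)).

(* f'(x) = d for a complex-valued function f of a real variable. *)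
Definition is_cderive (f : R -> R[i]) (x : R) (d : R[i]) : Prop :=
  is_derive x (1 : R) (fun t => Re (f t)) (Re d) /\
  is_derive x (1 : R) (fun t => Im (f t)) (Im d).

(* Absolute continuity on [a, b]: J ranges over the finite families of
   non-overlapping subintervals [(J i).1, (J i).2]. *)
Definition abs_continuous (a b : R) (f : R -> R[i]) : Prop :=
  forall e : R, 0 < e -> exists2 d : R, 0 < d &
    forall (m : nat) (J : 'I_m -> R * R),
      (forall i, [/\ a <= (J i).1, (J i).1 <= (J i).2 & (J i).2 <= b]) ->
      (forall i j, i != j -> (J i).2 <= (J j).1 \/ (J j).2 <= (J i).1) ->
      \sum_(i < m) ((J i).2 - (J i).1) < d ->
      \sum_(i < m) `|f (J i).2 - f (J i).1| < e%:C.

Definition cintegrable01 (f : R -> R[i]) : Prop :=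
  (@lebesgue_measure R).-integrable `[0%R, 1%R] (fun x => (Re (f x))%:E) /\
  (@lebesgue_measure R).-integrable `[0%R, 1%R] (fun x => (Im (f x))%:E).

(* Complex differentiability at every point; used for open S only. *)
Definition analytic_on (S : set R[i]) (f : R[i] -> R[i]) : Prop :=
  forall z, S z -> derivable (f : R[i]^o -> R[i]^o) z 1.

(* The filter "z tends to infinity, z in S". *)
Definition infty_in (S : set R[i]) : set_system R[i] :=
  filter_from [set: R] (fun M => [set z | S z /\ M%:C < `|z|]).

Definition o1 (S : set R[i]) (rho : R[i] -> R[i]) : Prop :=
  (rho : R[i] -> R[i]^o) @ infty_in S --> (0 : R[i]^o).

Definition o1_unif01 (S : set R[i]) (rho : R -> R[i] -> R[i]) : Prop :=
  forall e : R, 0 < e ->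
    \forall z \near infty_in S,
      forall x : R, 0 <= x <= 1 -> `|rho x z| < e%:C.

End Complex.

Section Sectors.
Context {R : realType}.

Definition sector (phi1 phi2 : R) : set R[i] :=
  [set z | exists rho theta : R,
     [/\ 0 < rho, phi1 < theta < phi2 &
         z = (rho * cos theta) +i* (rho * sin theta)]].

Definition trunc_sector (phi1 phi2 eps rad : R) : set R[i] :=
  [set z | sector (phi1 + eps) (phi2 - eps) z /\ rad%:C < `|z|].

Definition sector_lines (r : nat) (beta : 'I_r -> R[i]) : set R[i] :=
  [set z | (exists j k : 'I_r,
              (j < k)%N /\
              Re ('i%C * beta j * z) = Re ('i%C * beta k * z))
        \/ (exists j : 'I_r, Re ('i%C * beta j * z) = 0)].

(* The sectors S_1, ..., S_nu into which the lines divide the plane are the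
   connected components of the complement of the union of the lines. The angles
   are only determined up to a common multiple of 2 * pi. *)
Definition is_sector (r : nat) (beta : 'I_r -> R[i]) (phi1 phi2 : R) : Prop :=
  exists2 z : R[i]^o, ~ sector_lines beta z &
    sector phi1 phi2 =
      connected_component (~` sector_lines beta : set R[i]^o) z.

End Sectors.

Section DiracSystem.
Context {R : realType}.

Definition Bmx (r : nat) (n_ : 'I_r -> nat) (beta : 'I_r -> R[i]) :
    'M[R[i]]_(\sum_i n_ i) :=
  \mxdiag_(i < r) (beta i)%:M.

(* y is an absolutely continuous solution on [0, 1], the equation holding
   almost everywhere, of  - i B^-1 y' + Q(x) y = lambda y. *)
Definition is_solution (n : nat) (B : 'M[R[i]]_n) (Q : R -> 'M[R[i]]_n)
    (lambda : R[i]) (y : R -> 'cV[R[i]]_n) : Prop :=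
  (forall j, abs_continuous 0 1 (fun x => y x j 0)) /\
  {ae @lebesgue_measure R, forall x : R, 0 < x < 1 ->
     exists2 dy : 'cV[R[i]]_n,
       (forall j, is_cderive (fun t => y t j 0) x (dy j 0)) &
       (- 'i%C) *: (invmx B *m dy) + Q x *m y x = lambda *: y x}.

Definition is_fundamental_matrix (n : nat) (B : 'M[R[i]]_n)
    (Q : R -> 'M[R[i]]_n) (lambda : R[i]) (Y : R -> 'M[R[i]]_n) : Prop :=
  (forall k, is_solution B Q lambda (fun x => col k (Y x))) /\
  (forall c : 'cV[R[i]]_n,
     (forall x : R, 0 <= x <= 1 -> \sum_k c k 0 *: col k (Y x) = 0) -> c = 0).

End DiracSystem.

(* Main.v *)
Require Import Defs.
From HB Require Import structures.
From mathcomp Require Import all_boot all_order all_algebra complex.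
From mathcomp Require Import all_classical all_reals all_analysis.
From mathcomp Require Import measurable_realfun ring lra.

(** Fix a column index [k], write [z] for the spectral parameter and put
    [y_j(x) = u_j(x) e^(i b_k z x)]. The system becomes
    [u_j' = i (b_j - b_k) z u_j - i b_j sum_m q_jm u_m]. Integrating the [j]-th
    equation from the endpoint that keeps its exponential bounded, namely from
    [0] when [Re (i b_j z) <= Re (i b_k z)] and from [1] otherwise, turns it
    into an integral equation [u = e_k + K_z u] ([e_k] is [unit_vec], [K_z] is
    [volterra]) whose kernels are bounded uniformly in the closed sector. The
    exact zeros and Kronecker symbols of the statement are the constants of
    integration chosen here.

    [K_z] is not a contraction for large [z], but its square is. Indeed, let
    [w] satisfy [w_m' = i (b_m - b_k) z w_m + g_m] with bounded data. Since the
    diagonal blocks of [Q] vanish, [K_z w] only involves integrals of [q_jm]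
    with [b_m != b_j] against [e^(i (b_j - b_k) z (x - t)) w_m(t)]; this product
    is bounded and its primitive is [O(1/|z|)]. An integrable function has a
    small integral against a bounded function with a small primitive
    ([coscillation_small], a form of the Riemann-Lebesgue lemma), hence [K_z w]
    is small ([volterra_small]). Both [K_z u] and the solution itself are such
    functions [w]. This gives existence ([solve]), an a priori bound uniform in
    [z] ([apriori]) and [u - e_k = K_z u = o(1)] ([column_asym]). Only the signs
    of [Re (i (b_j - b_k) z)] enter, not the distance to the boundary of the
    sector, so that one radius works for all [eps]. Linear independence of the
    columns follows from diagonal dominance at [x = 0].

    For analyticity, the solution [v] of the formally differentiated equation
    is compared with the difference quotient: the a priori bound at the nearby
    parameter [z'] gives [u_z' - u_z - (z' - z) v = O(|z' - z|^2)]
    ([column_diff]).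

    At the endpoint where [u_j] is not prescribed, its value is an integral of
    [q_jm u_m] against an exponential. Multiplied by [i (b_j - b_k) z], this
    exponential becomes an approximate identity concentrating at the endpoint,
    provided [|Re (i (b_j - b_k) z)| >= c |z|], which is what shrinking the
    sector by [eps] ensures; continuity of [Q] there yields the stated leading
    coefficient ([column_end]).

    The coefficients being merely integrable, all the calculus is done with the
    relation [prim_of F f], that is [F(x) = F(0) + int_0^x f] on [0, 1]: it is
    stable under multiplication by exponentials ([prim_of_mulexp]), and it
    implies absolute continuity and the equation almost everywhere
    ([prim_of_abs_continuous], [prim_of_ae]). *)

Set Implicit Arguments.
Unset Strict Implicit.
Unset Printing Implicit Defensive.

Import numFieldNormedType.Exports.
Import Order.TTheory GRing.Theory Num.Theory.
Local Open Scope classical_set_scope.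
Local Open Scope complex_scope.
Local Open Scope ring_scope.

Local Notation Re := complex.Re.
Local Notation Im := complex.Im.

(** * A submultiplicative norm on the complex numbers *)

Section Norm1.
Context {R : realType}.
Implicit Types z w : R[i].

(** The l1 norm is equivalent to the modulus and still submultiplicative, and it
    bounds an integral taken componentwise without any constant. *)
Definition norm1 z : R := `|Re z| + `|Im z|.

Lemma ReM z w : Re (z * w) = Re z * Re w - Im z * Im w.
Proof. by case: z w => [a b] [c d]. Qed.
Lemma ImM z w : Im (z * w) = Re z * Im w + Im z * Re w.
Proof. by case: z w => [a b] [c d]. Qed.
Lemma ReD z w : Re (z + w) = Re z + Re w.
Proof. by case: z w => [a b] [c d]. Qed.
Lemma ImD z w : Im (z + w) = Im z + Im w.
Proof. by case: z w => [a b] [c d]. Qed.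
Lemma ReN z : Re (- z) = - Re z. Proof. by case: z. Qed.
Lemma ImN z : Im (- z) = - Im z. Proof. by case: z. Qed.
Lemma ReB z w : Re (z - w) = Re z - Re w. Proof. by rewrite ReD ReN. Qed.
Lemma ImB z w : Im (z - w) = Im z - Im w. Proof. by rewrite ImD ImN. Qed.
Lemma Re_real (x : R) : Re x%:C = x. Proof. by []. Qed.
Lemma Im_real (x : R) : Im x%:C = 0. Proof. by []. Qed.
Lemma ReMr z (x : R) : Re (z * x%:C) = Re z * x.
Proof. by rewrite ReM mulr0 subr0. Qed.
Lemma ImMr z (x : R) : Im (z * x%:C) = Im z * x.
Proof. by rewrite ImM mulr0 add0r. Qed.

Lemma complexP z w : Re z = Re w -> Im z = Im w -> z = w.
Proof. by case: z w => [a b] [c d] /= -> ->. Qed.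

Lemma norm1_ge0 z : 0 <= norm1 z.
Proof. by rewrite addr_ge0. Qed.
Lemma norm1_0 : norm1 0 = 0.
Proof. by rewrite /norm1 !normr0 addr0. Qed.
Lemma norm1_1 : norm1 1 = 1.
Proof. by rewrite /norm1 /= normr0 normr1 addr0. Qed.
Lemma norm1_i : norm1 'i%C = 1.
Proof. by rewrite /norm1 /= normr0 normr1 add0r. Qed.
Lemma norm1N z : norm1 (- z) = norm1 z.
Proof. by rewrite /norm1 ReN ImN !normrN. Qed.
Lemma norm1B z w : norm1 (z - w) = norm1 (w - z).
Proof. by rewrite -opprB norm1N. Qed.
Lemma norm1D z w : norm1 (z + w) <= norm1 z + norm1 w.
Proof.
by rewrite /norm1 ReD ImD addrACA lerD// ler_normD.
Qed.
Lemma norm1M z w : norm1 (z * w) <= norm1 z * norm1 w.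
Proof.
rewrite /norm1 ReM ImM; apply: (@le_trans _ _ (`|Re z| * `|Re w| +
  `|Im z| * `|Im w| + (`|Re z| * `|Im w| + `|Im z| * `|Re w|))).
  rewrite lerD// -!normrM; last exact: ler_normD.
  by rewrite (le_trans (ler_normD _ _))// normrN.
by rewrite mulrDl !mulrDr; lra.
Qed.
Lemma norm1M_real z (x : R) : norm1 (z * x%:C) = norm1 z * `|x|.
Proof. by rewrite /norm1 ReMr ImMr !normrM mulrDl. Qed.
Lemma norm1_eq0 z : norm1 z <= 0 -> z = 0.
Proof.
rewrite /norm1 => h; apply: complexP => /=.
  by apply/eqP; rewrite -normr_le0 (le_trans _ h)// lerDl.
by apply/eqP; rewrite -normr_le0 (le_trans _ h)// lerDr.
Qed.
Lemma norm1_gt0 z : z != 0 -> 0 < norm1 z.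
Proof.
by move=> z0; rewrite ltNge; apply: contra z0 => /norm1_eq0 ->.
Qed.
Lemma norm1_sum (I : Type) (s : seq I) (P : pred I) (F : I -> R[i]) :
  norm1 (\sum_(i <- s | P i) F i) <= \sum_(i <- s | P i) norm1 (F i).
Proof.
elim/big_ind2 : _ => [|x1 x2 y1 y2 h1 h2|//]; first by rewrite norm1_0.
by rewrite (le_trans (norm1D _ _))// lerD.
Qed.
Lemma ler_Re z : `|Re z| <= norm1 z. Proof. by rewrite lerDl. Qed.
Lemma ler_Im z : `|Im z| <= norm1 z. Proof. by rewrite lerDr. Qed.

(** The modulus is multiplicative and lies between [norm1 / sqrt 2] and [norm1];
    the constant 2 collects the two comparisons. *)
Lemma norm1V z : norm1 z^-1 <= 2 / norm1 z.
Proof.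
have [->|z0] := eqVneq z 0; first by rewrite invr0 norm1_0 invr0 mulr0.
have N0 := norm1_gt0 z0.
case: z z0 N0 => a b z0; rewrite /norm1 /= => N0.
have s0 : 0 < a ^+ 2 + b ^+ 2.
  rewrite lt_def addr_ge0 ?sqr_ge0// andbT paddr_eq0 ?sqr_ge0//.
  rewrite !sqrf_eq0; apply: contra z0 => /andP[/eqP-> /eqP->].
  by rewrite complexr0.
rewrite ler_pdivlMr// normrN !normrM [`|_^-1|]gtr0_norm ?invr_gt0//.
rewrite -mulrDl mulrAC ler_pdivrMr// -expr2 sqrrD !real_normK ?num_real//.
have := sqr_ge0 (`|a| - `|b|); rewrite sqrrB !real_normK ?num_real//.
by lra.
Qed.

Lemma normc_le_norm1 z : `|z| <= (norm1 z)%:C.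
Proof.
have zE : z = (Re z)%:C + 'i%C * (Im z)%:C.
  by case: z => a b; apply: complexP; rewrite /= ?mul0r ?mul1r; ring.
rewrite [in leLHS]zE (le_trans (ler_normD _ _))// normrM.
rewrite !normc_def /= expr0n /= expr1n !addr0 add0r sqrtr1 mul1r !sqrtr_sqr.
by rewrite -rmorphD.
Qed.

Lemma norm1_lt_normc z (e : R) : `|z| < e%:C -> norm1 z < 2 * e.
Proof.
rewrite normc_def ltcR => h.
have e0 : 0 < e by rewrite (le_lt_trans _ h)// sqrtr_ge0.
have hR : `|Re z| <= Num.sqrt (Re z ^+ 2 + Im z ^+ 2).
  by rewrite -sqrtr_sqr ler_sqrt ?addr_ge0 ?sqr_ge0// lerDl sqr_ge0.
have hI : `|Im z| <= Num.sqrt (Re z ^+ 2 + Im z ^+ 2).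
  by rewrite -sqrtr_sqr ler_sqrt ?addr_ge0 ?sqr_ge0// lerDr sqr_ge0.
by rewrite /norm1; lra.
Qed.

Lemma norm1_lt_lt_normc z (e : R) : norm1 z < e -> `|z| < e%:C.
Proof. by move=> h; rewrite (le_lt_trans (normc_le_norm1 _))// ltcR. Qed.

Lemma normc_lt_norm1 z (e : R) : e%:C < `|z| -> e < norm1 z.
Proof. by move=> h; rewrite -ltcR (lt_le_trans h)// normc_le_norm1. Qed.

End Norm1.

(** * The complex exponential *)

Section Cexp.
Context {R : realType}.
Implicit Types z w : R[i].

Lemma Re_cexp z : Re (cexp z) = expR (Re z) * cos (Im z).
Proof. by rewrite /cexp ReM /= mul0r subr0. Qed.
Lemma Im_cexp z : Im (cexp z) = expR (Re z) * sin (Im z).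
Proof. by rewrite /cexp ImM /= mul0r addr0. Qed.

Lemma cexpD z w : cexp (z + w) = cexp z * cexp w.
Proof.
apply: complexP.
  by rewrite Re_cexp ReD ImD expRD cosD [RHS]ReM !Re_cexp !Im_cexp; ring.
by rewrite Im_cexp ReD ImD expRD sinD [RHS]ImM !Re_cexp !Im_cexp; ring.
Qed.

Lemma cexp0 : cexp (0 : R[i]) = 1.
Proof.
by apply: complexP; rewrite ?Re_cexp ?Im_cexp /= expR0 ?cos0 ?sin0 !mul1r.
Qed.

Lemma cexpNK z : cexp z * cexp (- z) = 1.
Proof. by rewrite -cexpD subrr cexp0. Qed.

Lemma norm1_cexp z : norm1 (cexp z) <= 2 * expR (Re z).
Proof.
rewrite /norm1 Re_cexp Im_cexp !normrM ger0_norm ?expR_ge0// -mulrDr mulrC.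
by rewrite ler_wpM2r ?expR_ge0// (_ : 2 = 1 + 1)// lerD// ler_norml
  ?cos_geN1 ?cos_le1 ?sin_geN1 ?sin_le1.
Qed.

Lemma norm1_cexp_le0 z : Re z <= 0 -> norm1 (cexp z) <= 2.
Proof.
move=> h; rewrite (le_trans (norm1_cexp z))// -[leRHS]mulr1 ler_wpM2l//.
by rewrite -expR0 ler_expR.
Qed.

End Cexp.

(** * Primitives of integrable real functions *)

Section Primitive.
Context {R : realType}.
Local Notation mu := (@lebesgue_measure R).
Implicit Types (f g : R -> R).

Definition int01 f := mu.-integrable `[0%R, 1%R] (EFin \o f).
Definition prim f (x : R) : R := \int[mu]_(t in `[0%R, x]) f t.

Lemma int01S f x y : int01 f -> 0 <= x -> y <= 1 ->
  mu.-integrable `[x, y] (EFin \o f).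
Proof.
move=> h x0 y1; apply: integrableS h => //.
by apply: subset_itv; rewrite bnd_simp.
Qed.

Lemma int01So f x y : int01 f -> 0 <= x -> y <= 1 ->
  mu.-integrable `]x, y] (EFin \o f).
Proof.
move=> h x0 y1; apply: integrableS h => //.
by apply: subset_itv; rewrite bnd_simp.
Qed.

Lemma int01P f x : int01 f -> x <= 1 -> mu.-integrable `[0, x] (EFin \o f).
Proof. by move=> h x1; exact: int01S. Qed.

Lemma int01D f g : int01 f -> int01 g -> int01 (fun t => f t + g t).
Proof.
by move=> hf hg; apply: eq_integrable (integrableD _ hf hg).
Qed.
Lemma int01Z f c : int01 f -> int01 (fun t => c * f t).
Proof.
by move=> hf; apply: eq_integrable (integrableZl _ c hf).
Qed.
Lemma int01N f : int01 f -> int01 (fun t => - f t).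
Proof.
by move=> /(int01Z (-1)); congr (_ : Prop); congr int01; apply/funext => t; rewrite mulN1r.
Qed.
Lemma int01B f g : int01 f -> int01 g -> int01 (fun t => f t - g t).
Proof. by move=> hf hg; apply: int01D => //; exact: int01N. Qed.
Lemma int01_norm f : int01 f -> int01 (fun t => `|f t|).
Proof. by move=> /integrable_norm. Qed.
Lemma int01_eq f g : (forall t, 0 <= t <= 1 -> f t = g t) -> int01 f -> int01 g.
Proof.
move=> fg; apply: eq_integrable => // t; rewrite inE/= in_itv/= => ht.
by rewrite fg.
Qed.
Lemma int01_cst c : int01 (fun=> c).
Proof.
apply: measurable_bounded_integrable => //.
  by rewrite /= lebesgue_measure_itv/= lte_fin ltr01 oppr0 adde0 ltry.
by exists `|c|; split => // M cM t _ /=; exact: ltW.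
Qed.

Definition meas01 f := measurable_fun (`[0%R, 1%R] : set R) f.

Lemma int01M f g M : int01 f -> meas01 g ->
  (forall t, 0 <= t <= 1 -> `|g t| <= M) -> int01 (fun t => f t * g t).
Proof.
move=> hf mg gM.
suff bg : [bounded g x | x in `[0%R, 1%R] : set R].
  by apply: eq_integrable (integrableMl _ hf mg bg).
exists M; split; first exact: num_real.
move=> K MK t /=; rewrite in_itv/= => ht.
by rewrite (le_trans (gM _ ht))// ltW.
Qed.

Lemma int01_bounded g M : meas01 g ->
  (forall t, 0 <= t <= 1 -> `|g t| <= M) -> int01 g.
Proof.
move=> mg gM; apply: int01_eq (int01M (int01_cst 1) mg gM) => t _.
by rewrite mul1r.
Qed.

Lemma cont_meas01 f : continuous f -> meas01 f.
Proof.
by move=> cf; apply: measurable_funTS; exact: continuous_measurable_fun.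
Qed.

Lemma prim0 f : prim f 0 = 0.
Proof. by rewrite /prim set_itv1 Rintegral_set1. Qed.

Lemma primD f g x : int01 f -> int01 g -> x <= 1 ->
  prim (fun t => f t + g t) x = prim f x + prim g x.
Proof. by move=> hf hg x1; apply: RintegralD => //; exact: int01P. Qed.

Lemma primB f g x : int01 f -> int01 g -> x <= 1 ->
  prim (fun t => f t - g t) x = prim f x - prim g x.
Proof. by move=> hf hg x1; apply: RintegralB => //; exact: int01P. Qed.

Lemma primZ f c x : int01 f -> x <= 1 -> prim (fun t => c * f t) x = c * prim f x.
Proof. by move=> hf x1; apply: RintegralZl => //; exact: int01P. Qed.

Lemma prim_eq f g x : (forall t, 0 <= t <= x -> f t = g t) -> prim f x = prim g x.
Proof.
by move=> fg; apply: eq_Rintegral => t; rewrite inE/= in_itv/=; exact: fg.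
Qed.

Lemma prim_diff f x y : int01 f -> 0 <= x -> x <= y -> y <= 1 ->
  prim f y - prim f x = \int[mu]_(t in `]x, y]) f t.
Proof.
move=> hf x0 xy y1; rewrite /prim Rintegral_itvB ?bnd_simp//.
exact: int01P.
Qed.

Lemma prim_le f g x y : int01 f -> int01 g -> 0 <= x -> x <= y -> y <= 1 ->
  (forall t, x <= t <= y -> f t <= g t) ->
  prim f y - prim f x <= prim g y - prim g x.
Proof.
move=> hf hg x0 xy y1 fg; rewrite !prim_diff//; apply: le_Rintegral => //.
- exact: int01So.
- exact: int01So.
- by move=> t /=; rewrite in_itv/= => /andP[/ltW xt ty]; rewrite fg// xt.
Qed.

Lemma prim_norm f x y : int01 f -> 0 <= x -> x <= y -> y <= 1 ->
  `|prim f y - prim f x| <= prim (fun t => `|f t|) y - prim (fun t => `|f t|) x.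
Proof.
move=> hf x0 xy y1; rewrite !prim_diff//; last exact: int01_norm.
by apply: le_normr_Rintegral => //; exact: int01So.
Qed.

Lemma prim_cst c x : 0 <= x -> prim (fun=> c) x = c * x.
Proof.
move=> x0; rewrite /prim Rintegral_cst//= lebesgue_measure_itv/= lte_fin.
move: x0; rewrite le_eqVlt => /predU1P[<-|x0]; first by rewrite ltxx.
by rewrite x0 oppr0 adde0.
Qed.

Lemma prim_le_bound f g x y M : int01 f -> int01 g -> 0 <= x -> x <= y -> y <= 1 ->
  (forall t, x <= t <= y -> `|f t| <= M * g t) ->
  `|prim f y - prim f x| <= M * (prim g y - prim g x).
Proof.
move=> hf hg x0 xy y1 fg; apply: (le_trans (prim_norm hf x0 xy y1)).
rewrite mulrBr -!(primZ _ hg)//; last by rewrite (le_trans xy).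
apply: prim_le => //; [exact: int01_norm|exact: int01Z].
Qed.

Lemma prim_homo f x y : int01 f -> 0 <= x -> x <= y -> y <= 1 ->
  (forall t, 0 <= t <= 1 -> 0 <= f t) -> prim f x <= prim f y.
Proof.
move=> hf x0 xy y1 f0; rewrite -subr_ge0.
have <- : prim (fun=> 0) y - prim (fun=> 0) x = 0.
  by rewrite !prim_cst ?mul0r ?subrr// (le_trans x0).
apply: prim_le => //; first exact: int01_cst.
move=> t /andP[xt ty]; apply: f0.
by rewrite (le_trans x0)//= (le_trans ty).
Qed.

Lemma prim_deriv (F f : R -> R) x : (forall t : R, is_derive t (1 : R) F (f t)) ->
  continuous f -> 0 <= x -> prim f x = F x - F 0.
Proof.
move=> dF cf; rewrite le_eqVlt => /predU1P[<-|x0]; first by rewrite prim0 subrr.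
have cF : continuous F.
  move=> t; apply: differentiable_continuous; apply/derivable1_diffP.
  exact: (@ex_derive _ _ _ _ _ _ _ (dF t)).
rewrite /prim /Rintegral (@continuous_FTC2 _ f F)//.
- by apply: continuous_subspaceT.
- split.
  + by move=> t _; exact: (@ex_derive _ _ _ _ _ _ _ (dF t)).
  + by apply: cvg_at_right_filter; exact: cF.
  + by apply: cvg_at_left_filter; exact: cF.
- by move=> t _; rewrite derive1E; exact: derive_val.
Qed.

End Primitive.

(** * Primitives of integrable complex functions *)

Section ComplexPrimitive.
Context {R : realType}.
Implicit Types (f g F G : R -> R[i]) (c : R[i]).

Definition cint f := cintegrable01 f.
Definition cprim f (x : R) : R[i] :=
  prim (fun t => Re (f t)) x +i* prim (fun t => Im (f t)) x.

(** The class of multipliers that preserve integrability on [0, 1]. *)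
Definition bmeas f := [/\ meas01 (fun t => Re (f t)), meas01 (fun t => Im (f t)) &
  exists M : R, forall t, 0 <= t <= 1 -> norm1 (f t) <= M].

Lemma eq_fun_int01 (f g : R -> R) : f =1 g -> int01 f -> int01 g.
Proof. by move=> /funext ->. Qed.

Lemma cint_eq f g : (forall t, 0 <= t <= 1 -> f t = g t) -> cint f -> cint g.
Proof.
move=> fg [h1 h2]; split.
  by apply: (@int01_eq _ (fun t => Re (f t))) => // t /fg ->.
by apply: (@int01_eq _ (fun t => Im (f t))) => // t /fg ->.
Qed.

Lemma cintD f g : cint f -> cint g -> cint (fun t => f t + g t).
Proof.
move=> [f1 f2] [g1 g2]; split.
  by apply: eq_fun_int01 (int01D f1 g1) => t; rewrite ReD.
by apply: eq_fun_int01 (int01D f2 g2) => t; rewrite ImD.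
Qed.

Lemma cintZ f c : cint f -> cint (fun t => c * f t).
Proof.
move=> [f1 f2]; split.
  apply: eq_fun_int01 (int01B (int01Z (Re c) f1) (int01Z (Im c) f2)) => t.
  by rewrite ReM.
apply: eq_fun_int01 (int01D (int01Z (Re c) f2) (int01Z (Im c) f1)) => t.
by rewrite ImM.
Qed.

Lemma cintN f : cint f -> cint (fun t => - f t).
Proof. by move=> hf; apply: cint_eq (cintZ (-1) hf) => t _; rewrite mulN1r. Qed.

Lemma cintB f g : cint f -> cint g -> cint (fun t => f t - g t).
Proof. by move=> hf hg; apply: cintD => //; exact: cintN. Qed.

Lemma cintM f g : cint f -> bmeas g -> cint (fun t => f t * g t).
Proof.
move=> [f1 f2] [g1 g2 [M gM]].
have gR t : 0 <= t <= 1 -> `|Re (g t)| <= M.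
  by move=> ht; rewrite (le_trans (ler_Re _))// gM.
have gI t : 0 <= t <= 1 -> `|Im (g t)| <= M.
  by move=> ht; rewrite (le_trans (ler_Im _))// gM.
split.
  apply: eq_fun_int01 (int01B (int01M f1 g1 gR) (int01M f2 g2 gI)) => t.
  by rewrite ReM.
apply: eq_fun_int01 (int01D (int01M f1 g2 gI) (int01M f2 g1 gR)) => t.
by rewrite ImM.
Qed.

Lemma cintMl f g : cint f -> bmeas g -> cint (fun t => g t * f t).
Proof.
by move=> hf hg; apply: cint_eq (cintM hf hg) => t _; rewrite mulrC.
Qed.

Lemma cint_cst c : cint (fun=> c).
Proof. by split; exact: int01_cst. Qed.

Lemma bmeas_cint g : bmeas g -> cint g.
Proof.
by move=> hg; apply: cint_eq (cintM (cint_cst 1) hg) => t _; rewrite mul1r.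
Qed.

Lemma cint_sum (I : Type) (s : seq I) (P : pred I) (F : I -> R -> R[i]) :
  (forall i, cint (F i)) -> cint (fun t => \sum_(i <- s | P i) F i t).
Proof.
move=> hF; elim: s => [|i s IH].
  by apply: cint_eq (cint_cst 0) => t _; rewrite big_nil.
case Pi: (P i); last by apply: cint_eq IH => t _; rewrite big_cons Pi.
by apply: cint_eq (cintD (hF i) IH) => t _; rewrite big_cons Pi.
Qed.

Lemma cint_norm1 f : cint f -> int01 (fun t => norm1 (f t)).
Proof. by move=> [f1 f2]; apply: int01D; apply: int01_norm. Qed.

Lemma cprim0 f : cprim f 0 = 0.
Proof. by rewrite /cprim !prim0. Qed.

Lemma cprim_eq f g x : (forall t, 0 <= t <= x -> f t = g t) -> cprim f x = cprim g x.
Proof. by move=> fg; congr (_ +i* _); apply: prim_eq => t /fg ->. Qed.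

Lemma cprimD f g x : cint f -> cint g -> x <= 1 ->
  cprim (fun t => f t + g t) x = cprim f x + cprim g x.
Proof.
move=> [f1 f2] [g1 g2] x1; apply: complexP; rewrite ?ReD ?ImD/= -primD//.
  by apply: prim_eq => t _; rewrite ReD.
by apply: prim_eq => t _; rewrite ImD.
Qed.

Lemma cprimZ f c x : cint f -> x <= 1 ->
  cprim (fun t => c * f t) x = c * cprim f x.
Proof.
move=> [f1 f2] x1; apply: complexP; rewrite ?[in RHS]ReM ?[in RHS]ImM/=.
  rewrite -!primZ// -primB//; try exact: int01Z.
  by apply: prim_eq => t _; rewrite ReM.
rewrite -!primZ// -primD//; try exact: int01Z.
by apply: prim_eq => t _; rewrite ImM.
Qed.

Lemma cprimB f g x : cint f -> cint g -> x <= 1 ->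
  cprim (fun t => f t - g t) x = cprim f x - cprim g x.
Proof.
move=> hf hg x1; rewrite cprimD//; last exact: cintN.
congr (_ + _); rewrite -mulN1r -cprimZ//.
by apply: cprim_eq => t _; rewrite mulN1r.
Qed.

Lemma cprim_cst c x : 0 <= x -> cprim (fun=> c) x = c * x%:C.
Proof.
by move=> x0; apply: complexP; rewrite ?ReMr ?ImMr/= prim_cst.
Qed.

Lemma cprim_sum (I : Type) (s : seq I) (P : pred I) (F : I -> R -> R[i]) x :
  (forall i, cint (F i)) -> 0 <= x <= 1 ->
  cprim (fun t => \sum_(i <- s | P i) F i t) x = \sum_(i <- s | P i) cprim (F i) x.
Proof.
move=> hF /andP[x0 x1]; elim: s => [|i s IH].
  rewrite big_nil -[RHS](mul0r x%:C) -cprim_cst//.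
  by apply: cprim_eq => t _; rewrite big_nil.
rewrite big_cons; case Pi: (P i); rewrite -?IH -?cprimD//; try exact: cint_sum.
  by apply: cprim_eq => t _; rewrite big_cons Pi.
by apply: cprim_eq => t _; rewrite big_cons Pi.
Qed.

Lemma cprim_bound f (g : R -> R) x y : cint f -> int01 g ->
  0 <= x -> x <= y -> y <= 1 ->
  (forall t, x <= t <= y -> norm1 (f t) <= g t) ->
  norm1 (cprim f y - cprim f x) <= prim g y - prim g x.
Proof.
move=> hf hg x0 xy y1 fg; have [f1 f2] := hf.
rewrite /norm1 ReB ImB /=.
rewrite (le_trans (lerD (prim_norm f1 x0 xy y1) (prim_norm f2 x0 xy y1)))//.
rewrite addrACA -opprD -!primD//; try exact: int01_norm; last first.
  by rewrite (le_trans xy).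
by apply: prim_le => //; exact: (cint_norm1 hf).
Qed.

Lemma cprim_bound_norm1 f x y : cint f -> 0 <= x -> x <= y -> y <= 1 ->
  norm1 (cprim f y - cprim f x) <=
    prim (fun t => norm1 (f t)) y - prim (fun t => norm1 (f t)) x.
Proof. by move=> hf *; apply: cprim_bound => //; exact: cint_norm1. Qed.

Lemma prim_ge0 (f : R -> R) x y : int01 f -> 0 <= x -> x <= y -> y <= 1 ->
  (forall t, 0 <= t <= 1 -> 0 <= f t) -> 0 <= prim f y - prim f x.
Proof. by move=> *; rewrite subr_ge0; exact: prim_homo. Qed.

Lemma prim_diff_le (f : R -> R) x y : int01 f -> 0 <= x -> x <= y -> y <= 1 ->
  (forall t, 0 <= t <= 1 -> 0 <= f t) -> prim f y - prim f x <= prim f 1.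
Proof.
move=> hf x0 xy y1 f0.
have h1 : prim f y <= prim f 1 by apply: prim_homo => //; exact: le_trans xy.
have h2 : prim f 0 <= prim f x by apply: prim_homo => //; exact: le_trans y1.
by move: h2; rewrite prim0 => h2; lra.
Qed.

Lemma prim_continuous_measurable (f : R -> R) : int01 f -> meas01 (prim f).
Proof.
move=> hf; apply: subspace_continuous_measurable_fun => //.
exact: (@parameterized_integral_continuous _ 0 1).
Qed.

Lemma bmeasD f g : bmeas f -> bmeas g -> bmeas (fun t => f t + g t).
Proof.
move=> [f1 f2 [M fM]] [g1 g2 [N gN]]; split.
- rewrite /meas01 (_ : (fun _ => _) = (fun t => Re (f t)) \+ (fun t => Re (g t))).
    exact: measurable_funD.
  by apply/funext => t /=; rewrite ReD.
- rewrite /meas01 (_ : (fun _ => _) = (fun t => Im (f t)) \+ (fun t => Im (g t))).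
    exact: measurable_funD.
  by apply/funext => t /=; rewrite ImD.
- by exists (M + N) => t ht; rewrite (le_trans (norm1D _ _))// lerD ?fM ?gN.
Qed.

Lemma bmeasM f g : bmeas f -> bmeas g -> bmeas (fun t => f t * g t).
Proof.
move=> [f1 f2 [M fM]] [g1 g2 [N gN]]; split.
- rewrite /meas01 (_ : (fun _ => _) =
    ((fun t => Re (f t)) \* (fun t => Re (g t))) \-
    ((fun t => Im (f t)) \* (fun t => Im (g t)))).
    by apply: measurable_funB; exact: measurable_funM.
  by apply/funext => t /=; rewrite ReM.
- rewrite /meas01 (_ : (fun _ => _) =
    ((fun t => Re (f t)) \* (fun t => Im (g t))) \+
    ((fun t => Im (f t)) \* (fun t => Re (g t)))).
    by apply: measurable_funD; exact: measurable_funM.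
  by apply/funext => t /=; rewrite ImM.
- exists (M * N) => t ht; rewrite (le_trans (norm1M _ _))//.
  by rewrite ler_pM ?norm1_ge0 ?fM ?gN.
Qed.

Lemma bmeas_cst c : bmeas (fun=> c).
Proof.
split; [exact: measurable_cst|exact: measurable_cst|].
by exists (norm1 c).
Qed.

Lemma bmeasZ f c : bmeas f -> bmeas (fun t => c * f t).
Proof. by move=> hf; apply: bmeasM => //; exact: bmeas_cst. Qed.

Lemma bmeasB f g : bmeas f -> bmeas g -> bmeas (fun t => f t - g t).
Proof.
move=> hf hg; apply: bmeasD => //.
by rewrite (_ : (fun _ => _) = (fun t => -1 * g t)); [exact: bmeasZ|
  apply/funext => t; rewrite mulN1r].
Qed.

Lemma bmeas_cprim f : cint f -> bmeas (cprim f).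
Proof.
move=> hf; have [f1 f2] := hf; split; [exact: prim_continuous_measurable..|].
exists (prim (fun t => norm1 (f t)) 1) => t /andP[t0 t1].
rewrite -[cprim f t]subr0 -(cprim0 f).
rewrite (le_trans (cprim_bound_norm1 hf _ _ _))//.
apply: prim_diff_le => //; [exact: cint_norm1|by move=> *; exact: norm1_ge0].
Qed.

Lemma bmeas_eq f g : (forall t, 0 <= t <= 1 -> f t = g t) -> bmeas f -> bmeas g.
Proof.
move=> fg [h1 h2 [M hM]]; split.
- apply: eq_measurable_fun h1 => t; rewrite inE/= in_itv/= => ht.
  by rewrite fg.
- apply: eq_measurable_fun h2 => t; rewrite inE/= in_itv/= => ht.
  by rewrite fg.
- by exists M => t ht; rewrite -fg// hM.
Qed.

(** Absolute continuity in integral form; [prim_of_ae] recovers the derivative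
    almost everywhere. *)
Definition prim_of F f :=
  cint f /\ forall x, 0 <= x <= 1 -> F x = F 0 + cprim f x.

Lemma prim_of_diff F f x y : prim_of F f -> 0 <= x -> x <= y -> y <= 1 ->
  F y - F x = cprim f y - cprim f x.
Proof.
move=> [_ h] x0 xy y1; rewrite (h x) ?x0 ?(le_trans xy)//.
by rewrite (h y) ?y1 ?(le_trans x0 xy)//; ring.
Qed.

Lemma prim_of_bmeas F f : prim_of F f -> bmeas F.
Proof.
move=> [fi Ff]; apply: (@bmeas_eq (fun t => F 0 + cprim f t)).
  by move=> t ht; rewrite [RHS]Ff.
by apply: bmeasD; [exact: bmeas_cst|exact: bmeas_cprim].
Qed.

Lemma prim_of_eq F f G g : (forall t, 0 <= t <= 1 -> F t = G t) ->
  (forall t, 0 <= t <= 1 -> f t = g t) -> prim_of F f -> prim_of G g.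
Proof.
move=> FG fg [fi Ff]; split; first exact: cint_eq fi.
move=> x hx; rewrite -!FG// ?lexx ?ler01// Ff//; congr (_ + _).
apply: cprim_eq => t /andP[t0 tx]; rewrite fg// t0 (le_trans tx)//.
by case/andP: hx.
Qed.

Lemma prim_of_cst c : prim_of (fun=> c) (fun=> 0).
Proof.
split; first exact: cint_cst.
by move=> x /andP[x0 _]; rewrite cprim_cst// mul0r addr0.
Qed.

Lemma prim_of_cprim f : cint f -> prim_of (cprim f) f.
Proof. by move=> hf; split => // x _; rewrite cprim0 add0r. Qed.

Lemma prim_ofD F f G g : prim_of F f -> prim_of G g ->
  prim_of (fun t => F t + G t) (fun t => f t + g t).
Proof.
move=> [fi Ff] [gi Gg]; split; first exact: cintD.
move=> x hx; rewrite (Ff x)// (Gg x)// cprimD//; first by ring.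
by case/andP: hx.
Qed.

Lemma prim_ofZ F f c : prim_of F f -> prim_of (fun t => c * F t) (fun t => c * f t).
Proof.
move=> [fi Ff]; split; first exact: cintZ.
move=> x hx; rewrite (Ff x)// cprimZ//; first by ring.
by case/andP: hx.
Qed.

(** This is the fundamental theorem of calculus for the real and imaginary parts,
    [e^(Re c t) cos (Im c t)] and [e^(Re c t) sin (Im c t)]. *)
Lemma prim_of_exp (c : R[i]) :
  prim_of (fun t => cexp (c * t%:C)) (fun t => c * cexp (c * t%:C)).
Proof.
pose e (t : R) := expR (Re c * t).
have dlin (k t : R) : is_derive t (1 : R) ( *%R k) k.
  by have := is_deriveZ k (is_derive_id t (1 : R)); rewrite /GRing.scale/= mulr1.
have dexp (t : R) : is_derive t (1 : R) e (Re c * e t).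
  rewrite mulrC; apply: (@is_derive1_comp _ expR ( *%R (Re c))).
have dcos (t : R) : is_derive t (1 : R) (fun t => cos (Im c * t)) (Im c * - sin (Im c * t)).
  rewrite mulrC; apply: (@is_derive1_comp _ cos ( *%R (Im c))).
have dsin (t : R) : is_derive t (1 : R) (fun t => sin (Im c * t)) (Im c * cos (Im c * t)).
  rewrite mulrC; apply: (@is_derive1_comp _ sin ( *%R (Im c))).
have H1 (t : R) : is_derive t (1 : R) (fun t => Re (cexp (c * t%:C)))
    (Re (c * cexp (c * t%:C))).
  rewrite (_ : (fun _ => _) = e * (fun t => cos (Im c * t))); last first.
    by apply/funext => s; rewrite Re_cexp ReMr ImMr.
  apply: is_derive_eq.
  by rewrite ReM Re_cexp Im_cexp ReMr ImMr /GRing.scale /= -/(e t); ring.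
have H2 (t : R) : is_derive t (1 : R) (fun t => Im (cexp (c * t%:C)))
    (Im (c * cexp (c * t%:C))).
  rewrite (_ : (fun _ => _) = e * (fun t => sin (Im c * t))); last first.
    by apply/funext => s; rewrite Im_cexp ReMr ImMr.
  apply: is_derive_eq.
  by rewrite ImM Re_cexp Im_cexp ReMr ImMr /GRing.scale /= -/(e t); ring.
have cR : continuous (fun t : R => Re (cexp (c * t%:C))).
  move=> t; apply: differentiable_continuous; apply/derivable1_diffP.
  exact: (@ex_derive _ _ _ _ _ _ _ (H1 t)).
have cI : continuous (fun t : R => Im (cexp (c * t%:C))).
  move=> t; apply: differentiable_continuous; apply/derivable1_diffP.
  exact: (@ex_derive _ _ _ _ _ _ _ (H2 t)).
have cR' : continuous (fun t : R => Re (c * cexp (c * t%:C))).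
  rewrite (_ : (fun _ => _) =
    (fun t => Re c * Re (cexp (c * t%:C)) - Im c * Im (cexp (c * t%:C)))).
    by move=> t; apply: cvgB; apply: cvgM; [exact: cvg_cst|exact: cR|exact: cvg_cst|exact: cI].
  by apply/funext => t; rewrite ReM.
have cI' : continuous (fun t : R => Im (c * cexp (c * t%:C))).
  rewrite (_ : (fun _ => _) =
    (fun t => Re c * Im (cexp (c * t%:C)) + Im c * Re (cexp (c * t%:C)))).
    by move=> t; apply: cvgD; apply: cvgM; [exact: cvg_cst|exact: cI|exact: cvg_cst|exact: cR].
  by apply/funext => t; rewrite ImM.
have bexp : bmeas (fun t : R => cexp (c * t%:C)).
  split; [exact: cont_meas01|exact: cont_meas01|].
  exists (2 * expR `|Re c|) => t /andP[t0 t1].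
  rewrite (le_trans (norm1_cexp _))// ler_wpM2l// ler_expR ReMr.
  by rewrite (le_trans (ler_norm _))// normrM ler_piMr// ger0_norm.
split; first by apply: cintZ; exact: bmeas_cint.
move=> x /andP[x0 x1]; apply: complexP.
  by rewrite [RHS]ReD (prim_deriv H1 cR' x0 : Re (cprim _ x) = _) addrC subrK.
by rewrite [RHS]ImD (prim_deriv H2 cI' x0 : Im (cprim _ x) = _) addrC subrK.
Qed.

Lemma bmeas_exp (c : R[i]) : bmeas (fun t => cexp (c * t%:C)).
Proof. exact: prim_of_bmeas (prim_of_exp c). Qed.

End ComplexPrimitive.

(** * Product of a primitive and an exponential *)

Section ProductRule.
Context {R : realType}.
Implicit Types (f g F G : R -> R[i]) (c : R[i]).

Definition gridpt (x y : R) (m i : nat) : R := x + (y - x) * (i%:R / m%:R).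

Lemma gridpt0 x y m : gridpt x y m 0 = x.
Proof. by rewrite /gridpt mul0r mulr0 addr0. Qed.
Lemma gridptm x y m : (0 < m)%N -> gridpt x y m m = y.
Proof.
by move=> m0; rewrite /gridpt divff ?pnatr_eq0 -?lt0n// mulr1 addrC subrK.
Qed.
Lemma gridpt_step x y m i : gridpt x y m i.+1 - gridpt x y m i = (y - x) / m%:R.
Proof. by rewrite /gridpt -natr1; ring. Qed.
Lemma gridpt_le x y m i : x <= y -> gridpt x y m i <= gridpt x y m i.+1.
Proof.
by move=> xy; rewrite -subr_ge0 gridpt_step divr_ge0// subr_ge0.
Qed.
Lemma gridpt_itv x y m i : x <= y -> (i <= m)%N -> (0 < m)%N ->
  x <= gridpt x y m i <= y.
Proof.
move=> xy im m0; rewrite /gridpt lerDl mulr_ge0 ?subr_ge0 ?divr_ge0//=.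
rewrite -lerBrDl ler_piMr ?subr_ge0// ler_pdivrMr ?ltr0n// mul1r ler_nat//.
Qed.

Lemma gridpt_telescope (V : zmodType) (F : R -> V) x y m : (0 < m)%N ->
  F y - F x = \sum_(0 <= i < m) (F (gridpt x y m i.+1) - F (gridpt x y m i)).
Proof.
move=> m0; rewrite (telescope_sumr (fun i => F (gridpt x y m i)))//.
by rewrite gridpt0 gridptm.
Qed.

(** On the grid of [m] equal steps from [0] to [x] the increments add up to at most
    [x (Phi x - Phi 0) / m], and [m] is arbitrary. *)
Lemma const_of_small_increments (H : R -> R[i]) (Phi : R -> R) :
  (forall x y, 0 <= x -> x <= y -> y <= 1 ->
    norm1 (H y - H x) <= (y - x) * (Phi y - Phi x)) ->
  forall x, 0 <= x <= 1 -> H x = H 0.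
Proof.
move=> hH x /andP[x0 x1]; apply/eqP; rewrite -subr_eq0; apply/eqP.
apply: norm1_eq0.
have key m : (0 < m)%N -> norm1 (H x - H 0) * m%:R <= x * (Phi x - Phi 0).
  move=> m0; rewrite -ler_pdivlMr ?ltr0n//.
  rewrite (gridpt_telescope _ _ _ m0) (le_trans (norm1_sum _ _ _))//.
  rewrite (@le_trans _ _ (\sum_(0 <= i < m) x / m%:R *
    (Phi (gridpt 0 x m i.+1) - Phi (gridpt 0 x m i))))//.
    apply: ler_sum_nat => i /andP[_ im].
    have /andP[p0 px] := gridpt_itv x0 (ltnW im) m0.
    have /andP[q0 qx] := gridpt_itv x0 im m0.
    rewrite (le_trans (hH _ _ p0 (gridpt_le _ _ x0) (le_trans qx x1)))//.
    by rewrite gridpt_step subr0.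
  by rewrite -mulr_sumr -gridpt_telescope// mulrAC.
rewrite leNgt; apply/negP => h.
set K := x * _ in key.
have [m hm] : exists m : nat, K / norm1 (H x - H 0) < m%:R.
  by eexists; apply: (le_lt_trans (ler_norm _)); exact: truncnS_gt.
have := key m.+1 isT; rewrite leNgt => /negP; apply.
rewrite -ltr_pdivrMl// mulrC (lt_trans hm)// ltr_nat//.
Qed.

(** Let [H] be the difference between [e^(c x) G(x)] and the integral of the claimed
    derivative. Its increment over [x, y] is the integral of
    [(e^(c y) - e^(c t)) g(t) + c e^(c t) (G(x) - G(t))], where each term is bounded by
    a multiple of [(y - x)] times the mass of [g] on [x, y]; so
    [const_of_small_increments] applies. *)
Lemma prim_of_mulexp G g c : prim_of G g ->
  prim_of (fun t => cexp (c * t%:C) * G t)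
          (fun t => c * cexp (c * t%:C) * G t + cexp (c * t%:C) * g t).
Proof.
move=> pG; have [gi _] := pG; have bG := prim_of_bmeas pG.
pose E (t : R) := cexp (c * t%:C).
have pE : prim_of E (fun t => c * E t) by exact: prim_of_exp.
have bE : bmeas E := prim_of_bmeas pE.
have bcE : bmeas (fun t => c * E t) by exact: bmeasZ.
have icEG : cint (fun t => c * E t * G t) by apply: bmeas_cint; exact: bmeasM.
have iEg : cint (fun t => E t * g t) by exact: cintMl.
have iD : cint (fun t => c * E t * G t + E t * g t) by exact: cintD.
split => // x hx; rewrite -/(E x) -/(E 0).
pose H x := E x * G x - cprim (fun t => c * E t * G t + E t * g t) x.
suff /(_ x hx) : forall x, 0 <= x <= 1 -> H x = H 0.
  by rewrite /H cprim0 subr0 => <-; rewrite subrK.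
have [_ _ [M hM]] := bcE.
pose psi := prim (fun t => norm1 (g t)).
apply: (@const_of_small_increments _ (fun t => M * psi t + M * psi t)).
clear x hx => x y x0 xy y1.
have x1 : x <= 1 by exact: le_trans y1.
have y0 : 0 <= y by exact: le_trans xy.
have ig : int01 (fun t => norm1 (g t)) by exact: cint_norm1.
have bh1 : bmeas (fun t => E y - E t) by apply: bmeasB => //; exact: bmeas_cst.
have bh2 : bmeas (fun t => G x - G t) by apply: bmeasB => //; exact: bmeas_cst.
pose h1 t := (E y - E t) * g t; pose h2 t := c * E t * (G x - G t).
have ih1 : cint h1 by exact: cintMl.
have ih2 : cint h2 by apply: bmeas_cint; exact: bmeasM.
have M0 : 0 <= M by rewrite (le_trans (norm1_ge0 (c * E 0))) ?hM ?lexx ?ler01.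
have I1 z : z <= 1 -> cprim h1 z = E y * cprim g z - cprim (fun t => E t * g t) z.
  move=> z1; rewrite -cprimZ// -cprimB//; last exact: cintZ.
  by apply: cprim_eq => t _; rewrite /h1 mulrBl.
have I2 z : z <= 1 -> cprim h2 z =
    G x * cprim (fun t => c * E t) z - cprim (fun t => c * E t * G t) z.
  have icE : cint (fun t => c * E t) by exact: bmeas_cint.
  move=> z1; rewrite -cprimZ// -cprimB//; last exact: cintZ.
  by apply: cprim_eq => t _; rewrite /h2; ring.
have dpsi t : x <= t <= y -> psi t - psi x <= psi y - psi x.
  move=> /andP[xt ty]; rewrite lerD2r; apply: prim_homo => //.
    exact: le_trans xt.
  by move=> *; exact: norm1_ge0.
have -> : H y - H x = (cprim h1 y - cprim h1 x) + (cprim h2 y - cprim h2 x).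
  have EE := prim_of_diff pE x0 xy y1.
  have GG := prim_of_diff pG x0 xy y1.
  rewrite /H !cprimD// !I1// !I2//.
  have -> : cprim (fun t => c * E t) y = E y - E x + cprim (fun t => c * E t) x.
    by rewrite EE subrK.
  have -> : cprim g y = G y - G x + cprim g x by rewrite GG subrK.
  by ring.
rewrite (le_trans (norm1D _ _))// -mulrDl addrC.
have B1 : norm1 (cprim h1 y - cprim h1 x) <= (y - x) * (M * (psi y - psi x)).
  rewrite mulrCA mulrA mulrBr -!primZ//.
  apply: cprim_bound => //; first exact: int01Z.
  move=> t /andP[xt ty]; rewrite (le_trans (norm1M _ _))// ler_wpM2r ?norm1_ge0//.
  have t0 : 0 <= t := le_trans x0 xt.
  rewrite (prim_of_diff pE t0 ty y1).
  rewrite (le_trans (cprim_bound (g := fun=> M) (bmeas_cint bcE) _ t0 ty y1 _))//.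
  - exact: int01_cst.
  - by move=> s /andP[ts sy]; rewrite hM// (le_trans t0 ts) (le_trans sy y1).
  - by rewrite !prim_cst// -mulrBr ler_wpM2l// lerD2l lerN2.
have B2 : norm1 (cprim h2 y - cprim h2 x) <= (y - x) * (M * (psi y - psi x)).
  set K := M * _; have -> : (y - x) * K = prim (fun=> K) y - prim (fun=> K) x.
    by rewrite !prim_cst// -mulrBr mulrC.
  apply: cprim_bound => //; first exact: int01_cst.
  move=> t hxt; have /andP[xt ty] := hxt.
  have t0 : 0 <= t := le_trans x0 xt; have t1 : t <= 1 := le_trans ty y1.
  rewrite (le_trans (norm1M _ _))// ler_pM ?norm1_ge0 ?hM ?t0//.
  rewrite norm1B (prim_of_diff pG x0 xt t1) (le_trans _ (dpsi _ hxt))//.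
  exact: cprim_bound_norm1.
by rewrite addrC (le_trans (lerD B1 B2))//; lra.
Qed.

End ProductRule.

(** * A Riemann-Lebesgue lemma *)

Section RiemannLebesgue.
Context {R : realType}.

(** Heine's theorem, from the near-covering form of compactness. *)
Lemma continuous_unif01 (p : R -> R) (e : R) : continuous p -> 0 < e ->
  exists2 d : R, 0 < d & forall x y, 0 <= x <= 1 -> 0 <= y <= 1 ->
    `|x - y| <= d -> `|p x - p y| <= e.
Proof.
move=> cp e0.
have := @segment_compact R 0 1 => /compact_near_coveringP.
move=> /(_ R (0 : R)^'+ (fun d x => forall y, `|x - y| <= d -> `|p x - p y| <= e) _).
case.
  move=> x _; have /cvgrPdist_le /(_ (e / 2)) := cp x.
  rewrite divr_gt0// => /(_ isT); rewrite near_simpl => -[d /= d0 hd].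
  exists (ball x (d / 2), [set r | r < d / 2]) => /=.
    split; first by apply: nbhsx_ballx; rewrite divr_gt0.
    by apply: nbhs_right_lt; rewrite divr_gt0.
  move=> [u r] /= [ux rd] y uy.
  have hu := hd u; have hy := hd y; rewrite /ball_ /= in hu hy ux.
  have ux' : `|x - u| < d / 2 by exact: ux.
  have xu : `|x - u| < d by rewrite (lt_trans ux')// ltr_pdivrMr// ltr_pMr// ltr1n.
  have xy : `|x - y| < d.
    have -> : x - y = (x - u) + (u - y) by ring.
    rewrite (le_lt_trans (ler_normD _ _))// (splitr d) ltrD//.
    exact: le_lt_trans uy rd.
  have -> : p u - p y = (p x - p y) - (p x - p u) by ring.
  by rewrite (le_trans (ler_normB _ _))// (splitr e) lerD ?hu ?hy.
move=> d /= d0 hd.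
exists (d / 2); first by rewrite divr_gt0.
move=> x y x01 _ xy; apply: (hd (d / 2)) => //=.
- by rewrite sub0r normrN gtr0_norm ?divr_gt0// ltr_pdivrMr// ltr_pMr// ltr1n.
- by rewrite divr_gt0.
Qed.

Lemma continuous_bound01 (p : R -> R) : continuous p ->
  exists2 B : R, 0 <= B & forall x, 0 <= x <= 1 -> `|p x| <= B.
Proof.
move=> cp.
have cn : continuous (fun x => `|p x|) by move=> x; apply: cvg_norm; exact: cp.
have [c _ hc] := EVT_max (ler01 : (0 : R) <= 1) (continuous_subspaceT cn).
by exists `|p c| => // x hx; apply: hc; rewrite in_itv.
Qed.

Lemma approx_cont01 (q : R -> R) (e : R) : int01 q -> 0 < e ->
  exists p : R -> R, [/\ continuous p, int01 p & prim (fun t => `|q t - p t|) 1 <= e].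
Proof.
move=> iq e0.
have m01 : (@lebesgue_measure R `[0%R, 1%R]%classic < +oo)%E.
  by rewrite /= lebesgue_measure_itv/= lte_fin ltr01 oppr0 adde0 ltry.
have [p [cp ip hp]] :=
  @approximation_continuous_integrable R `[0%R, 1%R] q (measurable_itv _) m01 iq.
have /fine_cvgP[_ /cvgrPdist_le/(_ _ e0)[N _ /(_ N (leqnn N)) hN]] := hp.
exists (p N); split => //.
  exact: ip.
apply: le_trans hN; rewrite sub0r normrN /=.
exact: ler_norm.
Qed.

(** Approximate [q] in L1 by a continuous function and the latter by a step function
    with [m] steps: the errors are controlled by [|psi| <= 1], and on each step the
    integral of [psi] is at most [d]. The bound [1] is only required on [c, y], since
    the exponential kernels to come are large elsewhere on [0, 1]. *)
Lemma oscillation_small (q : R -> R) (e : R) : int01 q -> 0 < e ->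
  exists2 d : R, 0 < d & forall (psi : R -> R) c y M, meas01 psi ->
    (forall t, 0 <= t <= 1 -> `|psi t| <= M) ->
    0 <= c -> c <= y -> y <= 1 ->
    (forall t, c <= t <= y -> `|psi t| <= 1) ->
    (forall s t, c <= s -> s <= t -> t <= y -> `|prim psi t - prim psi s| <= d) ->
    `|prim (fun t => q t * psi t) y - prim (fun t => q t * psi t) c| <= e.
Proof.
move=> iq e0; have e3 : 0 < e / 3 by rewrite divr_gt0.
have [p [cp ip hp]] := approx_cont01 iq e3.
have [w w0 hw] := continuous_unif01 cp e3.
have [B B0 hB] := continuous_bound01 cp.
pose m := (Num.truncn w^-1).+1.
have mw : (m%:R)^-1 <= w.
  by rewrite -[leRHS]invrK lef_pV2 ?posrE ?invr_gt0// ltW// truncnS_gt.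
(* One third of [e] for each error; [B + 1] bounds [p] and is positive. *)
exists (e / 3 / (m%:R * (B + 1))); first by rewrite divr_gt0// mulr_gt0// ltr_wpDl.
move=> psi c y M mpsi psiM c0 cy y1 psi1 hpsi.
have c1 : c <= 1 := le_trans cy y1.
have iqpsi : int01 (fun t => q t * psi t) := int01M iq mpsi psiM.
have ippsi : int01 (fun t => p t * psi t) := int01M ip mpsi psiM.
have ipsi : int01 psi := int01_bounded mpsi psiM.
pose I f := prim f y - prim f c.
have E1 : `|I (fun t => (q t - p t) * psi t)| <= e / 3.
  have ia : int01 (fun t => `|q t - p t|) by apply: int01_norm; exact: int01B.
  rewrite (le_trans (prim_le_bound (g := fun t => `|q t - p t|) (M := 1) _ ia c0 cy y1 _))//.
  - by apply: int01M psiM => //; exact: int01B.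
  - by move=> t ht; rewrite normrM mul1r ler_piMr// psi1.
  - by rewrite mul1r (le_trans _ hp)// prim_diff_le.
have E2 : `|I (fun t => p t * psi t)| <= e / 3 + e / 3.
  rewrite /I (gridpt_telescope _ _ _ (ltn0Sn (Num.truncn w^-1))) -/m.
  rewrite (le_trans (ler_norm_sum _ _ _))//.
  rewrite (@le_trans _ _ (\sum_(0 <= i < m) (e / 3 / m%:R + e / 3 / m%:R)))//; last first.
    by rewrite sumr_const_nat subn0 -[X in X <= _]mulr_natr mulrDl !divfK ?pnatr_eq0.
  apply: ler_sum_nat => i /andP[_ im].
  have /andP[] := gridpt_itv cy (ltnW im) (ltn0Sn (Num.truncn w^-1)).
  have /andP[] := gridpt_itv cy im (ltn0Sn (Num.truncn w^-1)); rewrite -/m.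
  have := gridpt_step c y m i; have := gridpt_le m i cy.
  set s := gridpt c y m i; set t := gridpt c y m i.+1.
  move=> st ts ct ty cs sy.
  have s0 : 0 <= s := le_trans c0 cs.
  have t1 : t <= 1 := le_trans ty y1.
  have s1 : s <= 1 := le_trans st t1.
  have m0 : (0 : R) < m%:R by rewrite ltr0n.
  have tsm : t - s <= m%:R^-1.
    rewrite ts ler_piMl ?invr_ge0//; lra.
  have -> : prim (fun t => p t * psi t) t - prim (fun t => p t * psi t) s =
    (prim (fun t => (p t - p s) * psi t) t - prim (fun t => (p t - p s) * psi t) s)
    + p s * (prim psi t - prim psi s).
    have aux z : z <= 1 -> prim (fun t => (p t - p s) * psi t) z =
      prim (fun t => p t * psi t) z - p s * prim psi z.
      move=> z1; rewrite -primZ// -primB//; last exact: int01Z.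
      by apply: prim_eq => u _; rewrite mulrBl.
    by rewrite !aux//; ring.
  rewrite (le_trans (ler_normD _ _))// lerD//.
    rewrite (le_trans (prim_le_bound (g := fun=> 1) (M := e / 3) _ (int01_cst 1) s0 st t1 _))//.
    - apply: int01M psiM => //; apply: int01B => //; exact: int01_cst.
    - move=> u /andP[su ut]; rewrite normrM ler_pM//.
        apply: hw; rewrite ?s0 ?s1 ?(le_trans s0 su) ?(le_trans ut t1)//.
        rewrite ger0_norm ?subr_ge0//; apply: le_trans mw; apply: le_trans tsm.
        by rewrite lerD2r.
      by apply: psi1; rewrite (le_trans cs su) (le_trans ut ty).
    - by rewrite !prim_cst ?(le_trans s0 st)// !mul1r ler_wpM2l// ltW.
  rewrite normrM; apply: (@le_trans _ _ (B * (e / 3 / (m%:R * (B + 1))))).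
    by rewrite ler_pM// ?hpsi// hB// s0.
  rewrite [leLHS]mulrCA ler_wpM2l ?(ltW e3)// invfM mulrCA ler_piMr ?invr_ge0//.
  by rewrite ler_pdivrMr ?ltr_wpDl// mul1r lerDl.
rewrite -/(I (fun t => q t * psi t)).
have -> : I (fun t => q t * psi t) =
  I (fun t => (q t - p t) * psi t) + I (fun t => p t * psi t).
  have aux z : z <= 1 -> prim (fun t => (q t - p t) * psi t) z =
    prim (fun t => q t * psi t) z - prim (fun t => p t * psi t) z.
    by move=> z1; rewrite -primB//; apply: prim_eq => u _; rewrite mulrBl.
  by rewrite /I !aux//; ring.
rewrite (le_trans (ler_normD _ _))// (le_trans (lerD E1 E2))//; lra.
Qed.

(** Expanding the product into real and imaginary parts leaves four real integrals. *)
Lemma coscillation_small (q : R -> R[i]) (e : R) : cint q -> 0 < e ->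
  exists2 d : R, 0 < d & forall (psi : R -> R[i]) c y, bmeas psi ->
    0 <= c -> c <= y -> y <= 1 ->
    (forall t, c <= t <= y -> norm1 (psi t) <= 1) ->
    (forall s t, c <= s -> s <= t -> t <= y ->
       norm1 (cprim psi t - cprim psi s) <= d) ->
    norm1 (cprim (fun t => q t * psi t) y - cprim (fun t => q t * psi t) c) <= e.
Proof.
move=> iq e0; have [q1 q2] := iq; have e4 : 0 < e / 4 by rewrite divr_gt0.
have [d1 d10 h1] := oscillation_small q1 e4.
have [d2 d20 h2] := oscillation_small q2 e4.
exists (Num.min d1 d2); first by rewrite lt_min d10.
move=> psi c y bpsi c0 cy y1 hb hd; have [m1 m2 [M hM]] := bpsi.
have c1 : c <= 1 := le_trans cy y1.
have M1 t : 0 <= t <= 1 -> `|Re (psi t)| <= M.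
  by move=> ht; rewrite (le_trans (ler_Re _))// hM.
have M2 t : 0 <= t <= 1 -> `|Im (psi t)| <= M.
  by move=> ht; rewrite (le_trans (ler_Im _))// hM.
have b1 t : c <= t <= y -> `|Re (psi t)| <= 1.
  by move=> ht; rewrite (le_trans (ler_Re _))// hb.
have b2 t : c <= t <= y -> `|Im (psi t)| <= 1.
  by move=> ht; rewrite (le_trans (ler_Im _))// hb.
have D1 d s t : Num.min d1 d2 <= d -> c <= s -> s <= t -> t <= y ->
    `|prim (fun t => Re (psi t)) t - prim (fun t => Re (psi t)) s| <= d.
  move=> dd cs st ty; rewrite (le_trans _ dd)// (le_trans _ (hd _ _ cs st ty))//.
  by rewrite (le_trans _ (ler_Re _))// ReB.
have D2 d s t : Num.min d1 d2 <= d -> c <= s -> s <= t -> t <= y ->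
    `|prim (fun t => Im (psi t)) t - prim (fun t => Im (psi t)) s| <= d.
  move=> dd cs st ty; rewrite (le_trans _ dd)// (le_trans _ (hd _ _ cs st ty))//.
  by rewrite (le_trans _ (ler_Im _))// ImB.
have l1 : Num.min d1 d2 <= d1 by rewrite ge_min lexx.
have l2 : Num.min d1 d2 <= d2 by rewrite ge_min lexx orbT.
have A11 := h1 _ c y M m1 M1 c0 cy y1 b1 (fun s t => D1 _ s t l1).
have A12 := h1 _ c y M m2 M2 c0 cy y1 b2 (fun s t => D2 _ s t l1).
have A21 := h2 _ c y M m1 M1 c0 cy y1 b1 (fun s t => D1 _ s t l2).
have A22 := h2 _ c y M m2 M2 c0 cy y1 b2 (fun s t => D2 _ s t l2).
rewrite /norm1 ReB ImB /=.
have ER z : z <= 1 -> prim (fun t => Re (q t * psi t)) z =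
    prim (fun t => Re (q t) * Re (psi t)) z - prim (fun t => Im (q t) * Im (psi t)) z.
  move=> z1; rewrite -primB//; first by apply: prim_eq => t _; rewrite ReM.
    exact: int01M M1.
  exact: int01M M2.
have EI z : z <= 1 -> prim (fun t => Im (q t * psi t)) z =
    prim (fun t => Re (q t) * Im (psi t)) z + prim (fun t => Im (q t) * Re (psi t)) z.
  move=> z1; rewrite -primD//; first by apply: prim_eq => t _; rewrite ImM.
    exact: int01M M2.
  exact: int01M M1.
rewrite !ER// !EI//.
move: A11 A12 A21 A22; rewrite !ler_norml.
set a1 := prim _ y; set a2 := prim _ c; set a3 := prim _ y; set a4 := prim _ c.
set a5 := prim _ y; set a6 := prim _ c; set a7 := prim _ y; set a8 := prim _ c.
move=> /andP[? ?] /andP[? ?] /andP[? ?] /andP[? ?].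
rewrite (splitr e) lerD// ler_norml; apply/andP; split; lra.
Qed.

End RiemannLebesgue.

(** * The scalar integral operator and its dependence on the rate *)

Section Duhamel.
Context {R : realType}.
Implicit Types (f g w : R -> R[i]) (al : R[i]) (u : bool).

(** The solution of [F' = al F + f] that vanishes at [0] (if [u] is false) or at [1]
    (if [u] is true). *)
Definition duhamel al u f (x : R) : R[i] :=
  cexp (al * x%:C) * (cprim (fun t => cexp (- al * t%:C) * f t) x -
    (if u then cprim (fun t => cexp (- al * t%:C) * f t) 1 else 0)).

(** The condition under which the kernel [e^(al (x - t))] of [duhamel] is bounded on
    its interval of integration. *)
Definition admissible al u := if u then 0 <= Re al else Re al <= 0.

Lemma cint_expM al f : cint f -> cint (fun t => cexp (al * t%:C) * f t).
Proof. by move=> hf; apply: cintMl => //; exact: bmeas_exp. Qed.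

Lemma cexp_shift al (x t : R) :
  cexp (al * (x - t)%:C) = cexp (al * x%:C) * cexp (- al * t%:C).
Proof. by rewrite -cexpD; congr cexp; rewrite rmorphB/=; ring. Qed.

Lemma bmeas_exp_shift al (x : R) : bmeas (fun t => cexp (al * (x - t)%:C)).
Proof.
under eq_fun do rewrite cexp_shift.
by apply: bmeasZ; exact: bmeas_exp.
Qed.

Lemma duhamelE al u f x : cint f -> 0 <= x <= 1 ->
  duhamel al u f x = cprim (fun t => cexp (al * (x - t)%:C) * f t) x -
    (if u then cprim (fun t => cexp (al * (x - t)%:C) * f t) 1 else 0).
Proof.
move=> hf /andP[x0 x1].
have E z : z <= 1 -> cprim (fun t => cexp (al * (x - t)%:C) * f t) z =
    cexp (al * x%:C) * cprim (fun t => cexp (- al * t%:C) * f t) z.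
  move=> z1; rewrite -cprimZ//; last exact: cint_expM.
  by apply: cprim_eq => t _; rewrite cexp_shift mulrA.
by rewrite /duhamel !E// mulrBr; case: u; rewrite ?mulr0.
Qed.

Lemma admissible_kernel al u (x t : R) : admissible al u ->
  (if u then x <= t else t <= x) -> norm1 (cexp (al * (x - t)%:C)) <= 2.
Proof.
move=> hal xt; apply: norm1_cexp_le0; rewrite ReMr.
case: u hal xt => /= hal xt.
  by rewrite mulr_ge0_le0// subr_le0.
by rewrite mulr_le0_ge0// subr_ge0.
Qed.

(** [duhamel] integrates over [span_lo, span_hi], which is [0, x] or [x, 1]. *)
Definition span_lo u (x : R) : R := if u then x else 0.
Definition span_hi u (x : R) : R := if u then 1 else x.

Lemma span_bounds u x : 0 <= x <= 1 ->
  [/\ 0 <= span_lo u x, span_lo u x <= span_hi u x & span_hi u x <= 1].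
Proof. by move=> /andP[x0 x1]; rewrite /span_lo /span_hi; case: u. Qed.

Lemma duhamel_span al u f x : cint f -> 0 <= x <= 1 ->
  duhamel al u f x = (-1) ^+ u *
    (cprim (fun t => cexp (al * (x - t)%:C) * f t) (span_hi u x) -
     cprim (fun t => cexp (al * (x - t)%:C) * f t) (span_lo u x)).
Proof.
move=> hf hx; rewrite duhamelE//; case: u => /=.
  by rewrite expr1 mulN1r opprB.
by rewrite expr0 mul1r cprim0.
Qed.

Lemma norm1_sign u (z : R[i]) : norm1 ((-1) ^+ u * z) = norm1 z.
Proof. by case: u; rewrite ?expr1 ?expr0 ?mulN1r ?mul1r ?norm1N. Qed.

Lemma span_kernel al u x t : admissible al u -> span_lo u x <= t <= span_hi u x ->
  norm1 (cexp (al * (x - t)%:C)) <= 2.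
Proof.
move=> hal /andP[ht1 ht2]; apply: (admissible_kernel hal).
by case: u ht1 ht2 hal.
Qed.

Lemma duhamel_kernel_bound al u f x (k : R -> R[i]) (M : R) : cint f -> bmeas k ->
  0 <= x <= 1 -> 0 <= M -> (forall t, span_lo u x <= t <= span_hi u x -> norm1 (k t) <= M) ->
  norm1 (cprim (fun t => k t * f t) (span_hi u x) - cprim (fun t => k t * f t) (span_lo u x))
    <= M * prim (fun t => norm1 (f t)) 1.
Proof.
move=> hf bk hx M0 hk; have [l0 lh h1] := span_bounds u hx.
have iN := cint_norm1 hf.
apply: (@le_trans _ _ (M * (prim (fun t => norm1 (f t)) (span_hi u x) -
    prim (fun t => norm1 (f t)) (span_lo u x)))); last first.
  by rewrite ler_wpM2l// prim_diff_le// => *; exact: norm1_ge0.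
rewrite mulrBr -!primZ//; last by rewrite (le_trans lh).
apply: cprim_bound => //; [exact: cintMl|exact: int01Z|].
by move=> t ht; rewrite (le_trans (norm1M _ _))// ler_wpM2r ?norm1_ge0// hk.
Qed.

Lemma duhamel_bound al u f x : admissible al u -> cint f -> 0 <= x <= 1 ->
  norm1 (duhamel al u f x) <= 2 * prim (fun t => norm1 (f t)) 1.
Proof.
move=> hal hf hx; rewrite duhamel_span// norm1_sign.
apply: duhamel_kernel_bound => //; first exact: bmeas_exp_shift.
by move=> t; exact: span_kernel.
Qed.

Lemma duhamel_prim al u f : cint f ->
  prim_of (duhamel al u f) (fun t => al * duhamel al u f t + f t).
Proof.
move=> hf; set c := if u then cprim (fun t => cexp (- al * t%:C) * f t) 1 else 0.
have P1 : prim_of (fun x => cprim (fun t => cexp (- al * t%:C) * f t) x - c)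
    (fun t => cexp (- al * t%:C) * f t).
  have P0 := prim_of_cprim (cint_expM (- al) hf).
  apply: prim_of_eq (prim_ofD P0 (prim_of_cst (- c))) => // t _.
  by rewrite addr0.
apply: prim_of_eq (prim_of_mulexp al P1) => // t _.
have E : cexp (al * t%:C) * (cexp (- al * t%:C) * f t) = f t.
  by rewrite mulNr mulrA cexpNK mul1r.
by rewrite E /duhamel -/c -mulrA.
Qed.

Lemma duhamel_bmeas al u f : cint f -> bmeas (duhamel al u f).
Proof. by move=> /(duhamel_prim al u) /prim_of_bmeas. Qed.

Lemma duhamel_at0 al f : duhamel al false f 0 = 0.
Proof. by rewrite /duhamel cprim0 subr0 mulr0. Qed.

Lemma duhamel_at1 al f : duhamel al true f 1 = 0.
Proof. by rewrite /duhamel subrr mulr0. Qed.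

Lemma duhamelD al u f g x : cint f -> cint g -> 0 <= x <= 1 ->
  duhamel al u (fun t => f t + g t) x = duhamel al u f x + duhamel al u g x.
Proof.
move=> hf hg /andP[x0 x1]; rewrite /duhamel.
have E z : z <= 1 -> cprim (fun t => cexp (- al * t%:C) * (f t + g t)) z =
   cprim (fun t => cexp (- al * t%:C) * f t) z +
   cprim (fun t => cexp (- al * t%:C) * g t) z.
  move=> z1; rewrite -cprimD//; try exact: cint_expM.
  by apply: cprim_eq => t _; rewrite mulrDr.
rewrite E// -mulrDr; congr (_ * _); case: u => //; first by rewrite E//; ring.
by rewrite !subr0.
Qed.

Lemma duhamelZ al u f c x : cint f -> 0 <= x <= 1 ->
  duhamel al u (fun t => c * f t) x = c * duhamel al u f x.
Proof.
move=> hf /andP[x0 x1]; rewrite /duhamel.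
have E z : z <= 1 -> cprim (fun t => cexp (- al * t%:C) * (c * f t)) z =
   c * cprim (fun t => cexp (- al * t%:C) * f t) z.
  move=> z1; rewrite -cprimZ//; try exact: cint_expM.
  by apply: cprim_eq => t _; rewrite mulrCA.
rewrite E// mulrCA; congr (_ * _); rewrite mulrBr; case: u => //; first by rewrite E.
by rewrite mulr0.
Qed.

Lemma duhamel_eq al u f g x : (forall t, 0 <= t <= 1 -> f t = g t) ->
  0 <= x <= 1 -> duhamel al u f x = duhamel al u g x.
Proof.
move=> fg /andP[x0 x1]; rewrite /duhamel.
have E z : z <= 1 -> cprim (fun t => cexp (- al * t%:C) * f t) z =
   cprim (fun t => cexp (- al * t%:C) * g t) z.
  move=> z1; apply: cprim_eq => t /andP[t0 tz]; rewrite fg// t0.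
  exact: le_trans z1.
by rewrite E//; case: u => //; rewrite E.
Qed.

Lemma duhamel_sum al u (I : Type) (s : seq I) (F : I -> R -> R[i]) x :
  (forall i, cint (F i)) -> 0 <= x <= 1 ->
  duhamel al u (fun t => \sum_(i <- s) F i t) x = \sum_(i <- s) duhamel al u (F i) x.
Proof.
move=> hF hx; elim: s => [|i s IH].
  rewrite big_nil -[RHS](mul0r (duhamel al u (fun=> 0) x)) -duhamelZ//.
    by apply: duhamel_eq => // t _; rewrite big_nil mulr0.
  exact: cint_cst.
rewrite big_cons -IH -duhamelD//; last exact: cint_sum.
by apply: duhamel_eq => // t _; rewrite big_cons.
Qed.

Lemma duhamelB al u f g x : cint f -> cint g -> 0 <= x <= 1 ->
  duhamel al u (fun t => f t - g t) x = duhamel al u f x - duhamel al u g x.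
Proof.
move=> hf hg hx; rewrite duhamelD//; last exact: cintN.
congr (_ + _); rewrite -mulN1r -duhamelZ//.
by apply: duhamel_eq => // t _; rewrite mulN1r.
Qed.

(** If [w' = be w + g] then [e^(al (x - t)) w(t)] has derivative
    [(be - al) e^(al (x - t)) w(t) + e^(al (x - t)) g(t)]; hence the primitive of
    [e^(al (x - t)) w(t)] is [O(M / |be - al|)] on the interval of integration, and
    [coscillation_small] applies to it after division by [2 M]. *)
Lemma duhamel_oscillation (q : R -> R[i]) (e : R) : cint q -> 0 < e ->
  exists2 rho : R, 0 < rho & forall al be u w g (M : R) x,
    admissible al u -> prim_of w (fun t => be * w t + g t) -> cint g -> 0 < M ->
    (forall t, 0 <= t <= 1 -> norm1 (w t) <= M) ->
    prim (fun t => norm1 (g t)) 1 <= M ->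
    rho <= norm1 (be - al) -> 0 <= x <= 1 ->
    norm1 (duhamel al u (fun t => q t * w t) x) <= e * M.
Proof.
move=> iq e0; have e2 : 0 < e / 2 by rewrite divr_gt0.
have [d d0 hd] := coscillation_small iq e2.
(* [3 * 2 M] from the boundary terms and the integral of [g], times 2 from
   [norm1V], must not exceed [d * (2 M)]. *)
exists (6 / d); first by rewrite divr_gt0.
move=> al be u w g M x hal pw ig M0 wM gM hrho hx.
have rho0 : 0 < norm1 (be - al) by rewrite (lt_le_trans _ hrho)// divr_gt0.
have bw := prim_of_bmeas pw.
have iqw : cint (fun t => q t * w t) := cintM iq bw.
have [l0 lh h1] := span_bounds u hx.
pose E t := cexp (al * (x - t)%:C).
pose s : R[i] := ((2 * M)^-1)%:C.
pose psi t := s * (E t * w t).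
have bEw : bmeas (fun t => E t * w t) by apply: bmeasM => //; exact: bmeas_exp_shift.
have M20 : 0 < 2 * M by rewrite mulr_gt0.
have norm_s z : norm1 (s * z) = norm1 z / (2 * M).
  by rewrite mulrC norm1M_real gtr0_norm ?invr_gt0.
have EwM t : span_lo u x <= t <= span_hi u x -> norm1 (E t * w t) <= 2 * M.
  move=> ht; rewrite (le_trans (norm1M _ _))// ler_pM ?norm1_ge0//.
    exact: span_kernel ht.
  have /andP[h2 h3] := ht; apply: wM.
  by rewrite (le_trans l0 h2) (le_trans h3 h1).
have pPhi : prim_of (fun t => E t * w t) (fun t => (be - al) * (E t * w t) + E t * g t).
  apply: prim_of_eq (prim_ofZ (cexp (al * x%:C)) (prim_of_mulexp (- al) pw)).
    by move=> t _; rewrite /E cexp_shift mulrA.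
  by move=> t _; rewrite /E cexp_shift; ring.
have iEg : cint (fun t => E t * g t).
  by apply: cintMl => //; exact: bmeas_exp_shift.
have iEw : cint (fun t => E t * w t) by exact: bmeas_cint.
have small a b : span_lo u x <= a -> a <= b -> b <= span_hi u x ->
    norm1 (cprim (fun t => E t * w t) b - cprim (fun t => E t * w t) a) <= d * (2 * M).
  move=> la ab bh.
  have a0 : 0 <= a := le_trans l0 la; have b1 : b <= 1 := le_trans bh h1.
  have := prim_of_diff pPhi a0 ab b1.
  rewrite !cprimD ?(le_trans ab b1)//; try exact: cintZ.
  rewrite !cprimZ ?(le_trans ab b1)// => EE.
  have ba0 : be - al != 0.
    by apply/eqP => h; move: rho0; rewrite h norm1_0 ltxx.
  have -> : cprim (fun t => E t * w t) b - cprim (fun t => E t * w t) a =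
    (be - al)^-1 * ((E b * w b - E a * w a) -
      (cprim (fun t => E t * g t) b - cprim (fun t => E t * g t) a)).
    by rewrite EE; field.
  rewrite (le_trans (norm1M _ _))//.
  apply: (@le_trans _ _ (2 / (6 / d) * (6 * M))).
    rewrite ler_pM ?norm1_ge0//.
      rewrite (le_trans (norm1V _))// ler_wpM2l// lef_pV2// posrE//.
      by rewrite divr_gt0.
    rewrite (le_trans (norm1D _ _))// norm1N.
    have n1 : norm1 (E b * w b - E a * w a) <= 2 * M + 2 * M.
      rewrite (le_trans (norm1D _ _))// norm1N lerD// EwM// ?la ?bh ?andbT.
        exact: le_trans ab.
      by rewrite (le_trans ab bh).
    have n2 : norm1 (cprim (fun t => E t * g t) b - cprim (fun t => E t * g t) a)
        <= 2 * M.
      apply: (@le_trans _ _ (2 * (prim (fun t => norm1 (g t)) b -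
                                  prim (fun t => norm1 (g t)) a))).
        rewrite mulrBr -!primZ ?(le_trans ab b1)//; try exact: cint_norm1.
        apply: cprim_bound => //; first by apply: int01Z; exact: cint_norm1.
        move=> t /andP[at_ tb]; rewrite (le_trans (norm1M _ _))//.
        rewrite ler_wpM2r ?norm1_ge0//; apply: (span_kernel hal).
        by rewrite (le_trans la at_) (le_trans tb bh).
      rewrite ler_wpM2l// (le_trans _ gM)// prim_diff_le//.
        exact: cint_norm1.
      by move=> *; exact: norm1_ge0.
    by lra.
  rewrite le_eqVlt; apply/orP; left; apply/eqP; field.
  by rewrite gt_eqF.
have key : norm1 (cprim (fun t => q t * psi t) (span_hi u x) -
                  cprim (fun t => q t * psi t) (span_lo u x)) <= e / 2.
  apply: hd => //; first exact: bmeasZ.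
    by move=> t ht; rewrite norm_s ler_pdivrMr// mul1r EwM.
  move=> a b la ab bh; have b1 : b <= 1 := le_trans bh h1.
  rewrite !cprimZ ?(le_trans ab b1)// -mulrBr norm_s ler_pdivrMr//.
  exact: small.
rewrite duhamel_span// norm1_sign.
have EE z : z <= 1 -> cprim (fun t => q t * psi t) z =
    s * cprim (fun t => E t * (q t * w t)) z.
  move=> z1; rewrite -cprimZ//; last first.
    by apply: cintMl => //; exact: bmeas_exp_shift.
  by apply: cprim_eq => t _; rewrite /psi; ring.
move: key; rewrite !EE// ?(le_trans lh h1)// -mulrBr norm_s ler_pdivrMr//.
move=> /le_trans; apply; lra.
Qed.

(** The derivative in [al], whose kernel is [(x - t) e^(al (x - t))]. *)
Definition duhamel_diff al u f x : R[i] :=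
  x%:C * duhamel al u f x - duhamel al u (fun t => t%:C * f t) x.

Lemma bmeas_id : bmeas (fun t : R => t%:C).
Proof.
apply: (@bmeas_eq _ (fun t => cprim (fun=> 1) t)).
  by move=> t /andP[t0 _]; rewrite cprim_cst// mul1r.
by apply: bmeas_cprim; exact: cint_cst.
Qed.

Lemma duhamel_diff_bmeas al u f : cint f -> bmeas (duhamel_diff al u f).
Proof.
move=> hf; apply: bmeasB; last by apply: duhamel_bmeas; apply: cintMl bmeas_id.
by apply: bmeasM; [exact: bmeas_id|exact: duhamel_bmeas].
Qed.

Lemma cexp_sub1 (z : R[i]) : norm1 (cexp z - 1) <= norm1 z * (2 * expR (norm1 z)).
Proof.
have [ip /(_ 1)] := prim_of_exp z; rewrite ler01 lexx mulr0 cexp0 mulr1 => /(_ isT) ->.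
rewrite addrC addKr -[cprim _ 1]subr0 -[X in _ - X](cprim0 (fun t => z * cexp (z * t%:C))).
set K := _ * (2 * _).
have -> : K = prim (fun=> K) 1 - prim (fun=> K) 0 by rewrite !prim_cst// mulr1 mulr0 subr0.
apply: cprim_bound => //; first exact: int01_cst.
move=> t /andP[t0 t1]; rewrite (le_trans (norm1M _ _))// ler_wpM2l ?norm1_ge0//.
rewrite (le_trans (norm1_cexp _))// ler_wpM2l// ler_expR ReMr.
rewrite (le_trans (ler_norm _))// normrM (ger0_norm t0).
by rewrite (le_trans _ (ler_Re z))// ler_piMr.
Qed.

(** Two applications of [e^z - 1 = z int_0^1 e^(z t) dt]. *)
Lemma cexp_taylor (z : R[i]) :
  norm1 (cexp z - 1 - z) <= norm1 z ^+ 2 * (2 * expR (norm1 z)).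
Proof.
have ie : cint (fun t : R => cexp (z * t%:C)) by apply: bmeas_cint; exact: bmeas_exp.
have [ip /(_ 1)] := prim_of_exp z; rewrite ler01 lexx mulr0 cexp0 mulr1 => /(_ isT) ->.
rewrite cprimZ//.
have -> : 1 + z * cprim (fun t => cexp (z * t%:C)) 1 - 1 - z =
   z * (cprim (fun t => cexp (z * t%:C) - 1) 1 - cprim (fun t => cexp (z * t%:C) - 1) 0).
  rewrite cprimB// ?cprim_cst//; last exact: cint_cst.
  by rewrite cprim0 mulr1; ring.
rewrite (le_trans (norm1M _ _))// expr2 -mulrA ler_wpM2l ?norm1_ge0//.
set K := _ * (2 * _).
have -> : K = prim (fun=> K) 1 - prim (fun=> K) 0 by rewrite !prim_cst// mulr1 mulr0 subr0.
apply: cprim_bound => //; first by apply: cintB => //; exact: cint_cst.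
  exact: int01_cst.
move=> t /andP[t0 t1]; rewrite (le_trans (cexp_sub1 _))//.
have zt : norm1 (z * t%:C) <= norm1 z.
  by rewrite norm1M_real ger0_norm// ler_piMr// norm1_ge0.
by rewrite ler_pM ?norm1_ge0 ?mulr_ge0 ?expR_ge0// ler_wpM2l// ler_expR.
Qed.

(** With [h = al' - al] the difference of the kernels is
    [e^(al s) (e^(h s) - 1 - h s)] at [s = x - t], where [|s| <= 1]. *)
Lemma duhamel_taylor al al' u f x : admissible al u -> admissible al' u -> cint f ->
  0 <= x <= 1 -> norm1 (al' - al) <= 1 ->
  norm1 (duhamel al' u f x - duhamel al u f x - (al' - al) * duhamel_diff al u f x)
    <= 4 * expR 1 * norm1 (al' - al) ^+ 2 * prim (fun t => norm1 (f t)) 1.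
Proof.
move=> hal hal' hf hx h1; rewrite /duhamel_diff.
have itf : cint (fun t => t%:C * f t) by apply: cintMl => //; exact: bmeas_id.
have [l0 lh hh1] := span_bounds u hx.
set h := al' - al; pose E t := cexp (al * (x - t)%:C); pose E' t := cexp (al' * (x - t)%:C).
pose k t := E' t - E t - h * ((x - t)%:C * E t).
have bE : bmeas E := bmeas_exp_shift al x.
have bE' : bmeas E' := bmeas_exp_shift al' x.
have bxt : bmeas (fun t => (x - t)%:C).
  apply: (@bmeas_eq _ (fun t => x%:C - t%:C)); first by move=> t _; rewrite rmorphB.
  by apply: bmeasB; [exact: bmeas_cst|exact: bmeas_id].
have bk : bmeas k by apply: bmeasB; [exact: bmeasB|apply: bmeasZ; exact: bmeasM].
have -> : duhamel al' u f x - duhamel al u f x -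
    h * (x%:C * duhamel al u f x - duhamel al u (fun t => t%:C * f t) x) =
    (-1) ^+ u * (cprim (fun t => k t * f t) (span_hi u x) -
                 cprim (fun t => k t * f t) (span_lo u x)).
  have EE z : z <= 1 -> cprim (fun t => k t * f t) z =
     cprim (fun t => E' t * f t) z - cprim (fun t => E t * f t) z -
     h * (x%:C * cprim (fun t => E t * f t) z - cprim (fun t => E t * (t%:C * f t)) z).
    move=> z1.
    have i1 : cint (fun t => E t * f t) by exact: cintMl.
    have i2 : cint (fun t => E' t * f t) by exact: cintMl.
    have i3 : cint (fun t => E t * (t%:C * f t)) by exact: cintMl.
    rewrite -(cprimZ x%:C)// -(cprimB (cintZ _ i1))// -(cprimZ h)//; last first.
      by apply: cintB => //; exact: cintZ.
    rewrite -(cprimB i2)// -cprimB//; first last.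
    - by apply: cintZ; apply: cintB => //; exact: cintZ.
    - exact: cintB.
    by apply: cprim_eq => t _; rewrite /k rmorphB/=; ring.
  rewrite !duhamel_span// !EE ?(le_trans lh hh1)//.
  have alg (e p1 p0 q1 q0 t1 t0 y h0 : R[i]) :
    e * (p1 - p0) - e * (q1 - q0) - h0 * (y * (e * (q1 - q0)) - e * (t1 - t0)) =
    e * (p1 - q1 - h0 * (y * q1 - t1) - (p0 - q0 - h0 * (y * q0 - t0))) by ring.
  exact: alg.
rewrite norm1_sign; apply: duhamel_kernel_bound => //.
  by rewrite !mulr_ge0 ?expR_ge0 ?exprn_ge0 ?norm1_ge0.
move=> t ht.
have -> : k t = E t * (cexp (h * (x - t)%:C) - 1 - h * (x - t)%:C).
  have -> : k t = E' t - E t - h * ((x - t)%:C * E t) by [].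
  have -> : E' t = E t * cexp (h * (x - t)%:C).
    by rewrite /E' /E -cexpD; congr cexp; rewrite /h; ring.
  by ring.
have xt1 : `|x - t| <= 1.
  have /andP[h2 h3] := ht; have t0 := le_trans l0 h2; have t1 := le_trans h3 hh1.
  case/andP: hx => x0 x1; rewrite ler_norml; apply/andP; split; lra.
have hs : norm1 (h * (x - t)%:C) <= norm1 h.
  by rewrite norm1M_real ler_piMr// norm1_ge0.
rewrite (le_trans (norm1M _ _))//.
apply: (@le_trans _ _ (2 * (norm1 h ^+ 2 * (2 * expR 1)))); last lra.
rewrite ler_pM ?norm1_ge0//; first exact: span_kernel ht.
rewrite (le_trans (cexp_taylor _))// ler_pM ?exprn_ge0 ?norm1_ge0 ?mulr_ge0 ?expR_ge0//.
  by rewrite lerXn2r ?nnegrE ?norm1_ge0.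
by rewrite ler_wpM2l// ler_expR (le_trans hs).
Qed.

End Duhamel.

(** * Geometric estimates *)

Section Aux.
Context {R : realType}.

Lemma norm1M_ge (z w : R[i]) : norm1 z * norm1 w <= 2 * norm1 (z * w).
Proof.
have [->|z0] := eqVneq z 0; first by rewrite norm1_0 mul0r mulr_ge0// norm1_ge0.
have N0 := norm1_gt0 z0.
have wE : w = z^-1 * (z * w) by rewrite mulrA mulVf// mul1r.
rewrite -ler_pdivlMl// [in leLHS]wE (le_trans (norm1M _ _))//.
by rewrite mulrA ler_wpM2r ?norm1_ge0// mulrC norm1V.
Qed.

Lemma i_neq0 : 'i%C != 0 :> R[i].
Proof.
by apply/eqP => h; have /eqP := @norm1_i R; rewrite h norm1_0 eq_sym oner_eq0.
Qed.

Lemma ler_sum_single (I : finType) (F : I -> R) j : (forall i, 0 <= F i) ->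
  F j <= \sum_i F i.
Proof. by move=> F0; rewrite (bigD1 j)//= lerDl sumr_ge0. Qed.

Lemma le_geometric (a c B : R) : (forall m, a <= c + B / 2 ^+ m) -> a <= c.
Proof.
move=> h; rewrite leNgt; apply/negP => ca.
have ac0 : 0 < a - c by rewrite subr_gt0.
set m := (Num.truncn (B / (a - c))).+1.
have hm : B / (a - c) < m%:R by exact: truncnS_gt.
have h2 : (m%:R : R) <= 2 ^+ m by rewrite -natrX ler_nat ltnW// ltn_expl.
have := h m; rewrite leNgt => /negP; apply.
rewrite -ltrBrDl ltr_pdivrMr ?exprn_gt0// mulrC -ltr_pdivrMr//.
exact: lt_le_trans h2.
Qed.

Lemma geometric_cvg (x : nat -> R) (D : R) :
  (forall m, `|x m.+1 - x m| <= D / 2 ^+ m) ->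
  exists2 L : R, x @ \oo --> L & forall m, `|L - x m| <= 2 * D / 2 ^+ m.
Proof.
move=> hx.
have D0 : 0 <= D by have := hx 0; rewrite expr0 divr1; exact: le_trans.
have tele m p : `|x (m + p)%N - x m| <= 2 * D / 2 ^+ m - 2 * D / 2 ^+ (m + p).
  elim: p => [|p IH]; first by rewrite addn0 !subrr normr0.
  rewrite addnS; have -> : x (m + p).+1 - x m =
    (x (m + p).+1 - x (m + p)%N) + (x (m + p)%N - x m) by ring.
  rewrite (le_trans (ler_normD _ _))// (le_trans (lerD (hx _) IH))//.
  rewrite exprS invfM le_eqVlt; apply/orP; left; apply/eqP.
  by field; rewrite !expf_neq0.
have bd m p : `|x (m + p)%N - x m| <= 2 * D / 2 ^+ m.
  by rewrite (le_trans (tele m p))// gerBl divr_ge0 ?mulr_ge0// exprn_ge0.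
have cx : cvgn x.
  apply/cauchy_cvgP/cauchy_ballP => e e0; rewrite near_simpl.
  pose m := (Num.truncn (2 * (2 * D) / e)).+1.
  have hm : 2 * D / 2 ^+ m < e / 2.
    have h1 : 2 * (2 * D) / e < m%:R by exact: truncnS_gt.
    have h2 : (m%:R : R) <= 2 ^+ m by rewrite -natrX ler_nat ltnW// ltn_expl.
    rewrite ltr_pdivrMr ?exprn_gt0//; rewrite ltr_pdivrMr// in h1.
    suff : 2 * (2 * D) < 2 ^+ m * e by lra.
    by rewrite (lt_le_trans h1)// ler_wpM2r// ltW.
  exists ([set i | (m <= i)%N], [set i | (m <= i)%N]) => /=.
    by split; exists m.
  move=> [i j] /= [mi mj].
  rewrite /ball /= -(subnKC mi) -(subnKC mj).
  have -> : x (m + (i - m))%N - x (m + (j - m))%N =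
    (x (m + (i - m))%N - x m) - (x (m + (j - m))%N - x m) by ring.
  rewrite (le_lt_trans (ler_normB _ _))// (splitr e).
  by rewrite ltrD// (le_lt_trans (bd _ _)).
exists (limn x) => // m.
have cd : (fun p => `|x p - x m|) @ \oo --> `|limn x - x m|.
  by apply: cvg_norm; apply: cvgB => //; exact: cvg_cst.
rewrite -(cvg_lim _ cd)//; apply: limr_le; first by apply/cvg_ex; eexists; exact: cd.
by exists m => // p /= mp; rewrite -(subnKC mp) bd.
Qed.

End Aux.

(** * The integral equation of one column *)

Section System.
Context {R : realType} (n : nat) (b : 'I_n -> R[i]) (q : 'I_n -> 'I_n -> R -> R[i]).
Context (k : 'I_n) (up : pred 'I_n).
Context (hq : forall j l, cint (q j l)).
Implicit Types (u v w g : 'I_n -> R -> R[i]) (z : R[i]).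

(** The exponent of the [j]-th entry relative to that of the [k]-th. *)
Definition rate (j : 'I_n) z : R[i] := 'i%C * (b j - b k) * z.
(** The entries of [- i B Q u]. *)
Definition src u (j : 'I_n) (t : R) : R[i] := - 'i%C * b j * \sum_m q j m t * u m t.
(** The integral operator [K_z] of the column: [up j] tells that the [j]-th entry is
    integrated from [1]. *)
Definition volterra z u (j : 'I_n) (x : R) : R[i] := duhamel (rate j z) (up j) (src u j) x.
Definition admissible_at z := forall j, admissible (rate j z) (up j).
Definition vbmeas u := forall j, bmeas (u j).
Definition vbounded (M : R) u := forall j x, 0 <= x <= 1 -> norm1 (u j x) <= M.
Definition eq01 u v := forall j x, 0 <= x <= 1 -> u j x = v j x.
Definition src_const : R := \sum_j \sum_m norm1 (b j) * prim (fun t => norm1 (q j m t)) 1.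
Definition volterra_const : R := 2 * src_const.

Lemma prim_norm_ge0 (f : R -> R[i]) : cint f -> 0 <= prim (fun t => norm1 (f t)) 1.
Proof.
move=> hf; have := prim_ge0 (cint_norm1 hf) (lexx 0) ler01 (lexx 1).
by rewrite prim0 subr0; apply => t _; exact: norm1_ge0.
Qed.

Lemma src_const_ge0 : 0 <= src_const.
Proof.
by apply: sumr_ge0 => j _; apply: sumr_ge0 => m _; rewrite mulr_ge0 ?norm1_ge0 ?prim_norm_ge0.
Qed.
Lemma volterra_const_ge0 : 0 <= volterra_const. Proof. by rewrite mulr_ge0// src_const_ge0. Qed.

Lemma vbounded_le M M' u : M <= M' -> vbounded M u -> vbounded M' u.
Proof. by move=> MM h j x hx; rewrite (le_trans (h j x hx)). Qed.

Lemma vbounded_eq M u v : eq01 u v -> vbounded M u -> vbounded M v.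
Proof. by move=> e h j x hx; rewrite -e// h. Qed.

Lemma vboundedD M M' u v : vbounded M u -> vbounded M' v ->
  vbounded (M + M') (fun j x => u j x + v j x).
Proof.
by move=> hu hv j x hx; rewrite (le_trans (norm1D _ _))// lerD ?hu ?hv.
Qed.

Lemma vbmeas_bounded u : vbmeas u -> exists2 M, 0 < M & vbounded M u.
Proof.
move=> hu; have /choice [M hM] : forall j, exists M : R,
    forall t, 0 <= t <= 1 -> norm1 (u j t) <= M.
  by move=> j; have [_ _] := hu j.
exists (1 + \sum_j `|M j|); first by rewrite ltr_pwDl// sumr_ge0.
move=> j x hx; rewrite (le_trans (hM j x hx))// (le_trans (ler_norm _))//.
by rewrite (le_trans (ler_sum_single (F := fun j => `|M j|) j _))// lerDr.
Qed.

Lemma src_cint u j : vbmeas u -> cint (src u j).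
Proof. by move=> hu; apply: cintZ; apply: cint_sum => m; exact: cintM. Qed.

Lemma src_norm u j M : vbmeas u -> 0 <= M -> vbounded M u ->
  prim (fun t => norm1 (src u j t)) 1 <= src_const * M.
Proof.
move=> hu M0 hM.
have i1 := cint_norm1 (src_cint j hu).
have i2 m : int01 (fun t => norm1 (q j m t)) by exact: cint_norm1.
pose h t : R := M * \sum_m norm1 (b j) * norm1 (q j m t).
have is_ (s : seq 'I_n) : int01 (fun t => \sum_(m <- s) norm1 (b j) * norm1 (q j m t)).
  elim: s => [|m s IH].
    by apply: eq_fun_int01 (int01_cst 0) => t; rewrite big_nil.
  by apply: eq_fun_int01 (int01D (int01Z (norm1 (b j)) (i2 m)) IH) => t; rewrite big_cons.
have ps (s : seq 'I_n) : prim (fun t => \sum_(m <- s) norm1 (b j) * norm1 (q j m t)) 1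
   = \sum_(m <- s) norm1 (b j) * prim (fun t => norm1 (q j m t)) 1.
  elim: s => [|m s IH].
    rewrite big_nil -[RHS](mul0r 1) -(prim_cst 0 ler01).
    by apply: prim_eq => t _; rewrite big_nil.
  rewrite big_cons -IH -primZ// -primD//; last exact: int01Z.
  by apply: prim_eq => t _; rewrite big_cons.
have ih : int01 h by apply: int01Z.
apply: (@le_trans _ _ (prim h 1)).
  have := @prim_le _ (fun t => norm1 (src u j t)) h 0 1 i1 ih (lexx _) ler01 (lexx _).
  rewrite !prim0 !subr0; apply=> t ht.
  rewrite (le_trans (norm1M _ _))// mulNr norm1N.
  have hib : norm1 ('i%C * b j) <= norm1 (b j).
    by rewrite (le_trans (norm1M _ _))// norm1_i mul1r.
  rewrite /h -mulr_sumr mulrCA ler_pM ?norm1_ge0//.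
  rewrite (le_trans (norm1_sum _ _ _))// mulr_sumr ler_sum// => m _.
  by rewrite mulrC (le_trans (norm1M _ _))// ler_wpM2r ?norm1_ge0// hM.
rewrite primZ// ps mulrC ler_wpM2r//.
apply: (ler_sum_single (F := fun j => \sum_m norm1 (b j) * prim (fun t => norm1 (q j m t)) 1)).
by move=> i; apply: sumr_ge0 => m _; rewrite mulr_ge0 ?norm1_ge0 ?prim_norm_ge0.
Qed.

Lemma volterra_bmeas z u : vbmeas u -> vbmeas (volterra z u).
Proof. by move=> hu j; apply: duhamel_bmeas; exact: src_cint. Qed.

Lemma volterra_bounded z u M : admissible_at z -> vbmeas u ->
  0 <= M -> vbounded M u -> vbounded (volterra_const * M) (volterra z u).
Proof.
move=> hz hu M0 hM j x hx.
rewrite (le_trans (duhamel_bound (hz j) (src_cint j hu) hx))//.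
by rewrite /volterra_const -mulrA ler_wpM2l// src_norm.
Qed.

Lemma volterra_eq z u v : eq01 u v -> eq01 (volterra z u) (volterra z v).
Proof.
move=> uv j x hx; apply: duhamel_eq => // t ht.
by rewrite /src; under eq_bigr do rewrite uv//.
Qed.

Lemma volterraB z u v : vbmeas u -> vbmeas v ->
  eq01 (volterra z (fun j x => u j x - v j x)) (fun j x => volterra z u j x - volterra z v j x).
Proof.
move=> hu hv j x hx; rewrite /volterra -duhamelB//; try exact: src_cint.
apply: duhamel_eq => // t _; rewrite /src -mulrBr -sumrB.
by under eq_bigr do rewrite mulrBr.
Qed.

Lemma volterraZ z c u : vbmeas u ->
  eq01 (volterra z (fun j x => c * u j x)) (fun j x => c * volterra z u j x).
Proof.
move=> hu j x hx; rewrite /volterra -duhamelZ//; try exact: src_cint.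
apply: duhamel_eq => // t _; rewrite /src [RHS]mulrCA; congr (_ * _).
by rewrite mulr_sumr; apply: eq_bigr => m _; rewrite mulrCA.
Qed.

Lemma volterra_prim z u j : vbmeas u ->
  prim_of (volterra z u j) (fun t => rate j z * volterra z u j t + src u j t).
Proof. by move=> hu; apply: duhamel_prim; exact: src_cint. Qed.

Lemma vbmeasB u v : vbmeas u -> vbmeas v -> vbmeas (fun j x => u j x - v j x).
Proof. by move=> hu hv j; exact: bmeasB. Qed.
Lemma vbmeasD u v : vbmeas u -> vbmeas v -> vbmeas (fun j x => u j x + v j x).
Proof. by move=> hu hv j; exact: bmeasD. Qed.

(** Entries with [b_j = b_m] drop out because [q_jm = 0]. For the others, the rates of
    [w_m] and of the [j]-th kernel differ by [i (b_m - b_j) z], which is large, so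
    that [duhamel_oscillation] applies to each product [q_jm w_m]. *)
Lemma volterra_small (e : R) : (forall j l x, b j = b l -> q j l x = 0) -> 0 < e ->
  exists2 rho : R, 0 < rho & forall z w g M, admissible_at z -> rho <= norm1 z ->
    (forall j, prim_of (w j) (fun t => rate j z * w j t + g j t)) ->
    (forall j, cint (g j)) -> 0 < M -> vbounded M w ->
    (forall j, prim (fun t => norm1 (g j t)) 1 <= M) ->
    vbounded (e * M) (volterra z w).
Proof.
move=> q0 e0.
pose B := 1 + \sum_j norm1 (b j).
have B0 : 0 < B by rewrite ltr_pwDl// sumr_ge0// => j _; exact: norm1_ge0.
have bB j : norm1 (- 'i%C * b j) <= B.
  rewrite (le_trans (norm1M _ _))// norm1N norm1_i mul1r.
  rewrite (le_trans (ler_sum_single (F := fun j => norm1 (b j)) j _)) ?lerDr//.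
  by move=> i; exact: norm1_ge0.
pose e' := e / (B * n.+1%:R).
have e'0 : 0 < e' by rewrite divr_gt0// mulr_gt0.
have /choice [rh hrh] : forall jm : 'I_n * 'I_n, exists rho : R, 0 < rho /\
    forall (al be : R[i]) (u : bool) (w g : R -> R[i]) (M x : R),
    admissible al u -> prim_of w (fun t => be * w t + g t) -> cint g -> 0 < M ->
    (forall t, 0 <= t <= 1 -> norm1 (w t) <= M) ->
    prim (fun t => norm1 (g t)) 1 <= M ->
    rho <= norm1 (be - al) -> 0 <= x <= 1 ->
    norm1 (duhamel al u (fun t => q jm.1 jm.2 t * w t) x) <= e' * M.
  move=> [j m]; have [rho r0 hr] := duhamel_oscillation (hq j m) e'0.
  by exists rho; split.
(* Entries with [b_j = b_m] contribute 0 here, as division by 0 gives 0. *)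
pose F (jm : 'I_n * 'I_n) := 2 * rh jm / norm1 ('i%C * (b jm.2 - b jm.1)).
have F0 jm : 0 <= F jm.
  by rewrite divr_ge0 ?norm1_ge0// mulr_ge0// ltW//; have [] := hrh jm.
exists (1 + \sum_jm F jm); first by rewrite ltr_pwDl// sumr_ge0.
move=> z w g M hz hrho pw ig M0 wM gM j x hx.
have rw : vbmeas w by move=> i; exact: prim_of_bmeas (pw i).
have iqw m : cint (fun t => q j m t * w m t) by exact: cintM.
rewrite /volterra /src duhamelZ//; last exact: cint_sum.
rewrite duhamel_sum//.
apply: (@le_trans _ _ (B * \sum_(m < n) e' * M)); last first.
  rewrite sumr_const card_ord -[X in B * X]mulr_natr /e'.
  rewrite (_ : B * (e / (B * n.+1%:R) * M * n%:R) = e * M * (n%:R / n.+1%:R)).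
    rewrite ler_piMr ?mulr_ge0 ?(ltW e0) ?(ltW M0)//.
    by rewrite ler_pdivrMr// mul1r ler_nat.
  by field; rewrite (gt_eqF B0) andbT.
rewrite (le_trans (norm1M _ _))// ler_pM ?norm1_ge0//.
rewrite (le_trans (norm1_sum _ _ _))// ler_sum// => m _.
have [bjm|bjm] := eqVneq (b j) (b m).
  rewrite (@duhamel_eq _ _ _ _ (fun=> 0 * 0)) ?duhamelZ//; first last.
    by move=> t _; rewrite q0// !mul0r.
    exact: cint_cst.
  by rewrite mul0r norm1_0 mulr_ge0// ltW.
have [r0 hr] := hrh (j, m).
apply: (hr _ (rate m z) _ _ (g m)) => //; first by move=> t ht; exact: wM.
have -> : rate m z - rate j z = ('i%C * (b m - b j)) * z by rewrite /rate; ring.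
have N0 : 0 < norm1 ('i%C * (b m - b j)).
  by rewrite norm1_gt0// mulf_neq0 ?i_neq0// subr_eq0 eq_sym.
have hF : F (j, m) <= norm1 z.
  apply: le_trans hrho; rewrite (le_trans (ler_sum_single (F := F) (j, m) _))//.
  by rewrite lerDr.
have := norm1M_ge ('i%C * (b m - b j)) z.
move: hF; rewrite /F /= ler_pdivrMr// [_ * norm1 ('i%C * _)]mulrC => h1 h2; lra.
Qed.

(** With the factor 1/4 for the square of the operator, successive Picard differences
    decay like [2^-m], as if the operator itself had norm 1/2. *)
Definition contractive z := admissible_at z /\
  forall u M, vbmeas u -> 0 < M -> vbounded M u -> vbounded (M / 4) (volterra z (volterra z u)).

(** [w = K_z u] satisfies the differential relation required in [volterra_small], with
    [g = src u]. *)
Lemma contractive_large : (forall j l x, b j = b l -> q j l x = 0) ->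
  exists2 rho : R, 0 < rho & forall z, admissible_at z -> rho <= norm1 z -> contractive z.
Proof.
move=> q0; have C0 : 0 < volterra_const + 1 by rewrite ltr_wpDl// volterra_const_ge0.
have e0 : 0 < 1 / 4 / (volterra_const + 1) by rewrite !divr_gt0.
have [rho r0 hr] := volterra_small q0 e0.
exists rho => // z hz hrho; split=> // u M hu M0 hM.
have MM : M / 4 = 1 / 4 / (volterra_const + 1) * ((volterra_const + 1) * M).
  by field; rewrite gt_eqF.
rewrite MM; apply: (hr z _ (src u)) => //.
- by move=> j; exact: volterra_prim.
- by move=> j; exact: src_cint.
- by rewrite mulr_gt0.
- apply: vbounded_le (volterra_bounded hz hu (ltW M0) hM).
  by rewrite ler_wpM2r ?ltW// ltrDl.
- move=> j; rewrite (le_trans (src_norm j hu (ltW M0) hM))// ler_wpM2r ?ltW//.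
  by rewrite /volterra_const; have := src_const_ge0; lra.
Qed.

(** Starting from any bound [B], iteration replaces [B] by [2 c + B / 2 ^+ m]. *)
Lemma vbounded_contract u (c : R) : vbmeas u -> 0 <= c ->
  (forall B, 0 < B -> vbounded B u -> vbounded (c + B / 4) u) -> vbounded (2 * c) u.
Proof.
move=> hu c0 h; have [B B0 hB] := vbmeas_bounded hu.
have it m : vbounded (2 * c + B / 2 ^+ m) u.
  elim: m => [|m IH]; first by apply: vbounded_le hB; rewrite expr0 divr1 lerDr mulr_ge0.
  have P0 : 0 < B / 2 ^+ m by rewrite divr_gt0// exprn_gt0.
  apply: vbounded_le (h _ _ IH); last by rewrite ltr_wpDl// mulr_ge0.
  rewrite exprS invfM; have -> : B * (2^-1 * (2 ^+ m)^-1) = (B / 2 ^+ m) / 2 by ring.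
  lra.
by move=> j x hx; apply: (@le_geometric _ _ _ B) => m; exact: it.
Qed.

Definition apriori_const : R := 2 * (1 + volterra_const).

(** With [d = w - K_z w] one has [w = d + K_z d + K_z (K_z w)], and the last term is at most a
    quarter of any bound for [w]. *)
Lemma apriori z w M : contractive z -> vbmeas w -> 0 <= M ->
  vbounded M (fun j x => w j x - volterra z w j x) -> vbounded (apriori_const * M) w.
Proof.
move=> [hz hK] hw M0 hM; rewrite /apriori_const -mulrA; apply: vbounded_contract => //.
  by rewrite mulr_ge0// addr_ge0// volterra_const_ge0.
move=> B B0 hB; set d := (fun j x => _) in hM.
have rd : vbmeas d by apply: vbmeasB => //; exact: volterra_bmeas.
have e1 : eq01 (fun j x => (d j x + volterra z d j x) + volterra z (volterra z w) j x) w.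
  move=> j x hx; rewrite volterraB//; last exact: volterra_bmeas.
  by rewrite /d; ring.
apply: vbounded_eq e1 _; rewrite mulrDl mul1r; apply: vboundedD; last exact: hK.
apply: vboundedD => //; exact: volterra_bounded.
Qed.

Lemma geometric_cvg_vec (U : nat -> 'I_n -> R -> R[i]) (D : R) :
  (forall m, vbmeas (U m)) ->
  (forall m, vbounded (D / 2 ^+ m) (fun j x => U m.+1 j x - U m j x)) ->
  exists2 u, vbmeas u & forall m, vbounded (4 * D / 2 ^+ m) (fun j x => u j x - U m j x).
Proof.
move=> hU hD.
have ex (jx : 'I_n * R) : exists L : R[i], 0 <= jx.2 <= 1 ->
    [/\ (fun m => Re (U m jx.1 jx.2)) @ \oo --> Re L,
        (fun m => Im (U m jx.1 jx.2)) @ \oo --> Im L &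
        forall m, norm1 (L - U m jx.1 jx.2) <= 4 * D / 2 ^+ m].
  case: jx => j x /=.
  have [hx|hx] := boolP (0 <= x <= 1); last by exists 0.
  have h1 m : `|Re (U m.+1 j x) - Re (U m j x)| <= D / 2 ^+ m.
    by rewrite -ReB (le_trans (ler_Re _))//; exact: hD.
  have h2 m : `|Im (U m.+1 j x) - Im (U m j x)| <= D / 2 ^+ m.
    by rewrite -ImB (le_trans (ler_Im _))//; exact: hD.
  have [L1 c1 l1] := geometric_cvg h1.
  have [L2 c2 l2] := geometric_cvg h2.
  exists (L1 +i* L2) => _; split => // m.
  rewrite /norm1 ReB ImB /= (le_trans (lerD (l1 m) (l2 m)))//.
  by rewrite -mulrDl; have -> : 2 * D + 2 * D = 4 * D by ring.
have /choice [u0 hu0] := ex.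
pose u j x := u0 (j, x).
have hu j x : 0 <= x <= 1 -> forall m, norm1 (u j x - U m j x) <= 4 * D / 2 ^+ m.
  by move=> hx; have [] := hu0 (j, x) hx.
exists u; last by move=> m j x hx; exact: hu.
move=> j; split.
- apply: (@measurable_fun_cvg _ _ _ _ (fun m x => Re (U m j x))).
    by move=> m; have [] := hU m j.
  by move=> x; rewrite /= in_itv/= => hx; have [] := hu0 (j, x) hx.
- apply: (@measurable_fun_cvg _ _ _ _ (fun m x => Im (U m j x))).
    by move=> m; have [] := hU m j.
  by move=> x; rewrite /= in_itv/= => hx; have [] := hu0 (j, x) hx.
- have [_ _ [M hM]] := hU 0%N j.
  exists (4 * D + M) => x hx.
  have -> : u j x = (u j x - U 0%N j x) + U 0%N j x by ring.
  rewrite (le_trans (norm1D _ _))// lerD// ?hM//.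
  by have := hu j x hx 0%N; rewrite expr0 divr1.
Qed.

(** Picard iteration. *)
Lemma solve z phi : contractive z -> vbmeas phi ->
  exists2 u, vbmeas u & eq01 u (fun j x => phi j x + volterra z u j x).
Proof.
move=> gz hphi; have [hz hK] := gz.
pose U := fix U m := if m is m'.+1 then (fun j x => phi j x + volterra z (U m') j x) else phi.
have hU m : vbmeas (U m).
  by elim: m => [//|m IH] /=; apply: vbmeasD => //; exact: volterra_bmeas.
pose d m : 'I_n -> R -> R[i] := fun j x => U m.+1 j x - U m j x.
have rd m : vbmeas (d m) by exact: vbmeasB.
have dK m : eq01 (volterra z (d m)) (d m.+1).
  by move=> j x hx; rewrite volterraB// /d /=; ring.
have [D0 D00 hD0] := vbmeas_bounded (rd 0%N); have [D1 D10 hD1] := vbmeas_bounded (rd 1%N).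
(* Large enough for the first two differences, so that both parities start. *)
pose D := D0 + 2 * D1.
have Dpos : 0 < D by rewrite addr_gt0// mulr_gt0.
have hd m : vbounded (D / 2 ^+ m) (d m) /\ vbounded (D / 2 ^+ m.+1) (d m.+1).
  elim: m => [|m [IH1 IH2]].
    split; first by apply: vbounded_le hD0; rewrite expr0 divr1 lerDl mulr_ge0// ltW.
    by apply: vbounded_le hD1; rewrite expr1 ler_pdivlMr// /D; lra.
  split; first exact: IH2.
  have e2 : eq01 (volterra z (volterra z (d m))) (d m.+2).
    by move=> j x hx; rewrite (volterra_eq z (dK m))// dK.
  apply: vbounded_eq e2 _.
  have -> : D / 2 ^+ m.+2 = D / 2 ^+ m / 4.
    by rewrite !exprS; field; rewrite expf_neq0.
  by apply: hK => //; rewrite divr_gt0// exprn_gt0.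
have [u ru hu] := @geometric_cvg_vec U D hU (fun m => (hd m).1).
exists u => // j x hx; apply/eqP; rewrite -subr_eq0; apply/eqP/norm1_eq0.
apply: (@le_geometric _ _ _ (4 * D * (1 + volterra_const))) => m; rewrite add0r.
have -> : u j x - (phi j x + volterra z u j x) =
  (u j x - U m.+1 j x) + - volterra z (fun j x => u j x - U m j x) j x.
  by rewrite volterraB//=; ring.
rewrite (le_trans (norm1D _ _))// norm1N.
have P0 : 0 <= 4 * D / 2 ^+ m by rewrite divr_ge0 ?exprn_ge0// mulr_ge0// ltW.
have h1 := hu m.+1 j x hx.
have h2 := volterra_bounded hz (vbmeasB ru (hU m)) P0 (hu m) j hx.
rewrite (le_trans (lerD h1 h2))//.
have : 4 * D / 2 ^+ m.+1 <= 4 * D / 2 ^+ m.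
  rewrite ler_wpM2l ?mulr_ge0 ?(ltW Dpos)// lef_pV2 ?posrE ?exprn_gt0//.
  by rewrite ler_weXn2l// ler1n.
have -> : 4 * D * (1 + volterra_const) / 2 ^+ m =
  4 * D / 2 ^+ m + volterra_const * (4 * D / 2 ^+ m) by ring.
by move=> h3; rewrite lerD2r.
Qed.

End System.

(** * Complex differentiability with a quadratic remainder *)

Section ComplexDiff.
Context {R : realType}.
Implicit Types (f g : R[i] -> R[i]) (z d : R[i]).

(** A quadratic remainder is what the a priori estimate for the columns provides, and
    it makes the product rule elementary. *)
Definition quad_diff f z := exists d, exists C, exists2 del : R, 0 < del &
  forall z', norm1 (z' - z) <= del ->
    norm1 (f z' - f z - (z' - z) * d) <= C * norm1 (z' - z) ^+ 2.

Lemma quad_diffM f g z : quad_diff f z -> quad_diff g z ->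
  quad_diff (fun z => f z * g z) z.
Proof.
move=> [d [C [r r0 hf]]] [d' [C' [r' r'0 hg]]].
exists (d * g z + f z * d').
exists (`|C| * (norm1 (g z) + norm1 d' + `|C'|) + (norm1 (f z) + norm1 d) * `|C'|
  + norm1 d * norm1 d').
exists (Num.min 1 (Num.min r r')); first by rewrite !lt_min ltr01 r0.
move=> z'; rewrite !le_min => /andP[h1 /andP[hr hr']].
have := hf z' hr; have := hg z' hr'.
set h := z' - z; set ef := f z' - f z - h * d; set eg := g z' - g z - h * d'.
have n0 := norm1_ge0 h; rewrite -/h in h1.
set t := norm1 h in n0 h1 *.
move=> Hg Hf.
have t2 : 0 <= t ^+ 2 by exact: exprn_ge0.
have Hf' : norm1 ef <= `|C| * t ^+ 2 by rewrite (le_trans Hf)// ler_wpM2r// ler_norm.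
have Hg' : norm1 eg <= `|C'| * t ^+ 2 by rewrite (le_trans Hg)// ler_wpM2r// ler_norm.
have tt : t ^+ 2 <= 1 by rewrite exprn_ile1.
have -> : f z' * g z' - f z * g z - h * (d * g z + f z * d') =
  ef * (g z + h * d' + eg) + (f z + h * d) * eg + (h * d) * (h * d').
  by rewrite /ef /eg; ring.
have hd e : norm1 (h * e) <= norm1 e.
  by rewrite (le_trans (norm1M _ _))// ler_piMl// norm1_ge0.
have B1 : norm1 (g z + h * d' + eg) <= norm1 (g z) + norm1 d' + `|C'|.
  rewrite (le_trans (norm1D _ _))// lerD//; last first.
    by rewrite (le_trans Hg')// ler_piMr.
  by rewrite (le_trans (norm1D _ _))// lerD.
have B2 : norm1 (f z + h * d) <= norm1 (f z) + norm1 d.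
  by rewrite (le_trans (norm1D _ _))// lerD.
have T1 : norm1 (ef * (g z + h * d' + eg)) <= `|C| * t ^+ 2 * (norm1 (g z) + norm1 d' + `|C'|).
  by rewrite (le_trans (norm1M _ _))// ler_pM ?norm1_ge0.
have T2 : norm1 ((f z + h * d) * eg) <= (norm1 (f z) + norm1 d) * (`|C'| * t ^+ 2).
  by rewrite (le_trans (norm1M _ _))// ler_pM ?norm1_ge0.
have T3 : norm1 (h * d * (h * d')) <= (t * norm1 d) * (t * norm1 d').
  by rewrite (le_trans (norm1M _ _))// ler_pM ?norm1_ge0// norm1M.
rewrite (le_trans (norm1D _ _))// (le_trans (lerD (norm1D _ _) (lexx _)))//.
rewrite (le_trans (lerD (lerD T1 T2) T3))// le_eqVlt; apply/orP; left; apply/eqP; ring.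
Qed.

Lemma quad_diff_exp (c : R[i]) z : quad_diff (fun z => cexp (c * z)) z.
Proof.
pose A := 1 + norm1 c; have A0 : 0 < A by rewrite ltr_pwDl// norm1_ge0.
exists (c * cexp (c * z)); exists (norm1 (cexp (c * z)) * (A ^+ 2 * (2 * expR 1))).
exists (A^-1); first by rewrite invr_gt0.
move=> z' hz.
have -> : cexp (c * z') - cexp (c * z) - (z' - z) * (c * cexp (c * z)) =
   cexp (c * z) * (cexp (c * (z' - z)) - 1 - c * (z' - z)).
  have -> : cexp (c * z') = cexp (c * z) * cexp (c * (z' - z)).
    by rewrite -cexpD; congr cexp; ring.
  by ring.
rewrite (le_trans (norm1M _ _))// -[leRHS]mulrA ler_wpM2l ?norm1_ge0//.
have hc : norm1 (c * (z' - z)) <= A * norm1 (z' - z).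
  by rewrite (le_trans (norm1M _ _))// ler_wpM2r ?norm1_ge0// lerDr.
rewrite (le_trans (cexp_taylor _))//.
have -> : A ^+ 2 * (2 * expR 1) * norm1 (z' - z) ^+ 2 =
  (A * norm1 (z' - z)) ^+ 2 * (2 * expR 1) by ring.
rewrite ler_pM ?exprn_ge0 ?norm1_ge0// ?mulr_ge0 ?expR_ge0//.
  by rewrite lerXn2r ?nnegrE ?norm1_ge0// mulr_ge0 ?norm1_ge0// ltW.
rewrite ler_wpM2l// ler_expR (le_trans hc)// -(divff (lt0r_neq0 A0)).
by rewrite ler_wpM2l// ltW.
Qed.

Lemma quad_diff_derivable f z : quad_diff f z ->
  derivable (f : R[i]^o -> R[i]^o) z 1.
Proof.
move=> [d [C [r r0 hf]]].
apply/cvg_ex; exists d; apply/cvgrPdist_le => e e0.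
have e1 : 0 < Re e by move: e0; rewrite ltcE => /andP[].
have eE : e = (Re e)%:C.
  by move: e0; rewrite ltcE => /andP[/eqP h _]; apply: complexP.
pose s := Num.min r (Re e / (2 * (1 + `|C|))).
have C1 : 0 < 1 + `|C| by rewrite ltr_pwDl.
have s0 : 0 < s by rewrite lt_min r0 divr_gt0// mulr_gt0.
exists ((s / 2)%:C) => /=; first by rewrite ltcR divr_gt0.
move=> h /=; rewrite sub0r normrN => hs h0.
have hs' : norm1 h < s by have := norm1_lt_normc hs; rewrite mulrC divfK.
have := hf (h + z); rewrite addrK => /(_ _).
have hr : norm1 h <= r by rewrite (le_trans (ltW hs'))// ge_min lexx.
move=> /(_ hr) H.
rewrite /GRing.scale /= mulr1 eE.
have -> : d - h^-1 * (f (h + z) - f z) = - (h^-1 * (f (h + z) - f z - h * d)).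
  by field.
rewrite (le_trans (normc_le_norm1 _))// lecR norm1N (le_trans (norm1M _ _))//.
have N0 := norm1_gt0 h0.
apply: (@le_trans _ _ (2 / norm1 h * (`|C| * norm1 h ^+ 2))).
  rewrite ler_pM ?norm1_ge0// ?norm1V// (le_trans H)//.
  by rewrite ler_wpM2r ?exprn_ge0 ?norm1_ge0// ler_norm.
have -> : 2 / norm1 h * (`|C| * norm1 h ^+ 2) = 2 * `|C| * norm1 h.
  by field; rewrite gt_eqF.
have hs2 : norm1 h <= Re e / (2 * (1 + `|C|)).
  by rewrite (le_trans (ltW hs'))// ge_min lexx orbT.
move: hs2; rewrite ler_pdivlMr ?mulr_gt0//.
have : 0 <= `|C| by [].
lra.
Qed.

End ComplexDiff.

(** * The columns: bounds, asymptotics, analyticity *)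

Section Column.
Context {R : realType} (n : nat) (b : 'I_n -> R[i]) (q : 'I_n -> 'I_n -> R -> R[i]).
Context (k : 'I_n) (up : pred 'I_n).
Context (hq : forall j l, cint (q j l)).
Context (hup : forall j, b j = b k -> ~~ up j).
Implicit Types (u v w g : 'I_n -> R -> R[i]) (z : R[i]).

Local Notation rate := (rate b k).
Local Notation src := (src b q).
Local Notation volterra := (volterra b q k up).
Local Notation admissible_at := (admissible_at b k up).
Local Notation contractive := (contractive b q k up).
Local Notation src_const := (src_const b q).
Local Notation apriori_const := (apriori_const b q).

Definition unit_vec (j : 'I_n) (x : R) : R[i] := (j == k)%:R.

(** The integral equation of the [k]-th column after removal of [e^(i b_k z x)]. *)
Definition column z u := vbmeas u /\ eq01 u (fun j x => unit_vec j x + volterra z u j x).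

Lemma unit_vec_bmeas : vbmeas unit_vec. Proof. by move=> j; exact: bmeas_cst. Qed.

Lemma column_exists : exists U : R[i] -> 'I_n -> R -> R[i],
  forall z, contractive z -> column z (U z).
Proof.
have /choice [U hU] : forall z, exists u, contractive z -> column z u.
  move=> z; have [gz|ngz] := pselect (contractive z); last by exists unit_vec.
  by have [u ru hu] := solve hq gz unit_vec_bmeas; exists u.
by exists U.
Qed.

Lemma apriori_const_ge0 : 0 <= apriori_const.
Proof. by rewrite mulr_ge0// addr_ge0// volterra_const_ge0. Qed.

Lemma column_bounded z u : contractive z -> column z u -> vbounded apriori_const u.
Proof.
move=> gz [ru hu]; rewrite -[apriori_const]mulr1; apply: (apriori hq gz ru ler01).
move=> j x hx; rewrite hu// addrK /unit_vec.
by case: (j == k); rewrite ?norm1_1 ?norm1_0.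
Qed.

(** The constant [unit_vec] is compatible with the equation because [rate k = 0]. *)
Lemma column_prim z u j : column z u ->
  prim_of (u j) (fun t => rate j z * u j t + src u j t).
Proof.
move=> [ru hu].
have := prim_ofD (prim_of_cst (unit_vec j 0)) (volterra_prim b k up hq z j ru).
apply: prim_of_eq => t ht; first by rewrite hu.
rewrite hu// add0r mulrDr [X in X + _ + _](_ : _ = 0) ?add0r//.
by rewrite /rate /unit_vec; case: eqP => [->|_]; rewrite ?mulr0// subrr mulr0 !mul0r.
Qed.

Lemma column_at0 z u j : column z u -> ~~ up j -> u j 0 = unit_vec j 0.
Proof.
move=> [ru hu] /negbTE nj; rewrite hu ?lexx ?ler01//.
by rewrite /volterra nj duhamel_at0 addr0.
Qed.

Lemma up_neq j : up j -> unit_vec j 0 = 0.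
Proof.
by move=> uj; rewrite /unit_vec; case: eqP => // jk; move: uj; rewrite jk (negbTE (hup _)).
Qed.

Lemma column_at1 z u j : column z u -> up j -> u j 1 = 0.
Proof.
move=> [ru hu] uj; rewrite hu ?lexx ?ler01//.
by rewrite /volterra uj duhamel_at1 addr0; exact: up_neq.
Qed.

Lemma column_at0_up z u j : column z u -> up j ->
  u j 0 = - cprim (fun t => cexp (- rate j z * t%:C) * src u j t) 1.
Proof.
move=> [ru hu] uj; rewrite hu ?lexx ?ler01//.
rewrite (_ : unit_vec j 0 = 0) ?add0r ?up_neq// /volterra uj /duhamel mulr0 cexp0 mul1r.
by rewrite cprim0 sub0r.
Qed.

Lemma column_at1_down z u j : column z u -> ~~ up j ->
  u j 1 = unit_vec j 0 + cprim (fun t => cexp (rate j z * (1 - t)%:C) * src u j t) 1.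
Proof.
move=> [ru hu] /negbTE uj; rewrite hu ?lexx ?ler01//.
rewrite /volterra uj duhamelE ?lexx ?ler01// ?subr0//.
exact: src_cint.
Qed.

(** [u - unit_vec = K_z u], and by [column_prim] and [column_bounded] the solution [u]
    itself may play the role of [w] in [volterra_small]. *)
Lemma column_asym (e : R) : (forall j l x, b j = b l -> q j l x = 0) -> 0 < e ->
  exists2 rho : R, 0 < rho & forall z u, contractive z -> rho <= norm1 z -> column z u ->
    vbounded e (fun j x => u j x - unit_vec j x).
Proof.
move=> q0 e0; pose M := (src_const + 1) * (apriori_const + 1).
have cQ0 := src_const_ge0 b hq; have c0 := apriori_const_ge0.
have M0 : 0 < M by rewrite mulr_gt0// ltr_wpDl.
have [rho r0 hr] := volterra_small k up hq q0 (divr_gt0 e0 M0).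
exists rho => // z u gz hrho cu; have [ru hu] := cu; have hb := column_bounded gz cu.
rewrite -(divfK (lt0r_neq0 M0) e).
apply: (@vbounded_eq _ _ _ (volterra z u)).
  by move=> j x hx; rewrite [in RHS]hu// addrC addKr.
apply: (hr z u (src u)) => //.
- by case: gz.
- by move=> j; exact: column_prim.
- by move=> j; exact: src_cint.
- apply: vbounded_le hb; rewrite /M mulrDl mul1r.
  have : 0 <= src_const * (apriori_const + 1) by rewrite mulr_ge0// addr_ge0.
  lra.
- move=> j; rewrite (le_trans (src_norm b hq j ru c0 hb))// /M mulrDl mul1r mulrDr mulr1.
  by rewrite -addrA lerDl !addr_ge0.
Qed.

Definition volterra_diff z u (j : 'I_n) (x : R) : R[i] :=
  'i%C * (b j - b k) * duhamel_diff (rate j z) (up j) (src u j) x.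

Lemma volterra_diff_bmeas z u : vbmeas u -> vbmeas (volterra_diff z u).
Proof.
by move=> ru j; apply: bmeasZ; apply: duhamel_diff_bmeas; exact: src_cint.
Qed.

Definition rate_const : R := 1 + \sum_j norm1 ('i%C * (b j - b k)).

Lemma rate_const_gt0 : 0 < rate_const.
Proof. by rewrite ltr_pwDl// sumr_ge0// => *; exact: norm1_ge0. Qed.

Lemma norm1_rate j z : norm1 (rate j z) <= rate_const * norm1 z.
Proof.
rewrite (le_trans (norm1M _ _))// ler_wpM2r ?norm1_ge0//.
rewrite (le_trans (ler_sum_single (F := fun j => norm1 ('i%C * (b j - b k))) j _))//.
  by move=> i; exact: norm1_ge0.
by rewrite lerDr.
Qed.

Lemma rateB j z z' : rate j z' - rate j z = rate j (z' - z).
Proof. by rewrite /rate; ring. Qed.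

Lemma volterra_taylor z u : admissible_at z -> vbmeas u -> exists2 C : R, 0 <= C &
  forall z', admissible_at z' -> norm1 (z' - z) <= rate_const^-1 ->
  vbounded (C * norm1 (z' - z) ^+ 2)
      (fun j x => volterra z' u j x - volterra z u j x - (z' - z) * volterra_diff z u j x).
Proof.
move=> hz ru; have [M M0 hM] := vbmeas_bounded ru.
have cQ0 := src_const_ge0 b hq; have A0 := rate_const_gt0.
exists (4 * expR 1 * rate_const ^+ 2 * (src_const * M)).
  by rewrite !mulr_ge0 ?expR_ge0 ?exprn_ge0// ltW.
move=> z' hz' hzz j x hx.
have -> : (z' - z) * volterra_diff z u j x =
   (rate j z' - rate j z) * duhamel_diff (rate j z) (up j) (src u j) x.
  by rewrite /volterra_diff /rate; ring.
have hr1 : norm1 (rate j z' - rate j z) <= rate_const * norm1 (z' - z).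
  by rewrite rateB norm1_rate.
rewrite (le_trans (duhamel_taylor (hz j) (hz' j) (src_cint b hq j ru) hx _))//.
  by rewrite (le_trans hr1)// -(divff (lt0r_neq0 A0)) ler_wpM2l// ltW.
have -> : 4 * expR 1 * rate_const ^+ 2 * (src_const * M) * norm1 (z' - z) ^+ 2 =
  4 * expR 1 * (rate_const * norm1 (z' - z)) ^+ 2 * (src_const * M) by ring.
rewrite ler_pM ?mulr_ge0 ?expR_ge0 ?exprn_ge0 ?norm1_ge0//.
- exact/prim_norm_ge0/src_cint.
- rewrite ler_wpM2l ?mulr_ge0 ?expR_ge0// lerXn2r ?nnegrE ?norm1_ge0//.
  by rewrite mulr_ge0 ?norm1_ge0// ltW.
- by apply: src_norm => //; exact: ltW.
Qed.

(** Let [v] solve [v = (dK_z/dz) u_z + K_z v]. The remainder [u_z' - u_z - (z' - z) v] solves the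
    equation at [z'] up to an error of second order, so [apriori] bounds it. *)
Lemma column_diff (U : R[i] -> 'I_n -> R -> R[i]) z (del : R) j x :
  0 < del -> (forall z', norm1 (z' - z) <= del -> contractive z' /\ column z' (U z')) ->
  0 <= x <= 1 -> quad_diff (fun z => U z j x) z.
Proof.
move=> d0 hgood hx.
have [gz cz] : contractive z /\ column z (U z) by apply: hgood; rewrite subrr norm1_0 ltW.
have [ru hu] := cz; have [az _] := gz.
have [v rv hv] := solve hq gz (volterra_diff_bmeas z ru).
have [C1 C10 h1] := volterra_taylor az ru.
have [C2 C20 h2] := volterra_taylor az rv.
have [D D0 hD] := vbmeas_bounded (volterra_diff_bmeas z rv).
have A0 := rate_const_gt0.
exists (v j x), (apriori_const * (C1 + (C2 + D))), (Num.min (Num.min del 1) rate_const^-1).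
  by rewrite !lt_min d0 ltr01 invr_gt0.
move=> z'; rewrite !le_min -andbA => /and3P[hd hl hr].
have [gz' cz'] := hgood z' hd; have [ru' hu'] := cz'; have [az' _] := gz'.
set h := z' - z in hd hl hr *; set t := norm1 h in hd hl hr *.
have t0 : 0 <= t := norm1_ge0 h.
pose w : 'I_n -> R -> R[i] := fun i s => U z' i s - U z i s - h * v i s.
have rhv : vbmeas (fun i s => h * v i s) by move=> i; exact: bmeasZ.
have rw : vbmeas w by apply: vbmeasB => //; exact: vbmeasB.
rewrite -[_ - _]/(w j x) -mulrA; apply: (apriori hq gz' rw) => //.
  by rewrite mulr_ge0 ?exprn_ge0// !addr_ge0// ltW.
move=> i s hs.
have -> : w i s - volterra z' w i s =
   (volterra z' (U z) i s - volterra z (U z) i s - h * volterra_diff z (U z) i s) +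
   h * ((volterra z' v i s - volterra z v i s - h * volterra_diff z v i s) +
        h * volterra_diff z v i s).
  rewrite (volterraB b k up hq z' (vbmeasB ru' ru) rhv i hs).
  rewrite (volterraB b k up hq z' ru' ru i hs) (volterraZ b k up hq z' h rv i hs).
  rewrite /w (hu' i s hs) (hu i s hs) (hv i s hs).
  have alg (p a' c' a v' v0 du dv e : R[i]) :
    p + a' - (p + a) - e * (du + v0) - (a' - c' - e * v') =
    (c' - a - e * du) + e * ((v' - v0 - e * dv) + e * dv) by ring.
  exact: alg.
rewrite [leRHS]mulrDl (le_trans (norm1D _ _))// lerD//; first exact: h1.
rewrite (le_trans (norm1M _ _))// expr2 [leRHS]mulrCA ler_wpM2l ?norm1_ge0//.
rewrite [leRHS]mulrDl (le_trans (norm1D _ _))// lerD//.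
  rewrite (le_trans (h2 z' az' hr i s hs))// -/h -/t ler_wpM2l// expr2.
  by rewrite ler_piMr.
by rewrite (le_trans (norm1M _ _))// mulrC ler_wpM2r ?hD.
Qed.

End Column.

(** * Exponential approximate identities *)

Section ApproxIdentity.
Context {R : realType}.

(** Continuity relative to [0, 1], one-sided at the endpoints. *)
Definition cont_at01 (q : R -> R[i]) (t0 : R) := forall e : R, 0 < e ->
  exists2 d : R, 0 < d & forall t, 0 <= t <= 1 -> `|t - t0| <= d ->
    norm1 (q t - q t0) <= e.

(** Near [t0] the factor [q u] is close to [q(t0) kap] and the kernel has mass at most
    [A]; far from [t0] the kernel is small and [q] is integrable. *)
Lemma approx_identity (q : R -> R[i]) (t0 A e : R) : cint q -> cont_at01 q t0 ->
  0 < A -> 0 < e ->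
  exists d, exists eta, [/\ 0 < d, 0 < eta & forall (ker u : R -> R[i]) (kap : R[i]),
    bmeas ker -> bmeas u -> norm1 kap <= 1 -> prim (fun t => norm1 (ker t)) 1 <= A ->
    norm1 (cprim ker 1 - 1) <= eta ->
    (forall t, 0 <= t <= 1 -> d <= `|t - t0| -> norm1 (ker t) <= eta) ->
    (forall t, 0 <= t <= 1 -> norm1 (u t - kap) <= eta) ->
    norm1 (cprim (fun t => ker t * (q t * u t)) 1 - q t0 * kap) <= e].
Proof.
move=> iq cq A0 e0.
have e10 : 0 < e / (4 * A) by rewrite divr_gt0// mulr_gt0.
have [d d0 hd] := cq _ e10.
pose q0 := norm1 (q t0); pose nq := prim (fun t => norm1 (q t)) 1.
have q00 : 0 <= q0 := norm1_ge0 _.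
have nq0 : 0 <= nq := prim_norm_ge0 iq.
(* The total coefficient of [eta] in the final estimate, plus one. *)
pose G := A * q0 + (2 * nq + 2 * q0) + q0 + 1.
have G0 : 0 < G.
  by rewrite ltr_wpDl// addr_ge0// addr_ge0// ?addr_ge0// ?mulr_ge0// ltW.
pose eta := Num.min 1 (e / 2 / G).
have eta0 : 0 < eta by rewrite lt_min ltr01 !divr_gt0.
have eta1 : eta <= 1 by rewrite ge_min lexx.
have etaG : eta * G <= e / 2 by rewrite -ler_pdivlMr// ge_min lexx orbT.
exists d, eta; split => // ker u kap bk bu kap1 kA k1 kfar hu.
have iqu : cint (fun t => q t * u t) := cintM iq bu.
have ik : cint ker := bmeas_cint bk.
have i1 : cint (fun t => ker t * (q t * u t)) by exact: cintMl.
have i2 : cint (fun t => ker t * (q t * u t - q t0 * kap)).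
  by apply: cintMl => //; apply: cintB => //; exact: cint_cst.
have -> : cprim (fun t => ker t * (q t * u t)) 1 - q t0 * kap =
  (cprim (fun t => ker t * (q t * u t - q t0 * kap)) 1 -
   cprim (fun t => ker t * (q t * u t - q t0 * kap)) 0) + (q t0 * kap) * (cprim ker 1 - 1).
  have -> : cprim (fun t => ker t * (q t * u t)) 1 =
     cprim (fun t => ker t * (q t * u t - q t0 * kap)) 1 + (q t0 * kap) * cprim ker 1.
    rewrite -cprimZ// -cprimD//; last exact: cintZ.
    by apply: cprim_eq => t _; ring.
  by rewrite cprim0; ring.
have B2 : norm1 (q t0 * kap * (cprim ker 1 - 1)) <= q0 * eta.
  rewrite (le_trans (norm1M _ _))// ler_pM ?norm1_ge0//.
  by rewrite (le_trans (norm1M _ _))// ler_piMr.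
pose c1 := 2 * (e / (4 * A)) + q0 * eta.
have c10 : 0 <= c1 by rewrite addr_ge0// mulr_ge0// ltW.
pose h t := c1 * norm1 (ker t) + eta * (2 * norm1 (q t) + 2 * q0).
have ih1 : int01 (fun t => norm1 (ker t)) by exact: cint_norm1.
have ih2 : int01 (fun t => norm1 (q t)) by exact: cint_norm1.
have ih3 : int01 (fun t => 2 * norm1 (q t) + 2 * q0).
  exact: (int01D (int01Z 2 ih2) (int01_cst (2 * q0))).
have ih : int01 h by exact: (int01D (int01Z c1 ih1) (int01Z eta ih3)).
have B1 : norm1 (cprim (fun t => ker t * (q t * u t - q t0 * kap)) 1 -
   cprim (fun t => ker t * (q t * u t - q t0 * kap)) 0) <= prim h 1 - prim h 0.
  apply: cprim_bound => // t ht; rewrite (le_trans (norm1M _ _))//.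
  have u2 : norm1 (u t) <= 2.
    have -> : u t = (u t - kap) + kap by ring.
    by rewrite (le_trans (norm1D _ _))//; have := hu t ht; lra.
  have nqt := norm1_ge0 (q t); have nk := norm1_ge0 (ker t).
  have [near|far] := leP `|t - t0| d.
    have hq := hd t ht near.
    apply: (@le_trans _ _ (c1 * norm1 (ker t))); last first.
      by rewrite lerDl !mulr_ge0 ?addr_ge0 ?mulr_ge0// ltW.
    rewrite mulrC ler_wpM2r//.
    have -> : q t * u t - q t0 * kap = (q t - q t0) * u t + q t0 * (u t - kap) by ring.
    rewrite (le_trans (norm1D _ _))// lerD//.
      by rewrite (le_trans (norm1M _ _))// mulrC ler_pM ?norm1_ge0.
    by rewrite (le_trans (norm1M _ _))// ler_wpM2l// hu.
  apply: (@le_trans _ _ (eta * (2 * norm1 (q t) + 2 * q0))); last first.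
    by rewrite lerDr mulr_ge0.
  rewrite ler_pM ?norm1_ge0//; first by apply: kfar => //; exact: ltW.
  rewrite (le_trans (norm1D _ _))// norm1N lerD//.
    by rewrite (le_trans (norm1M _ _))// mulrC ler_wpM2r.
  rewrite (le_trans (norm1M _ _))//.
  apply: (@le_trans _ _ q0); first by rewrite ler_piMr.
  lra.
have B3 : prim h 1 - prim h 0 <= c1 * A + eta * (2 * nq + 2 * q0).
  rewrite prim0 subr0 /h primD//; [|exact: (int01Z c1 ih1)|exact: (int01Z eta ih3)].
  rewrite (primZ c1 ih1)// (primZ eta ih3)//.
  rewrite (primD (int01Z 2 ih2) (int01_cst (2 * q0)))// (primZ 2 ih2)// prim_cst// mulr1.
  by rewrite lerD// ler_wpM2l.
rewrite (le_trans (norm1D _ _))// (le_trans (lerD B1 B2))//.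
rewrite (le_trans (lerD B3 (lexx _)))//.
have E : c1 * A = e / 2 + q0 * eta * A.
  by rewrite /c1; field; rewrite gt_eqF.
have -> : c1 * A + eta * (2 * nq + 2 * q0) + q0 * eta = e / 2 + (eta * G - eta).
  by rewrite E /G; ring.
by rewrite [leRHS]splitr lerD2l (le_trans _ etaG)// gerBl ltW.
Qed.

Lemma exp_small (a eta : R) : 0 < a -> 0 < eta -> exists2 rho : R, 1 <= rho &
  forall s, rho <= s -> 2 * s * expR (- (a * s)) <= eta.
Proof.
move=> a0 eta0; exists (Num.max 1 (8 / (a ^+ 2 * eta))); first by rewrite le_max lexx.
move=> s; rewrite ge_max => /andP[s1 hs].
have s0 : 0 < s by rewrite (lt_le_trans ltr01).
rewrite expRN ler_pdivrMr ?expR_gt0//.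
have h : (a * s / 2) ^+ 2 <= expR (a * s).
  have -> : expR (a * s) = expR (a * s / 2) ^+ 2.
    by rewrite expr2 -expRD; congr expR; field.
  rewrite lerXn2r ?nnegrE ?expR_ge0//.
    by rewrite divr_ge0// mulr_ge0// ltW.
  by rewrite (le_trans _ (expR_ge1Dx _))// lerDr.
apply: (@le_trans _ _ (eta * (a * s / 2) ^+ 2)); last by rewrite ler_wpM2l// ltW.
move: hs; rewrite ler_pdivrMr ?mulr_gt0 ?exprn_gt0// => hs.
have -> : eta * (a * s / 2) ^+ 2 = s * (s * (a ^+ 2 * eta)) / 4 by field.
have := ler_wpM2l (ltW s0) hs; lra.
Qed.

Lemma prim_expR (r x : R) : 0 <= x <= 1 ->
  prim (fun t => r * expR (r * t)) x = expR (r * x) - 1.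
Proof.
have Re_e (t : R) : Re (cexp (r%:C * t%:C)) = expR (r * t).
  by rewrite Re_cexp ReMr ImMr Re_real Im_real mul0r cos0 mulr1.
move=> hx; have [_ /(_ x hx)] := prim_of_exp r%:C.
move=> /(congr1 (@complex.Re R)); rewrite ReD !Re_e mulr0 expR0 => ->.
rewrite addrC addKr; apply: prim_eq => t _.
by rewrite ReM Re_e Re_real Im_real mul0r subr0.
Qed.

Lemma int01_expR (r c : R) : int01 (fun t => expR (r * t + c)).
Proof.
have [h _ _] := bmeas_exp r%:C.
apply: (@int01_eq _ (fun t => expR c * Re (cexp (r%:C * t%:C)))).
  by move=> t _; rewrite Re_cexp ReMr ImMr /= !mul0r cos0 mulr1 expRD mulrC.
by apply: int01Z; have [] := bmeas_cint (bmeas_exp r%:C).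
Qed.

(** The kernel [y e^(- y t)] and its reflection in the midpoint of [0, 1]. *)
Definition expker (s : bool) (y : R[i]) (t : R) : R[i] :=
  y * cexp (- y * (if s then 1 - t else t)%:C).

Lemma expker_bmeas s y : bmeas (expker s y).
Proof.
apply: bmeasZ; case: s; last exact: bmeas_exp.
exact: bmeas_exp_shift.
Qed.

Lemma norm1_expker s y t : norm1 (expker s y t) <=
  2 * norm1 y * expR (- (Re y * (if s then 1 - t else t))).
Proof.
rewrite (le_trans (norm1M _ _))// [2 * _]mulrC -mulrA ler_wpM2l ?norm1_ge0//.
by rewrite (le_trans (norm1_cexp _))// ReMr ReN mulNr.
Qed.

Lemma expker_mass s y : 0 < Re y ->
  prim (fun t => norm1 (expker s y t)) 1 <= 2 * norm1 y / Re y.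
Proof.
move=> y0; set r := Re y in y0 *.
pose g (t : R) := if s then expR (- r) * (r * expR (r * t)) else - (- r * expR (- r * t)).
have ie (r' : R) : int01 (fun t => r' * expR (r' * t)).
  apply: (@eq_fun_int01 _ (fun t => r' * expR (r' * t + 0))).
    by move=> t; rewrite addr0.
  exact: (int01Z r' (int01_expR r' 0)).
have ig : int01 g by rewrite /g; case: (s); [exact: (int01Z _ (ie r))|exact: (int01N (ie (- r)))].
have h := @prim_le_bound _ (fun t => norm1 (expker s y t)) g 0 1 (2 * norm1 y / r).
rewrite !prim0 !subr0 in h.
have C0 : 0 <= 2 * norm1 y / r by rewrite divr_ge0 ?mulr_ge0 ?norm1_ge0// ltW.
rewrite (le_trans (ler_norm _))// (le_trans (h _ ig _ _ _ _))//.
- exact/cint_norm1/bmeas_cint/expker_bmeas.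
- move=> t _; rewrite ger0_norm ?norm1_ge0// (le_trans (norm1_expker _ _ _))//.
  rewrite -/r -[leRHS]mulrA ler_wpM2l// ?mulr_ge0 ?norm1_ge0//.
  rewrite le_eqVlt; apply/orP; left; apply/eqP.
  rewrite /g; case: (s) => /=.
    have -> : - (r * (1 - t)) = - r + r * t by ring.
    by rewrite expRD [RHS]mulrCA mulKf ?gt_eqF.
  by rewrite !mulNr opprK mulKf ?gt_eqF.
- rewrite ler_piMr//; rewrite /g; case: (s).
    rewrite primZ// prim_expR ?ler01 ?lexx// mulr1 mulrBr mulr1 -expRD addNr expR0.
    by rewrite gerBl expR_ge0.
  have -> : prim (fun t => - (- r * expR (- r * t))) 1 = - prim (fun t => - r * expR (- r * t)) 1.
    by rewrite -[RHS]mulN1r -primZ//; apply: prim_eq => t _; rewrite mulN1r.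
  by rewrite prim_expR ?ler01 ?lexx// opprB gerBl expR_ge0.
Qed.

Lemma expker_total s y : cprim (expker s y) 1 = 1 - cexp (- y).
Proof.
have E (c : R[i]) : cprim (fun t => c * cexp (c * t%:C)) 1 = cexp c - 1.
  have [_ /(_ 1)] := prim_of_exp c; rewrite ler01 lexx => /(_ isT).
  by rewrite mulr1 mulr0 cexp0 => ->; rewrite [1 + _]addrC addrK.
have ie (c : R[i]) : cint (fun t => c * cexp (c * t%:C)).
  by apply: bmeas_cint; apply: bmeasZ; exact: bmeas_exp.
case: s.
  have -> : 1 - cexp (- y) = cexp (- y) * cprim (fun t => y * cexp (y * t%:C)) 1.
    by rewrite E mulrBr mulr1 [_ * cexp y]mulrC cexpNK.
  rewrite -cprimZ//; apply: cprim_eq => t _; rewrite /expker [RHS]mulrCA -cexpD.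
  by congr (_ * cexp _); rewrite rmorphB/=; ring.
rewrite -[RHS]opprB -E -mulN1r -cprimZ//.
by apply: cprim_eq => t _; rewrite /expker; ring.
Qed.

(** In the cone [c |y| <= Re y] the masses stay bounded by [2 / c], and everything else
    is controlled by [2 |y| e^(- c d |y|)]. *)
Lemma expker_concentrate (c d eta : R) : 0 < c -> 0 < d -> 0 < eta ->
  exists2 rho : R, 0 < rho & forall s y, rho <= norm1 y -> c * norm1 y <= Re y ->
    [/\ prim (fun t => norm1 (expker s y t)) 1 <= 2 / c,
        norm1 (cprim (expker s y) 1 - 1) <= eta &
        forall t, 0 <= t <= 1 -> d <= `|t - s%:R| -> norm1 (expker s y t) <= eta].
Proof.
move=> c0 d0 eta0.
pose d' := Num.min d 1.
have d'0 : 0 < d' by rewrite lt_min d0 ltr01.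
have [rho rho1 hr] := exp_small (mulr_gt0 c0 d'0) eta0.
have rho0 : 0 < rho by rewrite (lt_le_trans ltr01).
exists rho => // s y hy hc.
have y0 : 0 < norm1 y by rewrite (lt_le_trans rho0).
have r0 : 0 < Re y by rewrite (lt_le_trans _ hc)// mulr_gt0.
have far t : d' <= t -> 2 * norm1 y * expR (- (Re y * t)) <= eta.
  move=> td; rewrite (le_trans _ (hr _ hy))// ler_wpM2l ?mulr_ge0 ?norm1_ge0//.
  rewrite ler_expR lerN2 mulrAC ler_pM ?mulr_ge0 ?norm1_ge0 ?(ltW c0) ?(ltW d'0)//.
split.
- rewrite (le_trans (expker_mass s r0))// ler_pdivrMr// mulrAC ler_pdivlMr//.
  by have := hc; lra.
- rewrite expker_total addrAC subrr add0r norm1N (le_trans (norm1_cexp _))//.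
  have := far 1; rewrite mulr1 ReN => /(_ _) h.
  have d1 : d' <= 1 by rewrite ge_min lexx orbT.
  apply: le_trans (h d1); rewrite ler_wpM2r ?expR_ge0// ler_peMr//.
  exact: le_trans hy.
- move=> t /andP[t0 t1] td; rewrite (le_trans (norm1_expker _ _ _))// far//.
  have d'd : d' <= d by rewrite ge_min lexx.
  apply: (le_trans d'd); apply: (le_trans td); case: {td} (s) => /=.
    by rewrite ler0_norm ?subr_le0// opprB.
  by rewrite subr0 ger0_norm.
Qed.

End ApproxIdentity.

(** * Boundary values of the columns *)

Section Endpoints.
Context {R : realType} (n : nat) (b : 'I_n -> R[i]) (q : 'I_n -> 'I_n -> R -> R[i]).
Context (k : 'I_n) (up : pred 'I_n).
Context (hq : forall j l, cint (q j l)).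
Context (hup : forall j, b j = b k -> ~~ up j).

(** Since [u] is close to [unit_vec], only the [k]-th summand of [src u] survives in
    the limit. *)
Lemma src_limit (s : bool) (j : 'I_n) (c e : R) :
  (forall m, cont_at01 (q j m) s%:R) -> 0 < c -> 0 < e ->
  exists rho, exists eta, [/\ 0 < rho, 0 < eta &
    forall y u, rho <= norm1 y -> c * norm1 y <= Re y -> vbmeas u ->
      vbounded eta (fun j x => u j x - unit_vec k j x) ->
      norm1 (cprim (fun t => expker s y t * src b q u j t) 1 - (- 'i%C * b j * q j k s%:R)) <= e].
Proof.
move=> cq c0 e0.
pose B := 1 + norm1 (b j); have B0 : 0 < B by rewrite ltr_pwDl// norm1_ge0.
pose e' := e / (B * n.+1%:R).
have e'0 : 0 < e' by rewrite divr_gt0// mulr_gt0.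
have A0 : 0 < 2 / c by rewrite divr_gt0.
have /choice [de hde] : forall m : 'I_n, exists de : R * R, [/\ 0 < de.1, 0 < de.2 &
    forall (ker u : R -> R[i]) (kap : R[i]),
    bmeas ker -> bmeas u -> norm1 kap <= 1 -> prim (fun t => norm1 (ker t)) 1 <= 2 / c ->
    norm1 (cprim ker 1 - 1) <= de.2 ->
    (forall t, 0 <= t <= 1 -> de.1 <= `|t - s%:R| -> norm1 (ker t) <= de.2) ->
    (forall t, 0 <= t <= 1 -> norm1 (u t - kap) <= de.2) ->
    norm1 (cprim (fun t => ker t * (q j m t * u t)) 1 - q j m s%:R * kap) <= e'].
  move=> m; have [d [eta [d0 eta0 H]]] := approx_identity (hq j m) (cq m) A0 e'0.
  by exists (d, eta).
have /choice [rh hrh] : forall m : 'I_n, exists rho : R, 0 < rho /\ forall s y,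
    rho <= norm1 y -> c * norm1 y <= Re y ->
    [/\ prim (fun t => norm1 (expker s y t)) 1 <= 2 / c,
        norm1 (cprim (expker s y) 1 - 1) <= (de m).2 &
        forall t, 0 <= t <= 1 -> (de m).1 <= `|t - s%:R| -> norm1 (expker s y t) <= (de m).2].
  move=> m; have [d0 eta0 _] := hde m.
  by have [rho r0 H] := expker_concentrate c0 d0 eta0; exists rho.
have rh0 m : 0 <= rh m by have [] := hrh m => /ltW.
pose ie := 1 + \sum_m (de m).2^-1.
have ie0 m : 0 <= (de m).2^-1 by have [_ h _] := hde m; rewrite invr_ge0 ltW.
have ieP : 0 < ie by rewrite ltr_pwDl// sumr_ge0.
exists (1 + \sum_m rh m), (ie^-1); split.
- by rewrite ltr_pwDl// sumr_ge0.
- by rewrite invr_gt0.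
move=> y u hy hc ru hu.
have iqu m : cint (fun t => q j m t * u m t) by exact: cintM.
have ikqu m : cint (fun t => expker s y t * (q j m t * u m t)).
  by apply: cintMl => //; exact: expker_bmeas.
have -> : cprim (fun t => expker s y t * src b q u j t) 1 =
   - 'i%C * b j * \sum_m cprim (fun t => expker s y t * (q j m t * u m t)) 1.
  rewrite -cprim_sum ?ler01 ?lexx// -cprimZ//; last exact: cint_sum.
  by apply: cprim_eq => t _; rewrite /src mulrCA mulr_sumr.
have -> : q j k s%:R = \sum_m q j m s%:R * unit_vec k m 0.
  rewrite (bigD1 k)//= /unit_vec eqxx mulr1 big1 ?addr0// => i /negbTE ->.
  by rewrite mulr0.
rewrite -mulrBr -sumrB (le_trans (norm1M _ _))//.
apply: (@le_trans _ _ (B * \sum_(m < n) e')); last first.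
  rewrite sumr_const card_ord -[X in B * X]mulr_natr /e'.
  rewrite (_ : B * (e / (B * n.+1%:R) * n%:R) = e * (n%:R / n.+1%:R)).
    rewrite ler_piMr ?(ltW e0)//.
    by rewrite ler_pdivrMr// mul1r ler_nat.
  by field; rewrite (gt_eqF B0) andbT.
rewrite ler_pM ?norm1_ge0//.
  rewrite (le_trans (norm1M _ _))// norm1N norm1_i mul1r /B lerDr//.
rewrite (le_trans (norm1_sum _ _ _))// ler_sum// => m _.
have [d0 eta0 H] := hde m; have [r0 H'] := hrh m.
have [|h1 h2 h3] := H' s y _ hc.
  rewrite (le_trans _ hy)// (le_trans (ler_sum_single (F := rh) m rh0))//.
  by rewrite lerDr.
apply: H => //; first exact: expker_bmeas.
- by rewrite /unit_vec; case: eqP => _; rewrite ?norm1_1 ?norm1_0.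
- move=> t ht; apply: (le_trans (hu m t ht)).
  rewrite -[leRHS]invrK lef_pV2 ?posrE ?invr_gt0//.
  rewrite (le_trans (ler_sum_single (F := fun m => (de m).2^-1) m ie0))//.
  by rewrite lerDr.
Qed.

(** By [column_at0_up] and [column_at1_down], [rate * u_j] at the free endpoint is, up
    to sign, the integral of [src u] against [expker] with [y = rate] or [y = - rate]. *)
Lemma column_end (s : bool) (j : 'I_n) (c e : R) :
  (forall j l x, b j = b l -> q j l x = 0) ->
  (forall m, cont_at01 (q j m) s%:R) -> b j != b k -> up j = ~~ s -> 0 < c -> 0 < e ->
  exists2 rho : R, 0 < rho & forall z u, contractive b q k up z -> rho <= norm1 z ->
    c * norm1 z <= (if s then - Re (rate b k j z) else Re (rate b k j z)) ->
    column b q k up z u ->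
    norm1 (rate b k j z * u j s%:R - 'i%C * b j * q j k s%:R) <= e.
Proof.
move=> q0 cq bjk ujs c0 e0.
have A0 := rate_const_gt0 b k.
have c'0 : 0 < c / rate_const b k by rewrite divr_gt0.
have [r1 [eta [r10 eta0 H]]] := src_limit cq c'0 e0.
have [r2 r20 H2] := column_asym k up hq q0 eta0.
exists (r1 / c + r2); first by rewrite addr_gt0// divr_gt0.
move=> z u gz hz hc cu.
have rc0 : 0 < r1 / c by rewrite divr_gt0.
pose y := if s then - rate b k j z else rate b k j z.
have Ry : Re y = if s then - Re (rate b k j z) else Re (rate b k j z).
  by rewrite /y; case: (s); rewrite ?ReN.
have Ny : norm1 y = norm1 (rate b k j z) by rewrite /y; case: (s); rewrite ?norm1N.
rewrite -Ry in hc.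
have h1 : r1 <= norm1 y.
  rewrite (le_trans _ (le_trans (ler_norm _) (ler_Re y)))// (le_trans _ hc)//.
  by rewrite mulrC -ler_pdivrMr//; lra.
have h2 : c / rate_const b k * norm1 y <= Re y.
  rewrite (le_trans _ hc)// -mulrA ler_wpM2l ?(ltW c0)// ler_pdivrMl//.
  by rewrite Ny norm1_rate.
have [ru _] := cu.
have := H y u h1 h2 ru (H2 z u gz _ cu); rewrite (le_trans _ hz) ?lerDr ?(ltW rc0)//.
move=> /(_ isT) /(le_trans _); apply.
have isrc := src_cint b hq j ru.
rewrite /y; case: s {H cq hc Ry Ny h1 h2 y} ujs => /= uj.
  rewrite (column_at1_down hq cu) ?uj//.
  have -> : unit_vec k j 0 = 0 :> R[i].
    by rewrite /unit_vec; have [jk|//] := eqVneq j k; move: bjk; rewrite jk eqxx.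
  rewrite add0r.
  have -> : cprim (fun t => expker true (- rate b k j z) t * src b q u j t) 1 =
      - rate b k j z * cprim (fun t => cexp (rate b k j z * (1 - t)%:C) * src b q u j t) 1.
    rewrite -cprimZ//; last by apply: cintMl => //; exact: bmeas_exp_shift.
    by apply: cprim_eq => t _; rewrite /expker opprK mulrA.
  rewrite -norm1N le_eqVlt; apply/orP; left; apply/eqP; congr norm1.
  by rewrite !mulNr; ring.
rewrite (column_at0_up hup cu)//.
have -> : cprim (fun t => expker false (rate b k j z) t * src b q u j t) 1 =
    rate b k j z * cprim (fun t => cexp (- rate b k j z * t%:C) * src b q u j t) 1.
  rewrite -cprimZ//; last exact: cint_expM.
  by apply: cprim_eq => t _; rewrite /expker mulrA.
rewrite -norm1N le_eqVlt; apply/orP; left; apply/eqP; congr norm1.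
by rewrite !mulNr; ring.
Qed.

End Endpoints.

(** * Absolute continuity and derivatives of primitives *)

Section Solutions.
Context {R : realType}.
Local Notation mu := (@lebesgue_measure R).

(** The half-open intervals are pairwise disjoint, even when some of them are empty. *)
Lemma sum_prim_nonoverlap (g : R -> R) m (J : 'I_m -> R * R) :
  int01 g -> (forall t, 0 <= t <= 1 -> 0 <= g t) ->
  (forall i, [/\ 0 <= (J i).1, (J i).1 <= (J i).2 & (J i).2 <= 1]) ->
  (forall i j, i != j -> (J i).2 <= (J j).1 \/ (J j).2 <= (J i).1) ->
  \sum_(i < m) (prim g (J i).2 - prim g (J i).1) <= prim g 1.
Proof.
move=> ig g0 J01 Jd.
pose A i : set R := `](J i).1, (J i).2]%classic.
have A01 i : A i `<=` `[0%R, 1%R].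
  have [h0 _ h1] := J01 i; move=> t; rewrite /A /= !in_itv/= => /andP[a b].
  by apply/andP; split; lra.
have mA i : measurable (A i) by exact: measurable_itv.
pose D := \big[setU/set0]_(i <- index_enum 'I_m) A i.
have mD : measurable D by apply: bigsetU_measurable.
have D01 : D `<=` `[0%R, 1%R].
  by rewrite /D; elim/big_ind : _ => // X Y hX hY t [/hX|/hY].
have := @ge0_integral_bigsetU _ _ _ mu _ A (EFin \o g) (index_enum 'I_m) mA
  (index_enum_uniq _) _ _ _.
have tr : trivIset [set` index_enum 'I_m] A.
  apply/trivIsetP => i j _ _ ij; apply/disjoints_subset => t /=.
  rewrite /setC /A /= !in_itv/= => /andP[a b]; apply/negP; rewrite negb_and.
  by have [h|h] := Jd i j ij; rewrite -!leNgt -ltNge; apply/orP; [left|right]; lra.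
have mg : measurable_fun D (EFin \o g).
  by apply: measurable_funS (measurable_int mu ig).
have g0D x : D x -> (0 <= (EFin \o g) x)%E.
  by move=> /D01; rewrite /= in_itv/= => h; rewrite lee_fin g0.
move=> /(_ tr mg g0D) E.
have E2 : (\sum_(i < m) (prim g (J i).2 - prim g (J i).1))%:E =
    (\int[mu]_(x in D) (EFin \o g) x)%E.
  rewrite E -sumEFin; apply: eq_bigr => i _.
  have [h0 h h1] := J01 i.
  rewrite prim_diff// /Rintegral fineK//.
  by apply: integrable_fin_num => //; exact: int01So.
rewrite -lee_fin E2 /prim /Rintegral fineK; last by apply: integrable_fin_num.
apply: ge0_subset_integral => //; first exact: measurable_int ig.
Qed.

(** Replace [g] by a continuous function close to it in L1: the error is bounded by
    [sum_prim_nonoverlap], and the bounded part by the total length. *)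
Lemma sum_prim_small (g : R -> R) (e : R) : int01 g ->
  (forall t, 0 <= t <= 1 -> 0 <= g t) -> 0 < e ->
  exists2 d : R, 0 < d & forall m (J : 'I_m -> R * R),
  (forall i, [/\ 0 <= (J i).1, (J i).1 <= (J i).2 & (J i).2 <= 1]) ->
  (forall i j, i != j -> (J i).2 <= (J j).1 \/ (J j).2 <= (J i).1) ->
  \sum_(i < m) ((J i).2 - (J i).1) < d ->
  \sum_(i < m) (prim g (J i).2 - prim g (J i).1) < e.
Proof.
move=> ig g0 e0; have e3 : 0 < e / 3 by rewrite divr_gt0.
have [p [cp ip hp]] := approx_cont01 ig e3.
have [B B0 hB] := continuous_bound01 cp.
have B1 : 0 < B + 1 by rewrite ltr_wpDl.
exists (e / 3 / (B + 1)); first by rewrite divr_gt0.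
move=> m J J01 Jd hd.
have ia : int01 (fun t => `|g t - p t|) by apply: int01_norm; exact: int01B.
have step i : prim g (J i).2 - prim g (J i).1 <=
   (prim (fun t => `|g t - p t|) (J i).2 - prim (fun t => `|g t - p t|) (J i).1) +
   (B + 1) * ((J i).2 - (J i).1).
  have [h0 h h1] := J01 i.
  have ib : int01 (fun t => `|g t - p t| + (B + 1)).
    by apply: int01D => //; exact: int01_cst.
  have := prim_le ig ib h0 h h1; rewrite !primD ?(le_trans h)//; try exact: int01_cst.
  rewrite !prim_cst ?(le_trans h0)// => H.
  apply: le_trans (H _) _; last lra.
  move=> t /andP[t0 t1].
  have ht : 0 <= t <= 1 by rewrite (le_trans h0 t0) (le_trans t1 h1).
  have := hB t ht; have := ler_norm (g t - p t); have := ler_norm (p t); lra.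
apply: (le_lt_trans (ler_sum _ (fun i _ => step i))).
rewrite big_split/= -mulr_sumr.
have H1 := sum_prim_nonoverlap ia (fun t _ => normr_ge0 _) J01 Jd.
have H2 : (B + 1) * \sum_(i < m) ((J i).2 - (J i).1) < e / 3.
  by rewrite mulrC -ltr_pdivlMr.
have := lerD H1 (ltW H2); lra.
Qed.

Lemma prim_of_abs_continuous (F f : R -> R[i]) : prim_of F f -> abs_continuous 0 1 F.
Proof.
move=> pF e e0; have [fi _] := pF.
have [d d0 hd] := sum_prim_small (cint_norm1 fi) (fun t _ => norm1_ge0 _) e0.
exists d => // m J J01 Jd hJ.
apply: (@le_lt_trans _ _ (\sum_(i < m) (prim (fun t => norm1 (f t)) (J i).2 -
  prim (fun t => norm1 (f t)) (J i).1))%:C); last by rewrite ltcR; exact: hd.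
rewrite rmorph_sum; apply: ler_sum => i _.
have [h0 h h1] := J01 i.
rewrite (le_trans (normc_le_norm1 _))// lecR (prim_of_diff pF)//.
exact: cprim_bound_norm1.
Qed.

(** Lebesgue differentiation for the extension of [f] by zero. *)
Lemma prim_ae (f : R -> R) : int01 f ->
  {ae mu, forall x : R, 0 < x < 1 -> is_derive x (1 : R) (prim f) (f x)}.
Proof.
move=> fi; pose f' := f \_ `[0%R, 1%R].
have f'E t : 0 <= t <= 1 -> f' t = f t.
  by move=> ht; rewrite /f' patchE ifT// inE/= in_itv.
have f'T : mu.-integrable setT (EFin \o f').
  by rewrite /f' -restrict_EFin; apply/integrable_restrict => //; rewrite setTI.
have f'i (y : R) : mu.-integrable [set` Interval (BLeft 0%R) (BRight y)] (EFin \o f').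
  exact: integrableS f'T.
have lf' : locally_integrable [set: R] f' by exact: integrable_locally.
have := FTC1 f'i lf'.
apply: filterS; first exact: (ae_filter_ringOfSetsType mu).
move=> x /= hx /andP[x0 x1].
have [|dF FE] := hx; first by rewrite lte_fin.
have x01 : 0 <= x <= 1 by rewrite !ltW.
have D1 := derivableP dF.
apply: (@near_eq_is_derive _ _ _ _ _ _ _ _ _ _); last first.
  by rewrite -(f'E x x01) -FE derive1E; exact: D1.
have : \forall a \near x, a < 1 by exact: lt_nbhsl.
apply: filterS => a a1; apply: eq_Rintegral => t; rewrite inE/= in_itv/= => /andP[t0 ta].
by rewrite f'E// t0 (le_trans ta)// ltW.
Qed.

Lemma prim_of_ae (F f : R -> R[i]) : prim_of F f ->
  {ae mu, forall x : R, 0 < x < 1 -> is_cderive F x (f x)}.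
Proof.
move=> [[f1 f2] FE].
have := prim_ae f1; apply: filterS2 (prim_ae f2); first exact: (ae_filter_ringOfSetsType mu).
move=> x /= h2 h1 x01.
have D1 := h1 x01; have D2 := h2 x01.
have nx : \forall a \near x, F a = F 0 + cprim f a.
  have n1 : \forall a \near x, a < 1 by apply: lt_nbhsl; case/andP: x01.
  have n0 : \forall a \near x, 0 < a by apply: lt_nbhsr; case/andP: x01.
  by apply: filterS2 n0 n1 => a a0 a1; rewrite FE// !ltW.
split.
  apply: (@near_eq_is_derive _ _ _ (cst (Re (F 0)) \+ prim (fun t => Re (f t)))).
    by apply: filterS nx => a ->; rewrite ReD.
  by rewrite -[Re (f x)]add0r; exact: is_deriveD.
apply: (@near_eq_is_derive _ _ _ (cst (Im (F 0)) \+ prim (fun t => Im (f t)))).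
  by apply: filterS nx => a ->; rewrite ImD.
by rewrite -[Im (f x)]add0r; exact: is_deriveD.
Qed.

End Solutions.

(** * Entries of block matrices *)

Section BlockDiagonal.
Context {R : realType} (r : nat) (n_ : 'I_r -> nat) (beta : 'I_r -> R[i]).
Local Notation N := (\sum_i n_ i)%N.
Local Notation sig1 := (@tagnat.sig1 r n_).

Lemma Bmx_diag : Bmx n_ beta = diag_mx (\row_s beta (sig1 s)).
Proof.
apply/matrixP => s t; rewrite !mxE.
rewrite -(can_eq (@tagnat.sigK r n_)) /tagnat.sig1 /tagnat.sig2.
move: (tagnat.sig s) (tagnat.sig t) => [/= i j] [/= i' j'].
rewrite -tag_eqE/= /tag_eq/=.
case: eqVneq => /= [ii'|_]; last by rewrite mxE.
by rewrite -ii' in j' *; rewrite tagged_asE conform_mx_id mxE.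
Qed.

Lemma Bmx_val s : Bmx n_ beta s s = beta (sig1 s).
Proof. by rewrite Bmx_diag !mxE eqxx mulr1n. Qed.

Lemma Bmx_mul (v : 'cV[R[i]]_N) s : (Bmx n_ beta *m v) s 0 = Bmx n_ beta s s * v s 0.
Proof. by rewrite Bmx_val Bmx_diag mul_diag_mx !mxE. Qed.

Lemma Bmx_unit : (forall i, beta i != 0) -> Bmx n_ beta \in unitmx.
Proof.
move=> b0; rewrite Bmx_diag unitmxE det_diag unitfE.
by apply/prodf_neq0 => s _; rewrite !mxE.
Qed.

Lemma submxblock_entry (A : 'M[R[i]]_N) s t : submxblock A (sig1 s) (sig1 s) = 0 ->
  sig1 s = sig1 t -> A s t = 0.
Proof.
move=> A0 st; have : submxblock A (sig1 s) (sig1 t) = 0 by rewrite -st.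
move=> /matrixP /(_ (tagnat.sig2 s) (tagnat.sig2 t)).
by rewrite !mxE !tagnat.sig2K.
Qed.

End BlockDiagonal.

(** * Signs of real parts in a sector *)

Section SectorSigns.
Context {R : realType}.
Implicit Types (d z : R[i]) (theta : R).

(** [Re (i d z)] at the point [z] of the unit circle with argument [theta]. *)
Definition dirval d theta : R := - (Re d * sin theta + Im d * cos theta).

Lemma Re_polar d (rho theta : R) :
  Re ('i%C * d * ((rho * cos theta) +i* (rho * sin theta))) = rho * dirval d theta.
Proof. by rewrite /dirval !ReM !ImM /=; ring. Qed.

Lemma dirval_continuous d : continuous (dirval d).
Proof.
move=> x; apply: cvgN; apply: cvgD; apply: cvgM; try exact: cvg_cst.
  exact: continuous_sin.
exact: continuous_cos.
Qed.

(** The intermediate value theorem on the segment between the two arguments. *)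
Lemma dirval_sign d (p1 p2 : R) : (forall theta, p1 < theta < p2 -> dirval d theta != 0) ->
  forall t1 t2, p1 < t1 < p2 -> p1 < t2 < p2 -> 0 < dirval d t1 -> 0 < dirval d t2.
Proof.
move=> nz t1 t2 h1 h2 g1; rewrite lt_neqAle eq_sym nz//= leNgt; apply/negP => g2.
have cd := continuous_subspaceT (@dirval_continuous d).
have [t12|/ltW t21] := leP t1 t2.
  have [|c] := @IVT R (dirval d) t1 t2 0 t12 (cd _).
    by rewrite ge_min le_max (ltW g1) (ltW g2) orbT.
  rewrite in_itv/= => /andP[c1 c2] c0.
  have : dirval d c != 0.
    case/andP: h1 => ? ?; case/andP: h2 => ? ?; apply: nz; apply/andP; split; lra.
  by rewrite c0 eqxx.
have [|c] := @IVT R (dirval d) t2 t1 0 t21 (cd _).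
  by rewrite ge_min le_max (ltW g1) (ltW g2) orbT.
rewrite in_itv/= => /andP[c1 c2] c0.
have : dirval d c != 0.
  case/andP: h1 => ? ?; case/andP: h2 => ? ?; apply: nz; apply/andP; split; lra.
by rewrite c0 eqxx.
Qed.

(** A continuous function without zeros attains a positive minimum modulus on the
    compact segment [p1 + eps, p2 - eps]. *)
Lemma dirval_bound d (p1 p2 eps : R) :
  (forall theta, p1 < theta < p2 -> dirval d theta != 0) -> 0 < eps ->
  exists2 c : R, 0 < c & forall theta, p1 + eps < theta < p2 - eps -> c <= `|dirval d theta|.
Proof.
move=> nz e0; have [le|lt] := leP (p1 + eps) (p2 - eps); last first.
  by exists 1 => // theta /andP[? ?]; exfalso; lra.
have cn : continuous (fun x => `|dirval d x|).
  by move=> x; apply: cvg_norm; exact: dirval_continuous.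
have [c] := EVT_min le (continuous_subspaceT cn).
rewrite in_itv/= => /andP[c1 c2] hc.
exists `|dirval d c|.
  by rewrite normr_gt0 nz//; apply/andP; split; lra.
by move=> theta /andP[h1 h2]; apply: hc; rewrite in_itv/= !ltW.
Qed.

Lemma sector_shrink (p1 p2 eps : R) z : 0 < eps ->
  sector (p1 + eps) (p2 - eps) z -> sector p1 p2 z.
Proof.
move=> e0 [rho [theta [r0 /andP[h1 h2] ->]]]; exists rho, theta; split => //.
by apply/andP; split; lra.
Qed.

Section OneDirection.
Context (d : R[i]) (p1 p2 : R).
Context (nz : forall z, sector p1 p2 z -> Re ('i%C * d * z) != 0).

Lemma dirval_neq0 theta : p1 < theta < p2 -> dirval d theta != 0.
Proof.
move=> h; have /nz : sector p1 p2 ((1 * cos theta) +i* (1 * sin theta)).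
  by exists 1, theta.
by rewrite Re_polar mul1r.
Qed.

Lemma sector_sign z w : sector p1 p2 z -> sector p1 p2 w ->
  0 < Re ('i%C * d * z) -> 0 < Re ('i%C * d * w).
Proof.
move=> [r1 [t1 [r10 h1 ->]]] [r2 [t2 [r20 h2 ->]]]; rewrite !Re_polar.
rewrite pmulr_rgt0// => g1; rewrite pmulr_rgt0//.
exact: (dirval_sign dirval_neq0 h1 h2).
Qed.

Lemma sector_bound eps : 0 < eps -> exists2 c : R, 0 < c &
  forall z, sector (p1 + eps) (p2 - eps) z -> c * norm1 z <= `|Re ('i%C * d * z)|.
Proof.
move=> e0; have [c c0 hc] := dirval_bound dirval_neq0 e0.
exists (c / 2); first by rewrite divr_gt0.
move=> z [rho [theta [r0 h ->]]]; rewrite Re_polar normrM (gtr0_norm r0).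
have n2 : norm1 ((rho * cos theta) +i* (rho * sin theta)) <= 2 * rho.
  rewrite /norm1 /= !normrM (gtr0_norm r0) -mulrDr mulrC ler_wpM2r ?(ltW r0)//.
  by rewrite (_ : 2 = 1 + 1)// lerD// ler_norml ?cos_geN1 ?cos_le1 ?sin_geN1 ?sin_le1.
apply: (@le_trans _ _ (c / 2 * (2 * rho))); first by rewrite ler_wpM2l// divr_ge0// ltW.
have -> : c / 2 * (2 * rho) = rho * c by field.
by rewrite ler_wpM2l ?hc// ltW.
Qed.

End OneDirection.

Lemma is_sector_neq (r : nat) (beta : 'I_r -> R[i]) (p1 p2 : R) (i j : 'I_r) z :
  is_sector beta p1 p2 -> i != j -> sector p1 p2 z ->
  Re ('i%C * (beta i - beta j) * z) != 0.
Proof.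
move=> [z0 _ E] ij hz.
have : ~ sector_lines beta z.
  have : connected_component (~` sector_lines beta : set R[i]^o) z0 z by rewrite -E.
  by move=> /connected_component_sub.
move=> nl; apply/eqP => h0; apply: nl; left.
have hij : Re ('i%C * beta i * z) = Re ('i%C * beta j * z).
  by apply/eqP; rewrite -subr_eq0 -ReB; apply/eqP; rewrite -[RHS]h0; congr Re; ring.
have [lt|gt|e] := ltngtP i j; [by exists i, j|by exists j, i|].
by move: ij; rewrite (val_inj e) eqxx.
Qed.

End SectorSigns.

(** * Little-o along a sector and one-sided limits *)

Section SmallO.
Context {R : realType}.
Implicit Types (S : set R[i]).

Lemma o1P S (rho : R[i] -> R[i]) :
  (forall e : R, 0 < e -> exists M : R, forall z, S z -> M < norm1 z -> norm1 (rho z) <= e) ->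
  o1 S rho.
Proof.
move=> h A /nbhs_ballP[e /= e0 hA].
have e1 : 0 < Re e by move: e0; rewrite ltcE => /andP[].
have eE : e = (Re e)%:C.
  by move: e0; rewrite ltcE => /andP[/eqP hh _]; apply: complexP.
have [M hM] := h (Re e / 2) (divr_gt0 e1 (ltr0Sn R 1)).
exists M => // z [Sz Mz]; apply: hA; rewrite /ball /= sub0r normrN eE.
apply: norm1_lt_lt_normc; rewrite (le_lt_trans (hM z Sz (normc_lt_norm1 Mz)))//.
by rewrite ltr_pdivrMr// ltr_pMr// ltr1n.
Qed.

Lemma o1_unif01P S (rho : R -> R[i] -> R[i]) :
  (forall e : R, 0 < e -> exists M : R, forall z x, S z -> M < norm1 z -> 0 <= x <= 1 ->
     norm1 (rho x z) <= e) ->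
  o1_unif01 S rho.
Proof.
move=> h e e0; have [M hM] := h (e / 2) (divr_gt0 e0 (ltr0Sn R 1)).
exists M => // z [Sz Mz] x hx.
apply: norm1_lt_lt_normc; rewrite (le_lt_trans (hM z x Sz (normc_lt_norm1 Mz) hx))//.
by rewrite ltr_pdivrMr// ltr_pMr// ltr1n.
Qed.

Lemma cont_at01_0 (q : R -> R[i]) :
  (q x : R[i]^o) @[x --> (0 : R)^'+] --> (q 0 : R[i]^o) -> cont_at01 q 0.
Proof.
move=> /cvgrPdist_lt h e e0.
have e2 : (0 : R[i]) < (e / 2)%:C by rewrite ltcR divr_gt0.
have [d /= d0 hd] := h _ e2.
exists (d / 2); first by rewrite divr_gt0.
move=> t /andP[t0 t1]; rewrite subr0 ger0_norm// => td.
move: t0; rewrite le_eqVlt => /predU1P[<-|t0].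
  by rewrite subrr norm1_0 ltW.
have dt : t < d by rewrite (le_lt_trans td)// ltr_pdivrMr// ltr_pMr// ltr1n.
have := hd t; rewrite /= sub0r normrN gtr0_norm// => /(_ dt t0) /norm1_lt_normc.
by rewrite mulrC divfK// norm1B => /ltW.
Qed.

Lemma cont_at01_1 (q : R -> R[i]) :
  (q x : R[i]^o) @[x --> (1 : R)^'-] --> (q 1 : R[i]^o) -> cont_at01 q 1.
Proof.
move=> /cvgrPdist_lt h e e0.
have e2 : (0 : R[i]) < (e / 2)%:C by rewrite ltcR divr_gt0.
have [d /= d0 hd] := h _ e2.
exists (d / 2); first by rewrite divr_gt0.
move=> t /andP[t0 t1]; rewrite distrC ger0_norm ?subr_ge0// => td.
move: t1; rewrite le_eqVlt => /predU1P[->|t1].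
  by rewrite subrr norm1_0 ltW.
have dt : 1 - t < d by rewrite (le_lt_trans td)// ltr_pdivrMr// ltr_pMr// ltr1n.
have := hd t; rewrite /= gtr0_norm ?subr_gt0// => /(_ dt t1) /norm1_lt_normc.
by rewrite mulrC divfK// norm1B => /ltW.
Qed.

End SmallO.

(** * From the integral equation to the system *)

Section Assembly.
Context {R : realType}.
Local Notation mu := (@lebesgue_measure R).

(** The open form of [admissible_at]: rates with [b_j = b_k] vanish identically and are
    exempted, the others lie strictly on their side of the imaginary axis. *)
Definition strictly_admissible n (b : 'I_n -> R[i]) k (up : pred 'I_n) z :=
  forall j, b j != b k ->
    if up j then 0 < Re (rate b k j z) else Re (rate b k j z) < 0.

Lemma norm1_Mi (w : R[i]) : norm1 ('i%C * w) = norm1 w.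
Proof. by rewrite /norm1 ReM ImM /= !mul0r !mul1r sub0r add0r normrN addrC. Qed.

Lemma strictly_admissible_at n (b : 'I_n -> R[i]) k up z :
  strictly_admissible b k up z -> admissible_at b k up z.
Proof.
move=> h j; rewrite /admissible; have [bjk|bjk] := eqVneq (b j) (b k).
  by rewrite /rate bjk subrr mulr0 mul0r; case: (up j).
by have := h j bjk; case: (up j) => /ltW.
Qed.

Lemma strictly_admissible_open n (b : 'I_n -> R[i]) k up z : strictly_admissible b k up z ->
  exists2 del : R, 0 < del & forall z', norm1 (z' - z) <= del -> strictly_admissible b k up z'.
Proof.
move=> h; have A0 := rate_const_gt0 b k.
pose F j : R := `|Re (rate b k j z)|^-1.
have F0 j : 0 <= F j by rewrite invr_ge0.
pose m := 1 + \sum_j F j; have m0 : 0 < m by rewrite ltr_pwDl// sumr_ge0.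
exists ((2 * m * rate_const b k)^-1); first by rewrite invr_gt0 !mulr_gt0.
move=> z' hz j bjk; have := h j bjk.
set a := Re (rate b k j z) => ha.
have an0 : 0 < `|a| by rewrite normr_gt0; case: (up j) ha => ha; [rewrite gt_eqF|rewrite lt_eqF].
have am : m^-1 <= `|a|.
  rewrite -[leRHS]invrK lef_pV2 ?posrE ?invr_gt0//.
  by rewrite (le_trans (ler_sum_single (F := F) j F0))// lerDr.
have d1 : `|Re (rate b k j z') - a| <= (2 * m)^-1.
  rewrite -ReB rateB (le_trans (ler_Re _))// (le_trans (norm1_rate b k j _))//.
  have -> : (2 * m)^-1 = rate_const b k * (2 * m * rate_const b k)^-1.
    by field; rewrite !gt_eqF.
  by rewrite ler_wpM2l// ltW.
have d2 : (2 * m)^-1 < m^-1.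
  by rewrite ltf_pV2 ?posrE ?mulr_gt0// ltr_pMl// ltr1n.
have d3 : `|Re (rate b k j z') - a| < `|a|.
  apply: (le_lt_trans d1); apply: (lt_le_trans d2); exact: am.
move: d3; rewrite ltr_norml => /andP[h1 h2].
case: (up j) ha => ha.
  by move: h1; rewrite (gtr0_norm ha) => ?; lra.
by move: h2; rewrite (ltr0_norm ha) => ?; lra.
Qed.

(** Summing over [j] the bounds for [c j] obtained from the [j]-th equation gives
    [sum |c j| <= (1/2) sum |c j|]. *)
Lemma near_identity_free n (A : 'I_n -> 'I_n -> R[i]) (c : 'I_n -> R[i]) :
  (forall j k, norm1 (A j k - (j == k)%:R) <= (2 * n.+1%:R)^-1) ->
  (forall j, \sum_k c k * A j k = 0) -> forall j, c j = 0.
Proof.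
move=> hA hc; pose M := \sum_j norm1 (c j).
have M0 : 0 <= M by apply: sumr_ge0 => j _; exact: norm1_ge0.
have cj j : norm1 (c j) <= M * (2 * n.+1%:R)^-1.
  have -> : c j = - \sum_k c k * (A j k - (j == k)%:R).
    under eq_bigr do rewrite mulrBr.
    rewrite sumrB hc sub0r opprK (bigD1 j)//= eqxx mulr1 big1 ?addr0// => i ij.
    by rewrite eq_sym (negbTE ij) mulr0.
  rewrite norm1N (le_trans (norm1_sum _ _ _))// mulr_suml ler_sum// => i _.
  by rewrite (le_trans (norm1M _ _))// ler_wpM2l ?norm1_ge0.
have MM : M <= M / 2.
  apply: (@le_trans _ _ (\sum_(j < n) M * (2 * n.+1%:R)^-1)).
    by apply: ler_sum => j _; exact: cj.
  rewrite sumr_const card_ord -[leLHS]mulr_natr -mulrA ler_wpM2l//.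
  rewrite invfM -mulrA ler_piMr//.
  by rewrite mulrC ler_pdivrMr// mul1r ler_nat.
have M00 : M <= 0 by lra.
move=> j; apply: norm1_eq0; apply: le_trans M00.
by apply: (ler_sum_single (F := fun j => norm1 (c j))) => i; exact: norm1_ge0.
Qed.

(** Multiplying [u] by [e^(i b_k z x)] shifts every rate [i (b_j - b_k) z] to
    [i b_j z], the rate of the original system. *)
Lemma column_is_solution n (B : 'M[R[i]]_n) (Q : R -> 'M[R[i]]_n)
    (b : 'I_n -> R[i]) q k up z u : (forall j m, cint (q j m)) ->
  B \in unitmx -> (forall (v : 'cV_n) j, (B *m v) j 0 = b j * v j 0) ->
  {ae mu, forall x : R, 0 < x < 1 -> forall j m, Q x j m = q j m x} ->
  column b q k up z u ->
  is_solution B Q z (fun x => \col_j (u j x * cexp ('i%C * b k * z * x%:C))).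
Proof.
move=> hq Bu Bv hQ cu; set c := 'i%C * b k * z.
have [ru _] := cu.
pose y j x := u j x * cexp (c * x%:C).
pose D j x := c * cexp (c * x%:C) * u j x +
  cexp (c * x%:C) * (rate b k j z * u j x + src b q u j x).
have pY j : prim_of (y j) (D j).
  apply: prim_of_eq (prim_of_mulexp c (column_prim hq j cu)) => // x _.
  by rewrite /y mulrC.
have yE j : (fun x => (\col_j (u j x * cexp (c * x%:C))) j 0) = y j.
  by apply/funext => x; rewrite mxE.
split.
  by move=> j; rewrite yE; exact: prim_of_abs_continuous (pY j).
have aeD : {ae mu, forall x : R, forall j, 0 < x < 1 -> is_cderive (y j) x (D j x)}.
  have F := ae_filter_ringOfSetsType mu.
  by apply: filter_forall => j; exact: prim_of_ae (pY j).
apply: filterS2 hQ aeD; first exact: (ae_filter_ringOfSetsType mu).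
move=> x hQ hD x01; set yx := \col_j _.
have yxE j : yx j 0 = y j x by rewrite mxE.
exists ('i%C *: (B *m (z *: yx - Q x *m yx))).
  move=> j; rewrite yE mxE Bv !mxE.
  have -> : 'i%C * (b j * (z * (u j x * cexp (c * x%:C)) - \sum_m Q x j m * yx m 0)) = D j x.
    have -> : \sum_m Q x j m * yx m 0 = cexp (c * x%:C) * \sum_m q j m x * u m x.
      by rewrite mulr_sumr; apply: eq_bigr => m _; rewrite yxE hQ// /y; ring.
    by rewrite /D /src /rate /c; ring.
  exact: hD.
rewrite -scalemxAr mulKmx// scalerA.
have -> : - 'i%C * 'i%C = 1 :> R[i] by apply: complexP; rewrite ?ReM ?ImM /=; ring.
by rewrite scale1r subrK.
Qed.

End Assembly.

Theorem proposition3p2 (R : realType) (r : nat) (n_ : 'I_r -> nat)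
    (beta : 'I_r -> R[i]) (Q : R -> 'M[R[i]]_(\sum_i n_ i))
    (phi1 phi2 : R) :
  let n := (\sum_i n_ i)%N in
  let B : 'M[R[i]]_n := Bmx n_ beta in
  let b (j : 'I_n) : R[i] := B j j in
  let delta (j k : 'I_n) : R[i] := (j == k)%:R in
  (0 < r)%N ->
  (forall i, 0 < n_ i)%N ->
  injective beta ->
  (forall i, beta i != 0) ->
  (forall j k : 'I_n, cintegrable01 (fun x => Q x j k)) ->
  (forall i : 'I_r, {ae @lebesgue_measure R, forall x : R, 0 <= x <= 1 ->
     submxblock (Q x) i i = 0}) ->
  (forall j k : 'I_n,
     (Q x j k : R[i]^o) @[x --> (0 : R)^'+] --> (Q 0 j k : R[i]^o)) ->
  (forall j k : 'I_n,
     (Q x j k : R[i]^o) @[x --> (1 : R)^'-] --> (Q 1 j k : R[i]^o)) ->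
  is_sector beta phi1 phi2 ->
  exists rad0 eps0 : R, 0 < eps0 /\
  forall rad eps : R, rad0 < rad -> 0 < eps < eps0 ->
  let S := trunc_sector phi1 phi2 eps rad in
  exists Y : R -> R[i] -> 'M[R[i]]_n,
  [/\ forall lambda, S lambda ->
        is_fundamental_matrix B Q lambda (fun x => Y x lambda),
      forall (x : R) (j k : 'I_n), 0 <= x <= 1 ->
        analytic_on S (fun lambda => Y x lambda j k),
      forall j k : 'I_n, exists2 rho : R -> R[i] -> R[i],
        o1_unif01 S rho &
        forall (x : R) lambda, 0 <= x <= 1 -> S lambda ->
          Y x lambda j k =
            (delta j k + rho x lambda) * cexp ('i%C * b k * lambda * x%:C),
      forall j k : 'I_n, exists2 rho : R[i] -> R[i],
        o1 S rho &
        forall lambda, S lambda ->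
          [/\ complex.Re ('i%C * b j * lambda) < complex.Re ('i%C * b k * lambda) ->
                Y 0 lambda j k = 0,
              b j = b k -> Y 0 lambda j k = delta j k &
              complex.Re ('i%C * b j * lambda) > complex.Re ('i%C * b k * lambda) ->
                Y 0 lambda j k =
                  (b j * Q 0 j k + rho lambda) / (b j - b k) * (1 / lambda)]
    & forall j k : 'I_n, exists2 rho : R[i] -> R[i],
        o1 S rho &
        forall lambda, S lambda ->
          [/\ complex.Re ('i%C * b j * lambda) < complex.Re ('i%C * b k * lambda) ->
                Y 1 lambda j k =
                  (b j * Q 1 j k + rho lambda) / (b j - b k)
                  * (cexp ('i%C * b k * lambda) / lambda),
              b j = b k ->
                Y 1 lambda j k =
                  (delta j k + rho lambda) * cexp ('i%C * b k * lambda) &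
              complex.Re ('i%C * b j * lambda) > complex.Re ('i%C * b k * lambda) ->
                Y 1 lambda j k = 0]].
Proof.
move=> n B b delta _ _ binj b0 Qint Qdiag Q0 Q1 hsec.
have bE j : b j = beta (@tagnat.sig1 r n_ j) by exact: Bmx_val.
have beq j m : b j = b m -> @tagnat.sig1 r n_ j = @tagnat.sig1 r n_ m.
  by rewrite !bE => /binj.
(* [Q] is changed on a null set so that the diagonal blocks vanish identically. *)
pose q (j m : 'I_n) x : R[i] := if b j == b m then 0 else Q x j m.
have q0 j l x : b j = b l -> q j l x = 0 by rewrite /q => ->; rewrite eqxx.
have hq j m : cint (q j m).
  by rewrite /q; case: eqP => _; [exact: cint_cst|exact: Qint].
have q_cont0 j m : cont_at01 (q j m) 0.
  rewrite /q; case: eqP => _; last exact: cont_at01_0 (Q0 j m).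
  by move=> e e0; exists 1 => // t _ _; rewrite subrr norm1_0 ltW.
have q_cont1 j m : cont_at01 (q j m) 1.
  rewrite /q; case: eqP => _; last exact: cont_at01_1 (Q1 j m).
  by move=> e e0; exists 1 => // t _ _; rewrite subrr norm1_0 ltW.
(* Any point of the sector decides the sign, since it is constant there. *)
pose up (k j : 'I_n) : bool := `[< exists2 z, sector phi1 phi2 z & 0 < Re (rate b k j z) >].
have hup k j : b j = b k -> ~~ up k j.
  by move=> bjk; apply/asboolP => -[z _]; rewrite /rate bjk subrr mulr0 mul0r ltxx.
have nz k j z : b j != b k -> sector phi1 phi2 z -> Re (rate b k j z) != 0.
  move=> bjk hz; rewrite /rate !bE; apply: is_sector_neq hsec _ hz.
  by apply: contra bjk => /eqP e; rewrite !bE e.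
have sadm k z : sector phi1 phi2 z -> strictly_admissible b k (up k) z.
  move=> hz j bjk; case: ifPn => [/asboolP[w hw w0]|nup].
    by apply: (sector_sign (fun z => @nz k j z bjk) hw hz w0).
  rewrite lt_neqAle nz//= leNgt; apply: contra nup => h0.
  by apply/asboolP; exists z.
have /choice [r1 hr1] : forall k : 'I_n, exists rho : R, 0 < rho /\
    forall z, admissible_at b k (up k) z -> rho <= norm1 z -> contractive b q k (up k) z.
  by move=> k; have [rho r0 H] := contractive_large k (up k) hq q0; exists rho.
have e00 : 0 < (2 * n.+1%:R)^-1 :> R by rewrite invr_gt0 mulr_gt0.
have /choice [r2 hr2] : forall k : 'I_n, exists rho : R, 0 < rho /\
    forall z u, contractive b q k (up k) z -> rho <= norm1 z -> column b q k (up k) z u ->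
    vbounded (2 * n.+1%:R)^-1 (fun j x => u j x - unit_vec k j x).
  by move=> k; have [rho r0 H] := column_asym k (up k) hq q0 e00; exists rho.
have /choice [U hU] : forall k, exists U : R[i] -> 'I_n -> R -> R[i],
  forall z, contractive b q k (up k) z -> column b q k (up k) z (U z).
  by move=> k; exact: column_exists.
have r10 k : 0 <= r1 k by have [/ltW] := hr1 k.
have r20 k : 0 <= r2 k by have [/ltW] := hr2 k.
(* A sum dominates every one of the finitely many radii. *)
pose rad0 := \sum_k r1 k + \sum_k r2 k.
(* Any positive bound on [eps] works, 1 for instance. *)
exists rad0, 1; split; first exact: ltr01.
move=> rad eps hrad /andP[eps0 _] S.
have Ssec z : S z -> sector phi1 phi2 z by case=> hz _; exact: sector_shrink hz.
have Srad z : S z -> rad < norm1 z by case=> _; exact: normc_lt_norm1.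
have rad_r1 k : r1 k <= rad0.
  rewrite (le_trans (ler_sum_single (F := r1) k r10))// lerDl.
  by apply: sumr_ge0.
have rad_r2 k : r2 k <= rad0.
  rewrite (le_trans (ler_sum_single (F := r2) k r20))// lerDr.
  by apply: sumr_ge0.
have rad00 : 0 <= rad0 by rewrite addr_ge0// sumr_ge0.
have Sgood k z : S z -> contractive b q k (up k) z.
  move=> Sz; have [_] := hr1 k; apply; first exact/strictly_admissible_at/sadm/Ssec.
  by rewrite (le_trans (rad_r1 k))// ltW// (lt_trans hrad)// Srad.
have Scol k z : S z -> column b q k (up k) z (U k z) by move=> Sz; exact/hU/Sgood.
have Sn0 z : S z -> z != 0.
  move=> Sz; apply/eqP => z0; have := Srad z Sz; rewrite z0 norm1_0 => h.
  by have := lt_trans hrad h; rewrite ltNge rad00.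
have Re_rate j k z : Re (rate b k j z) = Re ('i%C * b j * z) - Re ('i%C * b k * z).
  by rewrite -ReB; congr Re; rewrite /rate; ring.
have dE j k x : delta j k = unit_vec k j x by [].
have end_small (s : bool) j k : b j != b k -> up k j = ~~ s -> forall e : R, 0 < e ->
    exists rho : R, forall z, S z -> rho < norm1 z ->
    norm1 ((b j - b k) * z * U k z j s%:R - b j * Q s%:R j k) <= e.
  move=> bjk ujs e e0.
  have [c c0 hc] := sector_bound (fun z => @nz k j z bjk) eps0.
  have qc m : cont_at01 (q j m) s%:R by case: (s).
  have [rho _ H] := column_end hq (hup k) q0 qc bjk ujs c0 e0.
  exists rho => z Sz hz.
  have cz : c * norm1 z <= (if s then - Re (rate b k j z) else Re (rate b k j z)).
    have [hz' _] := Sz; rewrite (le_trans (hc z hz'))//.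
    have := sadm k z (Ssec z Sz) j bjk; rewrite ujs -/(rate b k j z).
    by case: (s) => /= h; [rewrite ltr0_norm|rewrite gtr0_norm].
  have := H z (U k z) (Sgood k z Sz) (ltW hz) cz (Scol k z Sz).
  rewrite /q (negbTE bjk) -[X in _ -> X <= _]norm1_Mi; congr (norm1 _ <= _).
  by rewrite /rate; ring.
pose Y x z : 'M[R[i]]_n := \matrix_(j, k) (U k z j x * cexp ('i%C * b k * z * x%:C)).
exists Y; split.
- move=> z Sz; split.
    move=> k; have -> : (fun x => col k (Y x z)) =
        (fun x => \col_j (U k z j x * cexp ('i%C * b k * z * x%:C))).
      by apply/funext => x; apply/matrixP => i j; rewrite !mxE.
    apply: (column_is_solution hq _ _ _ (Scol k z Sz)).
    + exact: Bmx_unit.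
    + by move=> v j; exact: Bmx_mul.
    + have F := ae_filter_ringOfSetsType (@lebesgue_measure R).
      have : {ae @lebesgue_measure R, forall x : R, forall i : 'I_r, 0 <= x <= 1 ->
          submxblock (Q x) i i = 0} by exact: filter_forall.
      apply: filterS => x /= hx /andP[x0 x1] j m.
      rewrite /q; case: eqP => // bjm.
      by apply: submxblock_entry (beq _ _ bjm); apply: hx; rewrite !ltW.
  move=> c hc; apply/matrixP => j j'; rewrite !ord1 [RHS]mxE.
  apply: (@near_identity_free _ _ (fun j k => U k z j 0) (fun k => c k 0)).
    move=> i k; have [_ H] := hr2 k.
    apply: (H z (U k z)) => //; [exact: Sgood| |exact: Scol|].
      by rewrite (le_trans (rad_r2 k))// ltW// (lt_trans hrad)// Srad.
    by apply/andP; split; [exact: lexx|exact: ler01].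
  move=> i; have h01 : 0 <= (0 : R) <= 1.
    by apply/andP; split; [exact: lexx|exact: ler01].
  have /matrixP /(_ i 0) := hc 0 h01.
  rewrite summxE [RHS]mxE => h; rewrite -[RHS]h.
  rewrite [RHS](eq_bigr (fun k => c k 0 * U k z i 0))// => k _.
  by rewrite !mxE mulr0 cexp0 mulr1.
- move=> x j k hx z Sz; apply: quad_diff_derivable.
  have -> : (fun z => Y x z j k) = (fun z => U k z j x * cexp ('i%C * b k * x%:C * z)).
    by apply/funext => w; rewrite mxE; congr (_ * cexp _); ring.
  apply: quad_diffM; last exact: quad_diff_exp.
  have [del d0 hd] := strictly_admissible_open (sadm k z (Ssec z Sz)).
  have hr0 : 0 < norm1 z - rad0 by rewrite subr_gt0 (lt_trans hrad)// Srad.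
  apply: (@column_diff _ _ b q k (up k) hq (U k) z (Num.min del (norm1 z - rad0))) => //.
    by rewrite lt_min d0.
  move=> z'; rewrite le_min => /andP[h1 h2].
  have gz' : contractive b q k (up k) z'.
    have [_] := hr1 k; apply; first exact/strictly_admissible_at/hd.
    rewrite (le_trans (rad_r1 k))//.
    have := norm1D z' (z - z'); rewrite addrC subrK norm1B; lra.
  by split => //; exact: hU.
- move=> j k; exists (fun x z => U k z j x - delta j k).
    apply: o1_unif01P => e e0.
    have [rho rho0 H] := column_asym k (up k) hq q0 e0.
    exists rho => z x Sz hz hx.
    exact: (H z (U k z) (Sgood k z Sz) (ltW hz) (Scol k z Sz) j x hx).
  by move=> x z hx Sz; rewrite mxE subrKC.
- move=> j k.
  exists (fun z => if (b j != b k) && up k j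
    then (b j - b k) * z * U k z j 0 - b j * Q 0 j k else 0).
    apply: o1P => e e0.
    have [M hM] : exists M : R, b j != b k -> up k j -> forall z, S z -> M < norm1 z ->
        norm1 ((b j - b k) * z * U k z j 0 - b j * Q 0 j k) <= e.
      have [bjk|bjk] := boolP (b j != b k); last by exists 0.
      have [ujk|ujk] := boolP (up k j); last by exists 0.
      by have [rho H] := @end_small false j k bjk ujk e e0; exists rho.
    exists M => z Sz Mz; case: ifP => [/andP[bjk ujk]|_]; first exact: hM.
    by rewrite norm1_0 ltW.
  move=> z Sz; have Y0 : Y 0 z j k = U k z j 0 by rewrite mxE mulr0 cexp0 mulr1.
  rewrite Y0; split.
  + move=> lt; rewrite (column_at0 (Scol k z Sz)).
      by rewrite -dE /delta; case: eqP lt => // ->; rewrite ltxx.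
    apply/negP => ujk; have bjk : b j != b k.
      by apply: contraTneq ujk => /hup.
    have := sadm k z (Ssec z Sz) j bjk; rewrite ujk Re_rate subr_gt0.
    by move=> /(lt_trans lt); rewrite ltxx.
  + by move=> bjk; rewrite (column_at0 (Scol k z Sz)) ?hup.
  + move=> gt; have bjk : b j != b k.
      by apply: contraTneq gt => ->; rewrite ltxx.
    have ujk : up k j.
      apply/asboolP; exists z; first exact: Ssec.
      by rewrite Re_rate subr_gt0.
    rewrite bjk ujk /= subrKC; field.
    by rewrite Sn0//= subr_eq0.
- move=> j k.
  exists (fun z => if b j == b k then U k z j 1 - delta j k else if ~~ up k j
    then (b j - b k) * z * U k z j 1 - b j * Q 1 j k else 0).
    apply: o1P => e e0.
    have [rho rho0 H] := column_asym k (up k) hq q0 e0.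
    have [M hM] : exists M : R, b j != b k -> ~~ up k j -> forall z, S z -> M < norm1 z ->
        norm1 ((b j - b k) * z * U k z j 1 - b j * Q 1 j k) <= e.
      have [bjk|bjk] := boolP (b j != b k); last by exists 0.
      have [ujk|ujk] := boolP (~~ up k j); last by exists 0.
      have ujk' : up k j = ~~ true by exact/negbTE.
      by have [M hM] := @end_small true j k bjk ujk' e e0; exists M.
    exists (Num.max rho M) => z Sz; rewrite gt_max => /andP[hz Mz].
    case: ifPn => [_|bjk].
      apply: (H z (U k z) (Sgood k z Sz) (ltW hz) (Scol k z Sz) j 1).
      by rewrite ler01 lexx.
    case: ifPn => [ujk|_]; first exact: hM.
    by rewrite norm1_0 ltW.
  move=> z Sz; have Y1 : Y 1 z j k = U k z j 1 * cexp ('i%C * b k * z).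
    by rewrite mxE mulr1.
  rewrite Y1; split.
  + move=> lt; have bjk : b j != b k.
      by apply: contraTneq lt => ->; rewrite ltxx.
    have ujk : ~~ up k j.
      apply/negP => ujk; have := sadm k z (Ssec z Sz) j bjk; rewrite ujk Re_rate subr_gt0.
      by move=> /(lt_trans lt); rewrite ltxx.
    rewrite (negbTE bjk) ujk subrKC; field.
    by rewrite Sn0//= subr_eq0.
  + by move=> bjk; rewrite bjk eqxx subrKC.
  + move=> gt; rewrite (column_at1 (hup k) (Scol k z Sz)) ?mul0r//.
    by apply/asboolP; exists z; [exact: Ssec|rewrite Re_rate subr_gt0].
Qed.
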